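(* Suppose that $b$ and $\sigma$ satisfy the following two conditions. (i) There exist constants $K_1,K_2>0$ such that for all $x,y\in\mathbb{R}^d$ and $\mu,\nu\in\mathcal{P}_2(\mathbb{R}^d)$, $$2\langle x-y,b(x,\mu)-b(y,\nu)\rangle+\|\sigma(x,\mu)-\sigma(y,\nu)\|^2\leq -K_1|x-y|^2+K_2\mathbb{W}_2(\mu,\nu)^2.$$ (ii) There exist constants $a_1,a_2>0$ and $q\geq 2$ such that for all $x\in\mathbb{R}^d$ and $\mu\in\mathcal{P}_2(\mathbb{R}^d)$, $$2\langle x,b(x,\mu)\rangle+(q-1)\|\sigma(x,\mu)\|^2\leq -a_1|x|^2+a_2\mathcal{W}_2(\mu)^2.$$ If $a_1>a_2$, then the solution $X^{j,N}_t$ of the interacting particle system is exponentially stable in the mean-square sense, i.e., for any $j\in\mathbb{S}_N$ and some $a\in(0,a_1-a_2]$, $$\limsup_{t\to\infty}\frac1t\log\big(\mathbb{E}|X^{j,N}_t|^2\big)\leq -a.$$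
   Context: $(\Omega,\mathcal{F},(\mathcal{F}_t)_{t\ge0},\mathbb{P})$ is a complete filtered probability space satisfying the usual conditions. $|\cdot|$ is the Euclidean norm on $\mathbb{R}^d$ and $\|\cdot\|$ is the Frobenius norm on $\mathbb{R}^{d\times m}$. $\mathcal{P}_2(\mathbb{R}^d)$ is the set of probability measures on $\mathbb{R}^d$ with finite second moment, $\mathbb{W}_2$ is the 2-Wasserstein distance on it, and $\mathcal{W}_2(\mu)=\left(\int_{\mathbb{R}^d}|x|^2\mu(dx)\right)^{1/2}$. The coefficients $b:\mathbb{R}^d\times\mathcal{P}_2(\mathbb{R}^d)\to\mathbb{R}^d$ and $\sigma:\mathbb{R}^d\times\mathcal{P}_2(\mathbb{R}^d)\to\mathbb{R}^{d\times m}$ are Borel measurable and locally Lipschitz with respect to $x$. $X_0$ is a non-zero $\mathcal{F}_0$-measurable $\mathbb{R}^d$-valued random variable with $\mathbb{E}|X_0|^{p}<\infty$ for all $p\ge2$, and $W$ is an $m$-dimensional $(\mathcal{F}_t)$-Brownian motion. Let $N\geq 1$ be an integer, $\mathbb{S}_N=\{1,\dots,N\}$, and for $j\in\mathbb{S}_N$ let $(W^j,X_0^j)$ be independent copies of $(W,X_0)$. The interacting particle system is $$dX^{j,N}_t=b(X^{j,N}_t,\mu^{X,N}_t)\,dt+\sigma(X^{j,N}_t,\mu^{X,N}_t)\,dW^j_t,\quad X^{j,N}_0=X^j_0,\quad j\in\mathbb{S}_N,$$ where $\mu^{X,N}_t=\frac1N\sum_{i=1}^N\delta_{X^{i,N}_t}$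 is the empirical measure. *)

(* Defs.v *)
From HB Require Import structures.
From mathcomp Require Import all_boot all_order all_algebra.
From mathcomp Require Import all_classical all_reals all_analysis.
From mathcomp Require Import measurable_realfun.

Set Implicit Arguments.
Unset Strict Implicit.
Unset Printing Implicit Defensive.

Import Order.TTheory GRing.Theory Num.Theory.
Import numFieldNormedType.Exports.

Local Open Scope classical_set_scope.
Local Open Scope ring_scope.

Section euclidean.
Context {R : realType}.

Definition dotp (d : nat) (x y : 'rV[R]_d) : R := \sum_(i < d) x 0 i * y 0 i.

(* The library norm on 'rV and 'M is the sup norm, hence these two. *)
Definition enorm (d : nat) (x : 'rV[R]_d) : R := Num.sqrt (dotp x x).

Definition frob (d m : nat) (A : 'M[R]_(d, m)) : R :=
  Num.sqrt (\sum_(i < d) \sum_(k < m) A i k ^+ 2).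

Lemma enorm_ge0 d (x : 'rV[R]_d) : 0 <= enorm x.
Proof. exact: sqrtr_ge0. Qed.

Lemma enorm_continuous d : continuous (@enorm d).
Proof.
move=> x; apply: (@continuous_comp _ _ _ (fun y : 'rV[R]_d => dotp y y)).
  apply: (@continuous_big _ _ +%R 0 _ _ _ _ (fun i (y : 'rV[R]_d) => y 0 i * y 0 i)).
    exact: add_continuous.
  move=> i _ y; have cy : {for y, continuous (fun z : 'rV[R]_d => z 0 i)}.
    exact: coord_continuous.
  exact: (continuousM cy cy).
exact: sqrt_continuous.
Qed.

End euclidean.

(* 'rV[R]_d with its Borel sigma-algebra. *)
Notation borel_rV R d := (g_sigma_algebraType (@open 'rV[R]_d)).

Section wasserstein.
Context {R : realType} {d : nat}.
Local Notation Rd := (borel_rV R d).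

Lemma measurable_enorm :
  measurable_fun [set: Rd] (fun x : Rd => enorm (x : 'rV[R]_d) : R).
Proof.
apply: (measurability _ (RGenOpens.measurableE R)).
move=> _ [_ [r [s ->] <-]]; rewrite setTI; apply: sub_sigma_algebra.
move: (@enorm_continuous R d) => /continuousP; apply; exact: interval_open.
Qed.

Definition moment2 (mu : set Rd -> \bar R) : \bar R :=
  (\int[mu]_x (enorm (x : 'rV[R]_d) ^+ 2)%:E)%E.

Record P2 := mkP2 {
  P2_prob :> probability Rd R ;
  P2_moment : (moment2 P2_prob < +oo)%E }.

Definition calW2 (mu : P2) : R := Num.sqrt (fine (moment2 mu)).

Definition coupling (mu nu : P2) (pi : probability (Rd * Rd)%type R) : Prop :=
  forall A : set Rd, measurable A ->
    pi (A `*` setT) = mu A /\ pi (setT `*` A) = nu A.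

(* The infimum is finite on P2, so [fine] loses nothing. *)
Definition W2 (mu nu : P2) : R :=
  Num.sqrt (fine (ereal_inf
    [set (\int[pi]_z (enorm ((z.1 : 'rV[R]_d) - z.2) ^+ 2)%:E)%E
       | pi in coupling mu nu])).

(* Open sets of R^d x P2 for the product of |.| and W2. *)
Definition openP2 : set (set ('rV[R]_d * P2)) :=
  [set U | forall p, U p -> exists2 e : R, 0 < e &
     forall p' : 'rV[R]_d * P2,
       enorm (p.1 - p'.1) < e -> W2 p.2 p'.2 < e -> U p'].

Definition borel_coef (T : topologicalType) (f : 'rV[R]_d -> P2 -> T) : Prop :=
  forall B : set T, <<s @open T >> B -> <<s openP2 >> [set p | B (f p.1 p.2)].

(* The Lipschitz constant may depend on the measure argument. *)
Definition locally_lipschitz (m n : nat) (f : 'rV[R]_d -> P2 -> 'M[R]_(m, n)) :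
    Prop :=
  forall (mu : P2) (r : R), exists L : R, forall x y : 'rV[R]_d,
    enorm x <= r -> enorm y <= r ->
    frob (f x mu - f y mu) <= L * enorm (x - y).

End wasserstein.
Arguments P2 R d : clear implicits.

Section empirical_measure.
Context {R : realType} {d : nat} (N : nat) (hN : (0 < N)%N).
Variable x : 'I_N -> 'rV[R]_d.
Local Notation Rd := (borel_rV R d).

(* Indices k >= N, where nth returns its default value 0, are never used. *)
Let diracs (k : nat) : {measure set Rd -> \bar R} :=
  dirac (nth 0 [seq x i | i <- enum 'I_N] k : Rd).

Definition emp : set Rd -> \bar R :=
  mscale (N%:R^-1)%:nng (msum diracs N).

HB.instance Definition _ := Measure.on emp.

Lemma empE (A : set Rd) : emp A = (N%:R^-1 * \sum_(i < N) \1_A (x i))%:E.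
Proof.
rewrite /emp /mscale /= /msum EFinM; congr (_ * _)%E.
rewrite -sumEFin; apply: eq_bigr => i _.
by rewrite /diracs /= (nth_map i) ?size_enum_ord// nth_ord_enum.
Qed.

Let emp_setT : emp setT = 1%E.
Proof.
rewrite empE (eq_bigr (fun=> 1)) => [|i _]; last by rewrite indicT.
by rewrite sumr_const card_ord mulVf// pnatr_eq0 -lt0n.
Qed.

HB.instance Definition _ := Measure_isProbability.Build _ _ _ emp emp_setT.

Lemma emp_moment2 : (moment2 emp < +oo)%E.
Proof.
have mf : measurable_fun [set: Rd]
    (EFin \o (fun y : Rd => enorm (y : 'rV[R]_d) ^+ 2)).
  by apply/measurable_EFinP; apply: measurable_funX; exact: measurable_enorm.
have f0 (y : Rd) : setT y -> (0 <= (enorm (y : 'rV[R]_d) ^+ 2)%:E)%E.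
  by rewrite lee_fin sqr_ge0.
rewrite /moment2 ge0_integral_mscale//= ge0_integral_measure_sum//.
under eq_bigr => i _ do rewrite integral_dirac// diracT mul1e.
by rewrite sumEFin -EFinM ltry.
Qed.

Definition empirical : P2 R d := mkP2 emp_moment2.

End empirical_measure.

Section stochastic.
Context {R : realType} {dO : measure_display} {Om : measurableType dO}.
Variables (P : probability Om R) (F : R -> set (set Om)).

(* Processes are indexed by R; only times t >= 0 are constrained or used. *)

Record is_filtration : Prop := {
  filt_sigma : forall t, 0 <= t -> sigma_algebra setT (F t) ;
  filt_sub : forall t, 0 <= t -> F t `<=` measurable ;
  filt_mono : forall s t, 0 <= s -> s <= t -> F s `<=` F t }.

Record usual_conditions : Prop := {
  usual_complete : measure_is_complete P ;
  usual_null : P.-negligible `<=` F 0 ;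
  usual_right : forall t, 0 <= t -> \bigcap_(s in [set s | t < s]) F s `<=` F t }.

Definition measurable_wrt (T : topologicalType) (G : set (set Om))
    (f : Om -> T) : Prop :=
  forall B : set T, <<s @open T >> B -> G (f @^-1` B).

Definition adapted (T : topologicalType) (X : R -> Om -> T) : Prop :=
  forall t, 0 <= t -> measurable_wrt (F t) (X t).

Definition continuous_paths (T : topologicalType) (X : R -> Om -> T) : Prop :=
  {ae P, forall w, {within [set t : R | 0 <= t], continuous (X ^~ w)}}.

(* [bm_incr] states at once that W_t - W_s is independent of F_s and that its
   law is N(0, (t - s) I_m); [normal_prob] takes the standard deviation. *)
Record brownian_motion (m : nat) (W : R -> Om -> 'rV[R]_m) : Prop := {
  bm_adapted : adapted W ;
  bm_paths : continuous_paths W ;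
  bm_start : {ae P, forall w, W 0 w = 0} ;
  bm_incr : forall s t, 0 <= s -> s < t ->
    forall (A : set Om) (B : 'I_m -> set R), F s A ->
      (forall k, measurable (B k)) ->
      P (A `&` \bigcap_k [set w | B k (W t w 0 k - W s w 0 k)]) =
      (P A * \prod_(k < m) normal_prob 0 (Num.sqrt (t - s)) (B k))%E }.

(* Convergence to 0 in probability of nonnegative random variables. *)
Definition cvg_prob0 (Z : nat -> Om -> \bar R) : Prop :=
  (forall n, measurable_fun setT (Z n)) /\
  forall e : R, 0 < e ->
    P [set w | (e%:E <= Z n w)%E] @[n --> \oo] --> 0%E.

(* The process sum_(i < n) xi_i 1_{(t_i, t_(i+1)]}. *)
Record simple_process := SimpleProcess {
  sp_size : nat ;
  sp_time : nat -> R ;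
  sp_coef : nat -> Om -> R }.

Record simple_adapted (S : simple_process) : Prop := {
  sa_time0 : 0 <= sp_time S 0 ;
  sa_mono : {homo sp_time S : i j / (i <= j)%N >-> i <= j} ;
  sa_coef : forall i, (i < sp_size S)%N ->
    measurable_wrt (F (sp_time S i)) (sp_coef S i) ;
  sa_bound : exists M : R, forall i w, (i < sp_size S)%N ->
    `|sp_coef S i w| <= M }.

Definition sp_val (S : simple_process) (s : R) (w : Om) : R :=
  \sum_(i < sp_size S)
    sp_coef S i w * (sp_time S i < s <= sp_time S i.+1)%R%:R.

Definition sp_int (S : simple_process) (B : R -> Om -> R) (t : R) (w : Om) : R :=
  \sum_(i < sp_size S) sp_coef S i w *
    (B (Num.min (sp_time S i.+1) t) w - B (Num.min (sp_time S i) t) w).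

(* Y is (a continuous version of) the Ito integral of H against the real
   Brownian motion B: the limit in probability of integrals of simple adapted
   processes that approximate H in L^2(0,t), in probability, for every t. *)
Definition ito_integral (B H Y : R -> Om -> R) : Prop :=
  [/\ adapted Y, continuous_paths Y,
      {ae P, forall w t, 0 <= t ->
        (\int[lebesgue_measure]_(s in `[0%R, t]) (H s w ^+ 2)%:E < +oo)%E} &
      exists S : nat -> simple_process,
        (forall n, simple_adapted (S n)) /\
        forall t, 0 <= t ->
          cvg_prob0 (fun n w => \int[lebesgue_measure]_(s in `[0%R, t])
            ((sp_val (S n) s w - H s w) ^+ 2)%:E)%E /\
          cvg_prob0 (fun n w => `|sp_int (S n) B t w - Y t w|%:E)].

(* Cylinder sigma-algebra on paths x R^d, generated by the coordinates at times
   t >= 0 and by the R^d component; [start] packs (W, X0) as a random element. *)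
Definition path_sigma (m d : nat) : set (set ((R -> 'rV[R]_m) * 'rV[R]_d)) :=
  <<s [set C | (exists t (A : set 'rV[R]_m),
                  [/\ 0 <= t, <<s @open 'rV[R]_m >> A &
                      C = [set p | A (p.1 t)]]) \/
               (exists2 A : set 'rV[R]_d, <<s @open 'rV[R]_d >> A &
                      C = [set p | A p.2])] >>.

Definition start (m d : nat) (W : R -> Om -> 'rV[R]_m) (X0 : Om -> 'rV[R]_d)
  (w : Om) : (R -> 'rV[R]_m) * 'rV[R]_d := (W ^~ w, X0 w).

Record independent_copies (m d N : nat)
    (W : R -> Om -> 'rV[R]_m) (X0 : Om -> 'rV[R]_d)
    (Wj : 'I_N -> R -> Om -> 'rV[R]_m) (X0j : 'I_N -> Om -> 'rV[R]_d) : Prop := {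
  ic_law : forall j (A : set ((R -> 'rV[R]_m) * 'rV[R]_d)), path_sigma A ->
    P (start (Wj j) (X0j j) @^-1` A) = P (start W X0 @^-1` A) ;
  ic_indep : forall A : 'I_N -> set ((R -> 'rV[R]_m) * 'rV[R]_d),
    (forall j, path_sigma (A j)) ->
    P (\bigcap_j (start (Wj j) (X0j j) @^-1` A j)) =
    (\prod_(j < N) P (start (Wj j) (X0j j) @^-1` A j))%E }.

Section particle_system.
Context {d m N : nat} (hN : (0 < N)%N).
Variables (b : 'rV[R]_d -> P2 R d -> 'rV[R]_d)
          (sigma : 'rV[R]_d -> P2 R d -> 'M[R]_(d, m))
          (W : 'I_N -> R -> Om -> 'rV[R]_m) (X0 : 'I_N -> Om -> 'rV[R]_d).

Definition particle_system (X : 'I_N -> R -> Om -> 'rV[R]_d) : Prop :=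
  let mu s w := empirical hN (fun i => X i s w) in
  forall j : 'I_N,
  [/\ adapted (X j), continuous_paths (X j),
      {ae P, forall w t i, 0 <= t ->
         lebesgue_measure.-integrable `[0%R, t]
           (fun s => (b (X j s w) (mu s w) 0 i)%:E)} &
      exists I : 'I_d -> 'I_m -> R -> Om -> R,
        (forall i k, ito_integral (fun t w => W j t w 0 k)
           (fun s w => sigma (X j s w) (mu s w) i k) (I i k)) /\
        {ae P, forall w t i, 0 <= t ->
           X j t w 0 i = X0 j w 0 i
             + \int[lebesgue_measure]_(s in `[0%R, t]) b (X j s w) (mu s w) 0 i
             + \sum_(k < m) I i k t w}].

End particle_system.
End stochastic.

(* Main.v *)
(* Write lambda = a1 - a2.  Summing (ii) over the particles and using that the
   second moment of the empirical measure is the average of |X^j|^2, the vector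
   of all coordinates of all particles satisfies pathwise
     2 <x, beta> + |Sigma|^2 <= - lambda |x|^2,
   so that formally e^{lambda t} E|x_t|^2 is nonincreasing; hence a = lambda.

   No Ito formula is available, so this is proved on the grid T l / (r + 1).
   There the stochastic integrals are replaced by integrals of simple processes
   that are 2^-r close, and x by Z = x0 + (drift) + (simple integral).  A 0/1
   factor rho, which switches to 0 once Z is far from x or once x or the
   variation of the drift exceeds K, makes every expectation finite.
   Expanding |Z_{l+1}|^2 and using that the simple integral is a martingale
   with bracket Q bounds e^{lambda T} E[rho |Z_T|^2] by E|x0|^2 plus the
   expectation of a Riemann sum of lambda |Z|^2 + 2 <Z, beta> + dQ/dt.  By
   dissipativity the upper limit of that sum is <= 0 on almost every path as
   r tends to infinity, up to a term which a parameter eta makes small, and the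
   sum is bounded above uniformly in r.  Fatou's lemma then lets K and r tend to
   infinity together. *)
Require Import Defs.
From HB Require Import structures.
From mathcomp Require Import all_boot all_order all_algebra.
From mathcomp Require Import all_classical all_reals all_analysis.
From mathcomp Require Import measurable_realfun.
From mathcomp Require Import ring lra.

Set Implicit Arguments.
Unset Strict Implicit.
Unset Printing Implicit Defensive.

Import Order.TTheory GRing.Theory Num.Theory.
Import numFieldNormedType.Exports.

Local Open Scope classical_set_scope.
Local Open Scope ring_scope.

(** * Real-valued integrals *)

(** The obstacle is how little is known of the solution. No moment of [X] at a positive time is
    assumed finite, and its stochastic integrals are only limits in probability, so neither
    expectations nor the martingale property can be used on x directly. The process Z keeps the
    exact drift increments of x, while its martingale increments can be computed from the Gaussian
    law of Brownian increments. Conditional expectations are replaced by tests against bounded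
    F_s-measurable factors.

    Stopping acts at grid times only: the factor is decided at the left end of each cell and
    decreases with the index, which lets the one-step estimates telescope.

    The parameter eta is the price of a drift increment that is known only at the end of its cell
    and may therefore be correlated with the martingale increment. Its cost is eta times a bracket,
    and the bracket is bounded in terms of K through the truncation of the simple integrands. Hence
    eta is chosen after K, and r after both. *)

Section real_integrable.
Context {d} {T : measurableType d} {R : realType}.
Variables (mu : {measure set T -> \bar R}) (D : set T).
Hypothesis mD : measurable D.
Local Notation L1 f := (mu.-integrable D (EFin \o f)).
Implicit Types f g : T -> R.

Lemma Rintegrable_meas f : L1 f -> measurable_fun D f.
Proof. by move=> /measurable_int /measurable_EFinP. Qed.

Lemma eq_Rintegrable f g : L1 f -> (forall x, f x = g x) -> L1 g.
Proof. by move=> If fg; rewrite (_ : g = f) //; apply/funext => x. Qed.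

Lemma RintegrableD f g : L1 f -> L1 g -> L1 (fun x => f x + g x).
Proof. by move=> If Ig; apply: eq_integrable (integrableD mD If Ig). Qed.

Lemma RintegrableN f : L1 f -> L1 (fun x => - f x).
Proof. by move=> If; apply: eq_integrable (integrableN If). Qed.

Lemma RintegrableB f g : L1 f -> L1 g -> L1 (fun x => f x - g x).
Proof. by move=> If Ig; apply: RintegrableD => //; exact: RintegrableN. Qed.

Lemma RintegrableZ (k : R) f : L1 f -> L1 (fun x => k * f x).
Proof. by move=> If; apply: eq_integrable (integrableZl mD k If). Qed.

Lemma Rintegrable0 : L1 (fun=> 0).
Proof. by apply: eq_integrable (integrable0 _ _). Qed.

Lemma Rintegrable_sum (I : Type) (s : seq I) (f : I -> T -> R) :
  (forall i, L1 (f i)) -> L1 (fun x => \sum_(i <- s) f i x).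
Proof.
move=> If; elim: s => [|i s IH].
  by apply: eq_integrable Rintegrable0 => // x _; rewrite /= big_nil.
apply: eq_integrable (RintegrableD (If i) IH) => // x _.
by rewrite /= big_cons.
Qed.

Lemma le_Rintegrable f g : measurable_fun D f ->
  (forall x, D x -> `|f x| <= g x) -> L1 g -> L1 f.
Proof.
move=> mf fg; apply: le_integrable => //; first exact/measurable_EFinP.
by move=> x Dx /=; rewrite lee_fin (le_trans (fg _ Dx)) ?ler_norm.
Qed.

Lemma Rintegral_sum (I : Type) (s : seq I) (f : I -> T -> R) :
  (forall i, L1 (f i)) ->
  \int[mu]_(x in D) (\sum_(i <- s) f i x) =
  \sum_(i <- s) \int[mu]_(x in D) f i x.
Proof.
move=> If; elim: s => [|i s IH].
  under eq_Rintegral do rewrite big_nil.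
  by rewrite big_nil Rintegral_cst// mul0r.
under eq_Rintegral do rewrite big_cons.
by rewrite RintegralD// ?big_cons ?IH//; exact: Rintegrable_sum.
Qed.

Lemma Rintegral_dominated (f_ : nat -> T -> R) f g :
  (forall n, measurable_fun D (f_ n)) -> measurable_fun D f ->
  {ae mu, forall x, D x -> f_ ^~ x @ \oo --> f x} -> L1 g ->
  {ae mu, forall x n, D x -> `|f_ n x| <= g x} ->
  \int[mu]_(x in D) f_ n x @[n --> \oo] --> \int[mu]_(x in D) f x.
Proof.
move=> mf_ mf f_f Ig f_g.
have f_f' : {ae mu, forall x, D x ->
    (EFin \o f_ n) x @[n --> \oo] --> (EFin \o f) x}.
  apply: filterS f_f => x h Dx; by apply/cvg_EFin; [exact: nearW|exact: h].
have f_g' : {ae mu, forall x n, D x -> (`|(EFin \o f_ n) x| <= (EFin \o g) x)%E}.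
  by apply: filterS f_g => x h n Dx; rewrite lee_fin h.
have [If _ cv] := dominated_convergence mD
  (fun n => (measurable_EFinP _ _).2 (mf_ n)) ((measurable_EFinP _ _).2 mf)
  f_f' Ig f_g'.
by apply: fine_cvg; rewrite fineK//; exact: integrable_fin_num.
Qed.

End real_integrable.

(** * Change of measure by a density *)

Section density.
Context d (T : measurableType d) {R : realType}.
Variables (mu nu : {measure set T -> \bar R}) (g : T -> R).
Hypotheses (mg : measurable_fun setT g) (g0 : forall x, 0 <= g x).
Hypothesis nuE : forall A, measurable A -> nu A = (\int[mu]_(x in A) (g x)%:E)%E.

Import HBNNSimple.

(** Indicators by [nuE], simple functions by linearity, then monotone convergence. Used for the
    Gaussian density and, with an indicator as density, for restricted measures. *)
Lemma ge0_integral_density (f : T -> \bar R) :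
  measurable_fun setT f -> (forall x, 0 <= f x)%E ->
  (\int[nu]_x f x = \int[mu]_x (f x * (g x)%:E))%E.
Proof.
move=> mf f0; pose f_ := nnsfun_approx measurableT mf.
have cf x : EFin (f_ n x) @[n --> \oo] --> f x.
  exact: (cvg_nnsfun_approx measurableT mf (fun x _ => f0 x)).
have fg0 n x : (0 <= (f_ n x)%:E * (g x)%:E)%E by rewrite -EFinM lee_fin mulr_ge0.
have mfg n : measurable_fun setT (fun x => (f_ n x)%:E * (g x)%:E)%E.
  by apply: emeasurable_funM; exact/measurable_EFinP.
transitivity (limn (fun n => \int[nu]_x (f_ n x)%:E)%E).
  rewrite -monotone_convergence//.
  - by apply: eq_integral => y _; apply/esym/cvg_lim.
  - by move=> n; exact/measurable_EFinP/measurable_funP.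
  - by move=> n y _; rewrite lee_fin.
  - by move=> y _ m n mn; rewrite lee_fin; exact/lefP/nd_nnsfun_approx.
transitivity (limn (fun n => \int[mu]_x ((f_ n x)%:E * (g x)%:E))%E); last first.
  rewrite -monotone_convergence//.
  - apply: eq_integral => y _; apply/cvg_lim => //.
    exact: cvgeZr.
  - by move=> y _ m n mn; rewrite lee_wpmul2r ?lee_fin//; exact/lefP/nd_nnsfun_approx.
apply: (congr1 (fun h : nat -> \bar R => limn h)); apply/funext => n.
transitivity (\sum_(k \in range (f_ n)) \int[nu]_x (k * \1_(f_ n @^-1` [set k]) x)%:E)%E.
  under eq_integral do rewrite fimfunE -fsumEFin//.
  rewrite ge0_integral_fsum//.
  - by move=> y; exact/measurable_EFinP/measurable_funM.
  - by move=> y x _; rewrite nnfun_muleindic_ge0.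
transitivity (\int[mu]_x (\sum_(k \in range (f_ n))
    ((k * \1_(f_ n @^-1` [set k]) x)%:E * (g x)%:E)))%E; last first.
  apply: eq_integral => x _; rewrite [in RHS]fimfunE -fsumEFin//.
  rewrite ge0_mule_fsuml// => r; exact: nnfun_muleindic_ge0.
rewrite ge0_integral_fsum//; last 2 first.
  - move=> y; apply: emeasurable_funM; apply/measurable_EFinP => //.
    exact: measurable_funM.
  - by move=> y x _; apply: mule_ge0; [exact: nnfun_muleindic_ge0|rewrite lee_fin].
apply: eq_fsbigr => r /[!inE] -[x _ <-].
rewrite integralZl_indic_nnsfun// integral_indic//= setIT nuE//.
under [RHS]eq_integral do rewrite EFinM -muleA.
rewrite ge0_integralZl//.
- rewrite integral_mkcond; congr (_ * _)%E; apply: eq_integral => y _.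
  rewrite patchE indicE; case: ifP => _; first by rewrite mul1e.
  by rewrite mul0e.
- by apply: emeasurable_funM; exact/measurable_EFinP.
- by move=> y _; rewrite mule_ge0// lee_fin.
- by rewrite lee_fin.
Qed.

End density.

(** * Second moments of normal laws *)

Section normal_moments.
Context {R : realType}.
Variable s : R.
Hypothesis s0 : s != 0.
Local Notation mu := (@lebesgue_measure R).
Local Notation N := (normal_prob 0 s).

Lemma normal_pdf_expR x : normal_pdf 0 s x =
  normal_peak s * expR (- x ^+ 2 / (s ^+ 2 *+ 2)).
Proof. by rewrite normal_pdfE// /normal_fun subr0. Qed.

Lemma is_derive_normal_pdf (x : R) :
  is_derive x 1 (normal_pdf 0 s) (- x / s ^+ 2 * normal_pdf 0 s x).
Proof.
rewrite (_ : normal_pdf 0 s = (fun x => normal_peak s * expR (- x ^+ 2 / (s ^+ 2 *+ 2)))); last first.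
  by apply/funext => y; rewrite normal_pdf_expR.
apply: is_derive_eq.
rewrite /GRing.scale /=.
have s2 : s ^+ 2 *+ 2 != 0 by rewrite mulrn_eq0/= expf_eq0.
field. by rewrite s0.
Qed.

Lemma ge0_integral_normal_prob (f : R -> \bar R) :
  measurable_fun setT f -> (forall x, 0 <= f x)%E ->
  (\int[N]_x f x = \int[mu]_x (f x * (normal_pdf 0 s x)%:E))%E.
Proof.
move=> mf f0; apply: ge0_integral_density => //.
- exact: measurable_normal_pdf.
- exact: normal_pdf_ge0.
Qed.

(** Integration by parts on [[-n, n]]: [- s ^+ 2] times the density is a primitive of [x] times the
    density. The boundary terms are nonpositive, and what remains is [s ^+ 2] times a mass at most
    1. *)
Lemma normal_prob_sqr_le : (\int[N]_x (x ^+ 2)%:E <= (s ^+ 2)%:E)%E.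
Proof.
have mp := measurable_normal_pdf 0 s.
have cp : continuous (normal_pdf 0 s) by exact: continuous_normal_pdf.
rewrite ge0_integral_normal_prob//; last 2 first.
- by apply/measurable_EFinP; exact: measurable_funX.
- by move=> x; rewrite lee_fin sqr_ge0.
have UT : \bigcup_(n : nat) `[- n%:R, n%:R]%classic = [set: R].
  rewrite -subTset => x _; exists (Num.Def.truncn `|x|).+1 => //=.
  by rewrite in_itv/= -ler_norml ltW// truncnS_gt.
pose f x := ((x ^+ 2)%:E * (normal_pdf 0 s x)%:E)%E.
have mf : measurable_fun setT f.
  by apply: emeasurable_funM; apply/measurable_EFinP => //; exact: measurable_funX.
have f0 x : (0 <= f x)%E by rewrite /f -EFinM lee_fin mulr_ge0 ?sqr_ge0 ?normal_pdf_ge0.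
have cvf : (\int[mu]_(x in `[(- n%:R)%R, n%:R]) f x)%E @[n --> \oo] --> (\int[mu]_x f x)%E.
  rewrite -UT; apply: ge0_nondecreasing_set_cvg_integral => //.
  - move=> m n mn; apply/subsetPset => x /=; rewrite !in_itv/= => /andP[a b].
    by rewrite (le_trans _ a) ?(le_trans b)// ?lerN2 ler_nat.
  - by move=> i; exact: measurable_funS mf.
rewrite -(cvg_lim _ cvf)//; apply: lime_le; first by apply/cvg_ex; eexists; exact: cvf.
apply: nearW => n.
(* Integration by parts asks for a nondegenerate interval, so [n = 0] is treated apart. *)
case: n => [|n].
  by rewrite oppr0 set_itv1 integral_set1 lee_fin sqr_ge0.
have nn : - n.+1%:R < n.+1%:R :> R by rewrite gtrN// ltr0n.
have cg : continuous (fun x : R => x * normal_pdf 0 s x).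
  by move=> x; apply: continuousM; [exact: cvg_id|exact: cp].
have dG (x : R) : is_derive x 1 (fun x : R => - s ^+ 2 * normal_pdf 0 s x) (x * normal_pdf 0 s x).
  have ? := is_derive_normal_pdf x.
  apply: is_derive_eq; rewrite /GRing.scale/=; field; exact: s0.
have cG : continuous (fun x : R => - s ^+ 2 * normal_pdf 0 s x).
  by move=> x; apply: cvgM; [exact: cvg_cst|exact: cp].
have LR (h : R -> R) : continuous h -> (forall x, derivable h x 1) ->
    derivable_oo_LRcontinuous h (- n.+1%:R) n.+1%:R.
  move=> ch dh; split; first by move=> x _; exact: dh.
  - exact: cvg_at_right_filter (ch _).
  - exact: cvg_at_left_filter (ch _).
have -> : (\int[mu]_(x in `[(- n.+1%:R)%R, n.+1%:R]) f x =
    \int[mu]_(x in `[(- n.+1%:R)%R, n.+1%:R]) (x * (x * normal_pdf 0 s x))%:E)%E.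
  by apply: eq_integral => x _; rewrite /f -EFinM expr2 mulrA.
rewrite (@integration_by_parts R id (fun x => - s ^+ 2 * normal_pdf 0 s x)
   (fun=> 1) (fun x => x * normal_pdf 0 s x) (- n.+1%:R) n.+1%:R nn)//; first last.
- by move=> x _; rewrite derive1E; exact: derive_val.
- by apply: LR => // x; exact: ex_derive.
- exact: continuous_subspaceT.
- by move=> x _; rewrite derive1E derive_id.
- by apply: LR => // x; exact: cvg_id.
- by apply: continuous_subspaceT => x; exact: cvg_cst.
under [X in (_ - X)%E]eq_integral do rewrite mul1r mulNr EFinN.
rewrite integral_ge0N; last first.
  by move=> x _; rewrite lee_fin mulr_ge0 ?sqr_ge0 ?normal_pdf_ge0.
rewrite oppeK.
apply: (@le_trans _ _ (0 + (s ^+ 2)%:E)%E); last by rewrite add0e.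
apply: leeD.
  rewrite lee_fin subr_le0.
  have := normal_pdf_ge0 0 s n.+1%:R; have := normal_pdf_ge0 0 s (- n.+1%:R).
  have n0 : 0 <= n.+1%:R :> R by [].
  have s2 := sqr_ge0 s.
  move=> p q; apply: (@le_trans _ _ 0).
    rewrite mulNr mulrN oppr_le0. exact: mulr_ge0 n0 (mulr_ge0 s2 q).
  rewrite !mulNr mulrN opprK; exact: mulr_ge0 n0 (mulr_ge0 s2 p).
under eq_integral do rewrite EFinM.
rewrite ge0_integralZl//; first last.
- by rewrite lee_fin sqr_ge0.
- by move=> x _; rewrite lee_fin normal_pdf_ge0.
- by apply/measurable_EFinP; exact: measurable_funS mp.
rewrite -[leRHS]mule1 lee_wpmul2l ?lee_fin ?sqr_ge0//.
rewrite -(integral_normal_pdf 0 s); apply: ge0_subset_integral => //.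
- exact/measurable_EFinP.
- by move=> x _; rewrite lee_fin normal_pdf_ge0.
Qed.

(** The density is even and Lebesgue measure is invariant under reflection; this symmetry is the
    source of the zero mean of Brownian increments. *)
Lemma ge0_integral_normal_probN (f : R -> \bar R) :
  measurable_fun setT f -> (forall x, 0 <= f x)%E ->
  (\int[N]_x f (- x)%R = \int[N]_x f x)%E.
Proof.
move=> mf f0.
have mp := measurable_normal_pdf 0 s.
have mN : measurable_fun [set: R] (-%R : R -> measurableTypeR R) by exact: oppr_measurable.
rewrite !ge0_integral_normal_prob//; last exact: (measurableT_comp mf).
rewrite (_ : (fun x => f (- x)%R * (normal_pdf 0 s x)%:E)%E =
  (fun x => f x * (normal_pdf 0 s x)%:E)%E \o (-%R : R -> measurableTypeR R)); last first.
  by apply/funext => x /=; rewrite !normal_pdf_expR sqrrN.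
transitivity (\int[pushforward mu (-%R : R -> measurableTypeR R)]_x
    (f x * (normal_pdf 0 s x)%:E))%E.
  rewrite ge0_integral_pushforward//.
  - by apply: emeasurable_funM => //; exact/measurable_EFinP.
  - by move=> x _; rewrite mule_ge0// lee_fin normal_pdf_ge0.
by apply: eq_measure_integral => A mA _; exact: lebesgue_measureN.
Qed.

End normal_moments.

Lemma ler_norm_indicM (R : realType) (T : Type) (A : set T) (w : T) (y : R) :
  `|\1_A w * y| <= `|y|.
Proof. by rewrite indicE; case: (_ \in _); rewrite ?mul1r// mul0r normr0. Qed.

(** * A Gaussian variable independent of an event *)

Section normal_factor.
Context d {Om : measurableType d} {R : realType}.
Variables (P : probability Om R) (A : set Om) (X : Om -> R) (s : R).
Hypotheses (s0 : s != 0) (mA : measurable A) (mX : measurable_fun setT X).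
Hypothesis fac : forall B, measurable B ->
  P (A `&` X @^-1` B) = (P A * normal_prob 0 s B)%E.

(** By [fac], the image under [X] of the restriction of [P] to [A] is the normal law scaled by
    [P A]. *)
Lemma ge0_integral_normal_factor (f : R -> \bar R) :
  measurable_fun setT f -> (forall x, 0 <= f x)%E ->
  (\int[P]_w (f (X w) * (\1_A w)%:E) = P A * \int[normal_prob 0 s]_x f x)%E.
Proof.
move=> mf f0.
have PA0 : 0 <= fine (P A) by rewrite fine_ge0.
have PAE : P A = (fine (P A))%:E by rewrite fineK// fin_num_measure.
rewrite -(@ge0_integral_density _ _ _ P (mrestr P mA)); first last.
- by move=> x; exact: f0.
- exact: measurableT_comp.
- by move=> B mB; rewrite integral_indic//= /mrestr setIC.
- by move=> x; rewrite indicE.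
- exact: measurable_indic.
transitivity (\int[pushforward (mrestr P mA) (X : Om -> measurableTypeR R)]_y f y)%E.
  by rewrite ge0_integral_pushforward.
transitivity (\int[mscale (NngNum PA0) (normal_prob 0 s)]_y f y)%E.
  apply: eq_measure_integral => B mB _.
  by rewrite -[RHS]/((fine (P A))%:E * normal_prob 0 s B)%E -PAE -fac// setIC.
by rewrite ge0_integral_mscale//= -PAE.
Qed.

Lemma normal_factor_L2 : P.-integrable setT (fun w => (\1_A w * X w ^+ 2)%:E).
Proof.
apply/integrableP; split.
  apply/measurable_EFinP; apply: measurable_funM; first exact: measurable_indic.
  exact: measurable_funX.
rewrite (_ : (fun w => _) = (fun w => ((X w ^+ 2)%:E * (\1_A w)%:E)%E)); last first.
  apply/funext => w; rewrite /= ger0_norm ?EFinM; first by rewrite muleC.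
  by rewrite mulr_ge0 ?sqr_ge0// indicE.
rewrite (@ge0_integral_normal_factor (fun x => (x ^+ 2)%:E)); last 2 first.
- by apply/measurable_EFinP; exact: measurable_funX.
- by move=> x; rewrite lee_fin sqr_ge0.
rewrite -ge0_fin_numE ?mule_ge0 ?integral_ge0// => [|x _]; last first.
  by rewrite lee_fin sqr_ge0.
rewrite fin_numM ?fin_num_measure// ge0_fin_numE ?integral_ge0// => [|x _]; last first.
  by rewrite lee_fin sqr_ge0.
by rewrite (le_lt_trans (normal_prob_sqr_le s0))// ltry.
Qed.

(** Positive and negative parts have the same integral, by symmetry of the normal law. *)
Lemma normal_factor_mean : (\int[P]_w (\1_A w * X w))%R = 0.
Proof.
pose p : R -> \bar R := fun x => (Num.max x 0)%:E.
have mp : measurable_fun setT p.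
  by apply/measurable_EFinP; exact: (@measurable_funrpos _ _ _ setT id).
have p0 x : (0 <= p x)%E by rewrite lee_fin le_max lexx orbT.
have mA1 : measurable_fun setT (\1_A : Om -> R) by exact: measurable_indic.
have E1 := ge0_integral_normal_factor mp p0.
have E2 := @ge0_integral_normal_factor (p \o -%R) _ (fun x => p0 _).
rewrite ge0_integral_normal_probN// in E2.
have mpN : measurable_fun setT (p \o -%R).
  by apply: measurableT_comp => //; exact: oppr_measurable.
have {}E2 := E2 mpN.
rewrite /Rintegral integralE -[RHS](subrr (0:R)).
have -> : (\int[P]_w (EFin \o (fun w => (\1_A w * X w)%R))^\+ w
    = P A * \int[normal_prob 0 s]_x p x)%E.
  rewrite -E1; apply: eq_integral => w _.
  rewrite funeposE /p /= indicE; case: (_ \in _); rewrite ?mul1r ?mul0r ?mule1 ?mule0.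
    by rewrite -EFin_max.
  by rewrite maxxx.
have -> : (\int[P]_w (EFin \o (fun w => (\1_A w * X w)%R))^\- w
    = P A * \int[normal_prob 0 s]_x p x)%E.
  rewrite -E2; apply: eq_integral => w _.
  rewrite funenegE /p /= indicE; case: (_ \in _); rewrite ?mul1r ?mul0r ?mule1 ?mule0.
    by rewrite -EFin_max.
  by rewrite oppr0 maxxx.
(* Were the common value infinite, the difference would be an infinity, which [fine] sends to 0. *)
case: (P A * _)%E => [r| |] //=; by rewrite ?subrr// subr0.
Qed.

Lemma normal_factor_sqr :
  (\int[P]_w (\1_A w * X w ^+ 2) <= s ^+ 2 * \int[P]_w \1_A w)%R.
Proof.
rewrite /Rintegral.
rewrite (_ : (fun w => _) = (fun w => ((X w ^+ 2)%:E * (\1_A w)%:E)%E)); last first.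
  by apply/funext => w; rewrite -EFinM mulrC.
rewrite (@ge0_integral_normal_factor (fun x => (x ^+ 2)%:E)); last 2 first.
- by apply/measurable_EFinP; exact: measurable_funX.
- by move=> x; rewrite lee_fin sqr_ge0.
have fN : (\int[normal_prob 0 s]_x (x ^+ 2)%:E)%E \is a fin_num.
  rewrite ge0_fin_numE ?integral_ge0// => [|x _].
    by rewrite (le_lt_trans (normal_prob_sqr_le s0))// ltry.
  by rewrite lee_fin sqr_ge0.
rewrite fineM ?fin_num_measure// integral_indic// setIT mulrC.
rewrite ler_wpM2r ?fine_ge0//.
by rewrite -lee_fin fineK// normal_prob_sqr_le.
Qed.

End normal_factor.

(** * From events to measurable multipliers *)

Section level_sets.
Context d {Om : measurableType d} {R : realType}.
Variables (P : probability Om R).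
Local Notation L1 f := (P.-integrable setT (EFin \o f)).

Import HBNNSimple.

(** Independence is given on events only. This carries a sign from the level sets of [G] to the
    multiplier [G], doing the work of a conditional expectation: simple functions of [G] increase to
    [G], and the products are dominated by [|G Y|]. *)
Lemma Rintegral_mul_ge0 (G Y : Om -> R) :
  measurable_fun setT G -> (forall w, 0 <= G w) -> L1 Y -> L1 (fun w => G w * Y w) ->
  (forall B : set R, measurable B -> 0 <= \int[P]_w (\1_(G @^-1` B) w * Y w)) ->
  0 <= \int[P]_w (G w * Y w).
Proof.
move=> mG G0 IY IGY H.
(* The approximation is made on the real line and then composed with [G], so that its level sets are
   preimages under [G] of Borel sets. *)
pose p : R -> \bar R := fun x => (Num.max x 0)%:E.
have mp : measurable_fun setT p.
  by apply/measurable_EFinP; exact: (@measurable_funrpos _ _ _ setT id).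
have p0 x : setT x -> (0 <= p x)%E by rewrite lee_fin le_max lexx orbT.
pose h := nnsfun_approx measurableT mp.
have ch x : h n x @[n --> \oo] --> Num.max x 0.
  by have /fine_cvg := cvg_nnsfun_approx measurableT mp p0 (x:=x) Logic.I.
have hle n x : h n x <= Num.max x 0.
  rewrite -(cvg_lim _ (ch x))//; apply: nondecreasing_cvgn_le.
    by move=> a b ab; exact/lefP/nd_nnsfun_approx.
  by apply/cvg_ex; eexists; exact: ch.
have GE w : Num.max (G w) 0 = G w by apply/max_idPl.
have mY := Rintegrable_meas IY.
have mh n : measurable_fun setT (fun w => h n (G w) * Y w).
  by apply: measurable_funM => //; apply: measurableT_comp.
have cv : \int[P]_w (h n (G w) * Y w) @[n --> \oo] --> \int[P]_w (G w * Y w).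
  apply: (Rintegral_dominated measurableT mh (Rintegrable_meas IGY)
    (g := fun w => `|G w * Y w|)).
  - apply: aeW => w _; apply: cvgMl; rewrite -[X in _ --> X]GE; exact: ch.
  - exact: (integrable_norm IGY).
  - apply: aeW => w n _; rewrite !normrM ler_wpM2r// ger0_norm//.
    by rewrite ger0_norm// -[leRHS]GE hle.
rewrite -(cvg_lim _ cv)//; apply: limr_ge; first by apply/cvg_ex; eexists; exact: cv.
apply: nearW => n.
have mI r : measurable (G @^-1` (h n @^-1` [set r])).
  by rewrite -[X in measurable X]setTI; apply: mG.
have I1 r : L1 (fun w => r * (\1_(G @^-1` (h n @^-1` [set r])) w * Y w)).
  apply: RintegrableZ => //; apply: le_Rintegrable (integrable_norm IY) => //.
    by apply: measurable_funM => //; exact: measurable_indic.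
  by move=> w _; exact: ler_norm_indicM.
rewrite (_ : (fun w => _) = (fun w => \sum_(r <- finmap.enum_fset (fset_set (range (h n))))
   (r * (\1_(G @^-1` (h n @^-1` [set r])) w * Y w)))); last first.
  apply/funext => w; rewrite fimfunE fsbig_finite//= mulr_suml.
  by apply: eq_bigr => r _; rewrite mulrA.
rewrite Rintegral_sum// big_seq; apply: sumr_ge0 => r.
rewrite in_fset_set// inE => -[x _ <-].
rewrite RintegralZl//.
  by rewrite mulr_ge0//; exact: H.
apply: le_Rintegrable (integrable_norm IY) => //.
  by apply: measurable_funM => //; exact: measurable_indic.
by move=> w _; exact: ler_norm_indicM.
Qed.

End level_sets.

Section level_sets_eq.
Context d {Om : measurableType d} {R : realType}.
Variables (P : probability Om R).
Local Notation L1 f := (P.-integrable setT (EFin \o f)).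

(** As [G] has no sign, [Rintegral_mul_ge0] is applied to its positive and negative parts, against
    both [Y] and [- Y]. *)
Lemma Rintegral_mul_eq0 (G Y : Om -> R) :
  measurable_fun setT G -> L1 Y -> L1 (fun w => G w * Y w) ->
  (forall B : set R, measurable B -> \int[P]_w (\1_(G @^-1` B) w * Y w) = 0) ->
  \int[P]_w (G w * Y w) = 0.
Proof.
move=> mG IY IGY H.
have I1 (g : R -> R) : measurable_fun setT g -> (forall x, 0 <= g x <= `|x|) ->
    L1 (fun w => g (G w) * Y w) /\ \int[P]_w (g (G w) * Y w) = 0.
  move=> mg g01.
  have mgG : measurable_fun setT (fun w => g (G w)) by exact: measurableT_comp.
  have mgGY : measurable_fun setT (fun w => g (G w) * Y w).
    by apply: measurable_funM => //; exact: Rintegrable_meas IY.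
  have I2 : L1 (fun w => g (G w) * Y w).
    apply: le_Rintegrable (integrable_norm IGY) => // w _ /=.
    have /andP[g0 g1] := g01 (G w).
    by rewrite !normrM ler_wpM2r// ger0_norm.
  split => //; apply/eqP; rewrite eq_le; apply/andP; split.
    rewrite -oppr_ge0 -mulN1r -RintegralZl//.
    rewrite (_ : (fun w => _) = (fun w => g (G w) * - Y w)); last first.
      by apply/funext => w; rewrite mulN1r mulrN.
    apply: Rintegral_mul_ge0 => //.
    - by move=> w; have /andP[] := g01 (G w).
    - exact: RintegrableN.
    - by apply: (eq_Rintegrable (RintegrableN measurableT I2)) => w; rewrite mulrN.
    - move=> B mB.
      rewrite (_ : (fun w => _) = (fun w => -1 * (\1_(G @^-1` (g @^-1` B)) w * Y w))).
        rewrite RintegralZl ?H ?mulr0//.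
          by rewrite -[X in measurable X]setTI; exact: mg.
        apply: le_Rintegrable (integrable_norm IY) => //.
          apply: measurable_funM; last exact: Rintegrable_meas IY.
          apply: measurable_indic; rewrite -[X in measurable X]setTI.
          exact: (mgG measurableT B mB).
        by move=> w _; exact: ler_norm_indicM.
      by apply/funext => w; rewrite mulN1r mulrN.
  apply: Rintegral_mul_ge0 => //.
  - by move=> w; have /andP[] := g01 (G w).
  - move=> B mB; rewrite (H (g @^-1` B))//.
    by rewrite -[X in measurable X]setTI; exact: mg.
have [Ip Ep] := I1 (fun x => Num.max x 0) (@measurable_funrpos _ _ _ setT id (@measurable_id _ _ _))
  (fun x => ltac:(by rewrite le_max lexx orbT ge_max ler_norm normr_ge0)).
have [In En] := I1 (fun x => Num.max (- x) 0) (@measurable_funrneg _ _ _ setT id (@measurable_id _ _ _))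
  (fun x => ltac:(by rewrite le_max lexx orbT ge_max -normrN ler_norm normr_ge0)).
transitivity (\int[P]_w (Num.max (G w) 0 * Y w - Num.max (- G w) 0 * Y w)).
  apply: eq_Rintegral => w _; rewrite -mulrBl; congr (_ * _).
  by rewrite !maxEle; case: ifPn; case: ifPn; rewrite -?ltNge; lra.
by rewrite RintegralB// Ep En subr0.
Qed.

End level_sets_eq.

Lemma borel_realE (R : realType) :
  (@measurable _ R : set (set R)) = <<s @open R >>.
Proof.
apply/seteqP; split.
  rewrite [X in X `<=` _](RGenOpens.measurableE R).
  apply: smallest_sub; first exact: smallest_sigma_algebra.
  by move=> _ [x [y ->]]; apply: sub_sigma_algebra; exact: interval_open.
apply: smallest_sub; first exact: sigma_algebra_measurable.
exact: open_measurable.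
Qed.

(** * Martingale increments *)

Section filtration.
Context {R : realType} {dO : measure_display} {Om : measurableType dO}.
Variables (P : probability Om R) (F : R -> set (set Om)).
Hypothesis hF : is_filtration F.
Local Notation L1 f := (P.-integrable setT (EFin \o f)).
Local Notation Fm s f := (measurable_fun [set: g_sigma_algebraType (F s)] f).
Implicit Types (f G D Q : Om -> R) (s t u : R).

Lemma measurable_wrtE s f : 0 <= s -> measurable_wrt (F s) f <-> Fm s f.
Proof.
move=> s0; have sF := filt_sigma hF s0.
have E : <<s F s>> = F s by exact: sigma_algebra_id.
have OE := @borel_realE R.
split => [h _ B mB|h B mB].
  by rewrite setTI; apply: sub_sigma_algebra; apply: h; rewrite -OE.
by rewrite -E -[X in _ X]setTI; apply: h => //; rewrite OE.
Qed.

Lemma Fm_preimage s f (B : set R) : 0 <= s -> Fm s f -> measurable B ->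
  F s (f @^-1` B).
Proof.
move=> s0 mf mB; rewrite -(sigma_algebra_id (filt_sigma hF s0)).
by rewrite -[X in _ X]setTI; apply: mf.
Qed.

Lemma Fm_mono s t f : 0 <= s -> s <= t -> Fm s f -> Fm t f.
Proof.
move=> s0 st mf _ B mB; apply: sub_sigma_algebra; rewrite setTI.
by apply: (filt_mono hF s0 st); exact: Fm_preimage.
Qed.

Lemma Fm_measurable s f : 0 <= s -> Fm s f -> measurable_fun [set: Om] f.
Proof.
move=> s0 mf _ B mB; rewrite setTI; apply: (filt_sub hF s0).
exact: Fm_preimage.
Qed.

(** The test functions for conditional expectation given [F s]; boundedness makes their products
    with integrable variables integrable. *)
Definition bounded_Fm s f := Fm s f /\ exists M, forall w, `|f w| <= M.

Lemma bounded_Fm_cst s (c : R) : bounded_Fm s (fun=> c).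
Proof. by split; [exact: measurable_cst|exists `|c|]. Qed.

Lemma bounded_FmM s f G : bounded_Fm s f -> bounded_Fm s G ->
  bounded_Fm s (fun w => f w * G w).
Proof.
move=> [mf [M fM]] [mG [N GN]]; split; first exact: measurable_funM.
by exists (M * N) => w; rewrite normrM ler_pM.
Qed.

Lemma bounded_FmD s f G : bounded_Fm s f -> bounded_Fm s G ->
  bounded_Fm s (fun w => f w + G w).
Proof.
move=> [mf [M fM]] [mG [N GN]]; split; first exact: measurable_funD.
by exists (M + N) => w; rewrite (le_trans (ler_normD _ _))// lerD.
Qed.

Lemma bounded_Fm_sum s (I : Type) (r : seq I) (f : I -> Om -> R) :
  (forall i, bounded_Fm s (f i)) -> bounded_Fm s (fun w => \sum_(i <- r) f i w).
Proof.
move=> bf; elim: r => [|i r IH].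
  rewrite (_ : (fun w => _) = (fun=> 0)); first exact: bounded_Fm_cst.
  by apply/funext => w; rewrite big_nil.
rewrite (_ : (fun w => _) = (fun w => f i w + \sum_(j <- r) f j w)).
  exact: bounded_FmD.
by apply/funext => w; rewrite big_cons.
Qed.

Lemma bounded_Fm_mono s t f : 0 <= s -> s <= t -> bounded_Fm s f -> bounded_Fm t f.
Proof. by move=> s0 st [mf ?]; split => //; exact: Fm_mono mf. Qed.

Lemma bounded_Fm_indic s (A : set Om) : F s A -> bounded_Fm s (\1_A).
Proof.
move=> FA; split.
  by apply: (@measurable_indic _ (g_sigma_algebraType (F s))); exact: sub_sigma_algebra.
by exists 1 => w; rewrite indicE; case: (_ \in _); rewrite ?normr1 ?normr0.
Qed.

Lemma integrable_bounded_mul s G f : 0 <= s -> bounded_Fm s G -> L1 f ->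
  L1 (fun w => G w * f w).
Proof.
move=> s0 [mG [M GM]] If.
apply: (@le_Rintegrable _ _ _ P setT measurableT _ (fun w => M * `|f w|)) => //.
- by apply: measurable_funM; [exact: Fm_measurable mG|exact: Rintegrable_meas If].
- by move=> w _; rewrite normrM ler_wpM2r.
- by apply: RintegrableZ => //; exact: integrable_norm.
Qed.

Lemma integrable_bounded s G : 0 <= s -> bounded_Fm s G -> L1 G.
Proof.
move=> s0 bG; have I1 : L1 (fun=> 1) by exact: finite_measure_integrable_cst.
by apply: (eq_Rintegrable (integrable_bounded_mul s0 bG I1)) => w; rewrite mulr1.
Qed.

Lemma integrable_mul_sqr f G : measurable_fun setT f -> measurable_fun setT G ->
  L1 (fun w => f w ^+ 2) -> L1 (fun w => G w ^+ 2) -> L1 (fun w => f w * G w).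
Proof.
move=> mf mG If IG.
apply: (@le_Rintegrable _ _ _ P setT measurableT _ (fun w => f w ^+ 2 + G w ^+ 2)) => //.
- exact: measurable_funM.
- move=> w _; rewrite normrM -(real_normK (num_real (f w))) -(real_normK (num_real (G w))).
  by have := sqr_ge0 (`|f w| - `|G w|); have := sqr_ge0 (`|f w| + `|G w|); nra.
- exact: RintegrableD.
Qed.

Lemma integrable_sqr f : measurable_fun setT f ->
  L1 (fun w => f w ^+ 2) -> L1 f.
Proof.
move=> mf If.
have I1 : L1 (fun=> 1) by exact: finite_measure_integrable_cst.
have I2 : L1 (fun=> 1 ^+ 2) by exact: finite_measure_integrable_cst.
by apply: (eq_Rintegrable (integrable_mul_sqr mf _ If I2)) => // w; rewrite mulr1.
Qed.

(* [D] is the increment over (s, t] of a square-integrable martingale whose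
   bracket increases by at most [Q]. *)
Record mart_incr s t D Q : Prop := {
  mi_meas : Fm t D ;
  mi_L2 : L1 (fun w => D w ^+ 2) ;
  mi_Q : bounded_Fm t Q ;
  mi_mean : forall G, bounded_Fm s G -> \int[P]_w (G w * D w) = 0 ;
  mi_sqr : forall G, bounded_Fm s G -> (forall w, 0 <= G w) ->
    \int[P]_w (G w * D w ^+ 2) <= \int[P]_w (G w * Q w) }.

Lemma mart_incr0 s t : 0 <= t -> mart_incr s t (fun=> 0) (fun=> 0).
Proof.
move=> t0; split.
- exact: measurable_cst.
- exact: finite_measure_integrable_cst.
- exact: bounded_Fm_cst.
- by move=> G _; under eq_Rintegral do rewrite mulr0; rewrite Rintegral_cst// mul0r.
- by move=> G _ _; under eq_Rintegral do rewrite expr2 mulr0.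
Qed.

Lemma mart_incrD s t u D1 D2 Q1 Q2 : 0 <= s -> s <= t -> t <= u ->
  mart_incr s t D1 Q1 -> mart_incr t u D2 Q2 ->
  mart_incr s u (fun w => D1 w + D2 w) (fun w => Q1 w + Q2 w).
Proof.
move=> s0 st tu [mD1 I1 bQ1 E1 V1] [mD2 I2 bQ2 E2 V2].
have t0 := le_trans s0 st; have u0 := le_trans t0 tu.
have m1 := Fm_measurable t0 mD1; have m2 := Fm_measurable u0 mD2.
have I12 := integrable_mul_sqr m1 m2 I1 I2.
have sqE w : (D1 w + D2 w) ^+ 2 = D1 w ^+ 2 + (2 * (D1 w * D2 w) + D2 w ^+ 2).
  by ring.
split.
- by apply: measurable_funD => //; exact: Fm_mono mD1.
- apply: (eq_Rintegrable (RintegrableD measurableT I1 (RintegrableD measurableT (RintegrableZ measurableT 2 I12) I2))) => w.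
  by rewrite -sqE.
- by apply: bounded_FmD => //; exact: bounded_Fm_mono bQ1.
- move=> G bG; have bGt := bounded_Fm_mono s0 st bG.
  under eq_Rintegral do rewrite mulrDr.
  rewrite RintegralD//.
  + by rewrite E1// E2// addr0.
  + exact: (integrable_bounded_mul s0 bG (integrable_sqr m1 I1)).
  + exact: (integrable_bounded_mul s0 bG (integrable_sqr m2 I2)).
- move=> G bG G0; have bGt := bounded_Fm_mono s0 st bG.
  have IG1 := integrable_bounded_mul s0 bG I1.
  have IG2 := integrable_bounded_mul s0 bG I2.
  have IG12 := integrable_bounded_mul s0 bG I12.
  (* [G D1] may be unbounded, so [mi_mean] does not apply to it; but its level sets lie in [F t],
     and their indicators are admissible factors. *)
  have cross : \int[P]_w (G w * (D1 w * D2 w)) = 0.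
    under eq_Rintegral do rewrite mulrA.
    apply: Rintegral_mul_eq0.
    + by apply: measurable_funM => //; apply: Fm_measurable bG.1.
    + exact: (integrable_sqr m2 I2).
    + by apply: (eq_Rintegrable IG12) => w; rewrite mulrA.
    + move=> B mB; apply: E2; apply: bounded_Fm_indic; apply: Fm_preimage => //.
      by apply: measurable_funM => //; exact: bGt.1.
  under eq_Rintegral do rewrite sqE mulrDr mulrDr (mulrCA _ 2).
  rewrite RintegralD//; last first.
    by apply: RintegrableD => //; exact: RintegrableZ.
  rewrite RintegralD//; last exact: RintegrableZ.
  rewrite RintegralZl// cross mulr0 add0r.
  under [leRHS]eq_Rintegral do rewrite mulrDr.
  rewrite RintegralD//; last 2 first.
  + exact: integrable_bounded_mul s0 bG (integrable_bounded t0 bQ1).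
  + exact: integrable_bounded_mul s0 bG (integrable_bounded u0 bQ2).
  by apply: lerD; [exact: V1|exact: V2].
Qed.

End filtration.

Lemma preimage_sigma (T U : Type) (S : set (set T)) (H : set (set U)) (f : T -> U) :
  sigma_algebra setT S -> (forall V, H V -> S (f @^-1` V)) ->
  forall B, <<s H >> B -> S (f @^-1` B).
Proof.
move=> [S0 SD SU] HS; apply: smallest_sub => //; split.
- by rewrite /= preimage_set0.
- by move=> A SA; rewrite /= setTD preimage_setC -setTD; exact: SD.
- by move=> A SA; rewrite /= preimage_bigcup; exact: SU.
Qed.

(** * Brownian increments *)

Section brownian_increments.
Context {R : realType} {dO : measure_display} {Om : measurableType dO}.
Variables (P : probability Om R) (F : R -> set (set Om)).
Hypothesis hF : is_filtration F.
Local Notation L1 f := (P.-integrable setT (EFin \o f)).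
Local Notation Fm s f := (measurable_fun [set: g_sigma_algebraType (F s)] f).
Variables (m : nat) (W : R -> Om -> 'rV[R]_m).
Hypothesis hW : brownian_motion P F W.
Implicit Types (k : 'I_m) (G : Om -> R).

Lemma adapted_coord n (X : R -> Om -> 'rV[R]_n) t (i : 'I_n) : 0 <= t ->
  adapted F X -> Fm t (fun w => X t w 0 i).
Proof.
move=> t0 aX; apply/(measurable_wrtE hF _ t0) => B mB.
apply: (aX _ t0 ((fun x : 'rV[R]_n => x 0 i) @^-1` B)).
move: B mB; apply: preimage_sigma; first exact: smallest_sigma_algebra.
move=> U oU; apply: sub_sigma_algebra.
have /continuousP : continuous (fun x : 'rV[R]_n => x 0 i) by exact: coord_continuous.
exact.
Qed.

Section increment.
Variables (s t : R).
Hypotheses (s0 : 0 <= s) (st : s < t).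
Let incr k w := W t w 0 k - W s w 0 k.
Let sd := Num.sqrt (t - s).

Let t0 : 0 <= t. Proof. exact: le_trans s0 (ltW st). Qed.

Let sd0 : sd != 0.
Proof. by rewrite gt_eqF// sqrtr_gt0 subr_gt0. Qed.

Lemma incr_Fm k : Fm t (incr k).
Proof.
apply: measurable_funB; first exact: adapted_coord (bm_adapted hW).
by apply: (Fm_mono hF s0 (ltW st)); apply: adapted_coord (bm_adapted hW).
Qed.

Let mi k : measurable_fun [set: Om] (incr k).
Proof. exact: (Fm_measurable hF t0 (incr_Fm k)). Qed.

(** The other coordinates are left free by giving them the full line as their set. *)
Let fac k (A : set Om) (B : set R) : F s A -> measurable B ->
  P (A `&` incr k @^-1` B) = (P A * normal_prob 0 sd B)%E.
Proof.
move=> FA mB.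
pose B_ j : set R := if j == k then B else setT.
have mB_ j : measurable (B_ j) by rewrite /B_; case: ifP.
have := bm_incr hW s0 st (B := B_) FA mB_.
rewrite (bigD1 k)//= big1 => [|j jk]; last first.
  by rewrite /B_ (negbTE jk) probability_setT.
rewrite mule1 /B_ eqxx => <-; congr (P (A `&` _)).
apply/seteqP; split => w /=.
  by move=> Bw j _; case: eqP => // ->.
by move=> /(_ k Logic.I); rewrite eqxx.
Qed.

(** Independence of two coordinates, in the form that lets a condition on [incr k'] join the event:
    [incr k] is still normal there. *)
Let fac2 k k' (A : set Om) (B B' : set R) : k != k' -> F s A ->
  measurable B -> measurable B' ->
  P ((A `&` incr k' @^-1` B') `&` incr k @^-1` B) =
  (P (A `&` incr k' @^-1` B') * normal_prob 0 sd B)%E.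
Proof.
move=> kk' FA mB mB'.
pose B_ j : set R := if j == k then B else if j == k' then B' else setT.
have mB_ j : measurable (B_ j) by rewrite /B_; case: ifP => //; case: ifP.
have := bm_incr hW s0 st (B := B_) FA mB_.
rewrite (bigD1 k)//= (bigD1 k')/= 1?eq_sym// big1 => [|j /andP[jk jk']]; last first.
  by rewrite /B_ (negbTE jk) (negbTE jk') probability_setT.
rewrite mule1 /B_ eqxx eq_sym (negbTE kk') eqxx => E; rewrite [in RHS]fac//.
rewrite -muleA (muleC (normal_prob _ _ B')) -E -setIA; congr (P (A `&` _)).
apply/seteqP; split => w /=.
  move=> [B'w Bw] j _; case: eqP => [->//|_]; by case: eqP => // ->.
move=> h; split; last by have := h k Logic.I; rewrite eqxx.
by have := h k' Logic.I; rewrite eqxx eq_sym (negbTE kk').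
Qed.

Let mF A : F s A -> measurable A.
Proof. by move=> FA; apply: (filt_sub hF s0). Qed.

Let FT : F s setT.
Proof.
rewrite -setC0 -setTD; have [h0 hD _] := filt_sigma hF s0.
exact: hD.
Qed.

Lemma incr_L2 k : L1 (fun w => incr k w ^+ 2).
Proof.
apply: (eq_Rintegrable (normal_factor_L2 sd0 measurableT (mi k) (fun B => fac k FT))).
by move=> w; rewrite indicT mul1r.
Qed.

Lemma incr_mean k G : bounded_Fm F s G -> \int[P]_w (G w * incr k w) = 0.
Proof.
move=> bG; apply: Rintegral_mul_eq0.
- exact: (Fm_measurable hF s0 bG.1).
- exact: (integrable_sqr (mi k) (incr_L2 k)).
- exact: (integrable_bounded_mul hF s0 bG (integrable_sqr (mi k) (incr_L2 k))).
- move=> B mB; have FA := Fm_preimage hF s0 bG.1 mB.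
  by apply: (normal_factor_mean sd0 (mF FA) (mi k)) => C mC; exact: fac.
Qed.

Let incr_prod k k' : L1 (fun w => incr k w * incr k' w).
Proof. exact: integrable_mul_sqr (incr_L2 k) (incr_L2 k'). Qed.

(** Two reductions to level sets, first of [G] and then of [incr k'], leave a centred Gaussian on an
    event independent of it. *)
Lemma incr_cov k k' G : bounded_Fm F s G -> k != k' ->
  \int[P]_w (G w * (incr k w * incr k' w)) = 0.
Proof.
move=> bG kk'.
have mG := Fm_measurable hF s0 bG.1.
apply: Rintegral_mul_eq0 => //.
  exact: (integrable_bounded_mul hF s0 bG (incr_prod k k')).
move=> B mB; have FA := Fm_preimage hF s0 bG.1 mB.
under eq_Rintegral do rewrite mulrA mulrC.
apply: Rintegral_mul_eq0 => //.
- apply: (integrable_bounded_mul hF s0 (bounded_Fm_indic FA)).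
  exact: (integrable_sqr (mi k) (incr_L2 k)).
- apply: (eq_Rintegrable (integrable_bounded_mul hF s0 (bounded_Fm_indic FA) (incr_prod k k'))).
  by move=> w; rewrite mulrA mulrC.
- move=> B' mB'.
  under eq_Rintegral => w _.
    rewrite mulrA -[_ * \1_(G @^-1` B) w]/((\1_(incr k' @^-1` B') \* \1_(G @^-1` B)) w) -indicI setIC; over.
  apply: (normal_factor_mean sd0 _ (mi k)) => [|C mC]; last exact: fac2.
  apply: measurableI; first exact: mF.
  by rewrite -[X in measurable X]setTI; exact: mi.
Qed.

(** [Rintegral_mul_ge0] with [Y = (t - s) - incr k ^+ 2], whose integral over each event of [F s] is
    nonnegative. *)
Lemma incr_var k G : bounded_Fm F s G -> (forall w, 0 <= G w) ->
  \int[P]_w (G w * incr k w ^+ 2) <= \int[P]_w (G w * (t - s)).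
Proof.
move=> bG G0.
have IG := integrable_bounded P hF s0 bG.
have IGt := integrable_bounded_mul hF s0 bG (incr_L2 k).
have I1 : L1 (fun=> t - s) by exact: finite_measure_integrable_cst.
have IY : L1 (fun w => (t - s) - incr k w ^+ 2).
  by apply: RintegrableB => //; exact: incr_L2.
rewrite -subr_ge0 -RintegralB//; last first.
  by apply: (eq_Rintegrable (RintegrableZ measurableT (t - s) IG)) => w; rewrite mulrC.
under eq_Rintegral do rewrite -mulrBr.
apply: Rintegral_mul_ge0 => //.
- exact: Fm_measurable bG.1.
- exact: integrable_bounded_mul bG IY.
move=> B mB; have FA := Fm_preimage hF s0 bG.1 mB.
have bA := bounded_Fm_indic FA.
under eq_Rintegral do rewrite mulrBr.
rewrite RintegralB//.
- rewrite subr_ge0.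
  have := normal_factor_sqr sd0 (mF FA) (mi k) (fun C mC => fac k FA mC).
  move=> /le_trans; apply.
  rewrite sqr_sqrtr ?subr_ge0 ?(ltW st)// RintegralZr//.
    by rewrite mulrC.
  exact: (integrable_bounded P hF s0 bA).
- exact: (integrable_bounded_mul hF s0 bA I1).
- exact: (integrable_bounded_mul hF s0 bA (incr_L2 k)).
Qed.

(** One cell of the Ito isometry: the coefficients are known at time [s], so off-diagonal terms
    vanish by [incr_cov] and diagonal ones give the bracket. *)
Lemma mart_incr_cell (c : 'I_m -> Om -> R) : (forall k, bounded_Fm F s (c k)) ->
  mart_incr P F s t (fun w => \sum_k c k w * incr k w)
    (fun w => \sum_k c k w ^+ 2 * (t - s)).
Proof.
move=> bc.
have bc2 k k' : bounded_Fm F s (fun w => c k w * c k' w) by exact: bounded_FmM.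
have sqE w : (\sum_k c k w * incr k w) ^+ 2 =
    \sum_k \sum_k' (c k w * c k' w) * (incr k w * incr k' w).
  rewrite expr2 mulr_suml; apply: eq_bigr => k _.
  by rewrite mulr_sumr; apply: eq_bigr => k' _; rewrite mulrACA.
have I2 k k' : L1 (fun w => (c k w * c k' w) * (incr k w * incr k' w)).
  exact: (integrable_bounded_mul hF s0 (bc2 k k') (incr_prod k k')).
split.
- apply: measurable_sum => k; apply: measurable_funM; last exact: incr_Fm.
  exact: (bounded_Fm_mono hF s0 (ltW st) (bc k)).1.
- apply: (eq_Rintegrable (Rintegrable_sum measurableT _ (fun k => Rintegrable_sum measurableT (index_enum _) (I2 k)))).
  by move=> w; rewrite sqE.
- apply: (bounded_Fm_mono hF s0 (ltW st)); apply: bounded_Fm_sum => k.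
  by apply: bounded_FmM; [exact: bc2|exact: bounded_Fm_cst].
- move=> G bG; under eq_Rintegral do rewrite mulr_sumr.
  have E k : (fun w => G w * (c k w * incr k w)) = (fun w => (G w * c k w) * incr k w).
    by apply/funext => w; rewrite mulrA.
  rewrite Rintegral_sum//.
    by apply: big1 => k _; rewrite E incr_mean//; exact: bounded_FmM.
  move=> k; rewrite E.
  apply: (integrable_bounded_mul hF s0) => //; first exact: bounded_FmM.
  exact: (integrable_sqr (mi k) (incr_L2 k)).
- move=> G bG G0.
  have E k k' : (fun w => G w * ((c k w * c k' w) * (incr k w * incr k' w))) =
      (fun w => (G w * (c k w * c k' w)) * (incr k w * incr k' w)).
    by apply/funext => w; rewrite mulrA.
  have bGc k k' : bounded_Fm F s (fun w => G w * (c k w * c k' w)).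
    exact: bounded_FmM.
  have IG k k' : L1 (fun w => G w * ((c k w * c k' w) * (incr k w * incr k' w))).
    by rewrite E; exact: (integrable_bounded_mul hF s0 (bGc k k') (incr_prod k k')).
  under eq_Rintegral do rewrite sqE mulr_sumr; under eq_Rintegral do under eq_bigr do rewrite mulr_sumr.
  rewrite Rintegral_sum//; last by move=> k; exact: Rintegrable_sum.
  under [leRHS]eq_Rintegral do rewrite mulr_sumr.
  rewrite Rintegral_sum//; last first.
    move=> k; apply: (integrable_bounded_mul hF s0) => //.
    by apply: (integrable_bounded _ hF s0); apply: bounded_FmM; [exact: bc2|exact: bounded_Fm_cst].
  apply: ler_sum => k _.
  rewrite Rintegral_sum// (bigD1 k)//= [X in _ + X]big1 => [|k' k'k]; last first.
    by rewrite E incr_cov// eq_sym.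
  rewrite addr0 E.
  have -> : (fun w => G w * (c k w ^+ 2 * (t - s))) = (fun w => (G w * (c k w * c k w)) * (t - s)).
    by apply/funext => w; rewrite mulrA expr2.
  under [leLHS]eq_Rintegral do rewrite -[incr k _ * _]expr2.
  apply: incr_var => // w; rewrite mulr_ge0// -expr2 sqr_ge0//.
Qed.

End increment.
End brownian_increments.

(** * Simple processes *)

(** A cell with neither [a] nor [b] in its interior lies within []a, b]] or outside it. Used with a
    Brownian path for [B], and with the identity for the bracket. *)
Lemma min_incr_cell (R : realType) (B : R -> R) (a b s t : R) :
  a <= b -> s <= t -> ~~ (s < a < t) -> ~~ (s < b < t) ->
  (B (Num.min b t) - B (Num.min a t)) - (B (Num.min b s) - B (Num.min a s)) =
  (a < t <= b)%R%:R * (B t - B s).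
Proof.
move=> ab st; rewrite !negb_and -!leNgt => sa sb.
have [ta|] := boolP (t <= a); last rewrite -ltNge => lta.
  rewrite (min_r ta) (min_r (le_trans ta ab)) (min_r (le_trans st ta)).
  by rewrite (min_r (le_trans st (le_trans ta ab))) !subrr ltNge ta mul0r.
have as_ : a <= s by case/orP: sa => //; rewrite leNgt lta.
have [tb|] := boolP (t <= b); last rewrite -ltNge => bt.
  rewrite lta /= mul1r (min_l (ltW lta)) (min_l as_) (min_r tb) (min_r (le_trans st tb)).
  by rewrite opprB addrA subrK.
have bs : b <= s by case/orP: sb => //; rewrite leNgt bt.
by rewrite (min_l (ltW lta)) (min_l as_) (min_l (ltW bt)) (min_l bs) subrr andbF mul0r.
Qed.

Lemma min_incr_mono (R : realType) (a b s t : R) : a <= b -> s <= t ->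
  Num.min b s - Num.min a s <= Num.min b t - Num.min a t.
Proof.
move=> ab st; rewrite !minEle.
by case: ifPn; case: ifPn; case: ifPn; case: ifPn; rewrite -?ltNge; lra.
Qed.

Section simple_process.
Context {R : realType} {dO : measure_display} {Om : measurableType dO}.
Implicit Types (S : @simple_process R _ Om) (s t : R) (w : Om).

(** The bracket of the simple integral: for nonnegative break times, the integral over []0, t]] of
    the square of [sp_val]. *)
Definition sp_quad S t w : R :=
  \sum_(i < sp_size S) sp_coef S i w ^+ 2 *
    (Num.min (sp_time S i.+1) t - Num.min (sp_time S i) t).

Let mono S := {homo sp_time S : i j / (i <= j)%N >-> i <= j}.

(** The intervals []t_i, t_(i+1)]] are disjoint, so the square has no cross terms. *)
Lemma sp_val_sqr S t w : mono S ->
  sp_val S t w ^+ 2 = \sum_(i < sp_size S)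
    sp_coef S i w ^+ 2 * (sp_time S i < t <= sp_time S i.+1)%R%:R.
Proof.
move=> mS; rewrite /sp_val.
case: (pickP (fun i : 'I_(sp_size S) => sp_time S i < t <= sp_time S i.+1)) => [i0 h|none].
  have h' (i : 'I_(sp_size S)) : i != i0 -> (sp_time S i < t <= sp_time S i.+1) = false.
    move=> ii0; apply/negP => /andP[ti ti1]; case/andP: h => ti0 ti01.
    move: ii0; rewrite neq_ltn => /orP[] /mS H.
      by have := le_lt_trans H ti0; rewrite ltNge ti1.
    by have := le_lt_trans H ti; rewrite ltNge ti01.
  rewrite (bigD1 i0)//= [in RHS](bigD1 i0)//= big1 ?[in RHS]big1 ?addr0.
  - by rewrite h !mulr1.
  - by move=> i /h' ->; rewrite mulr0.
  - by move=> i /h' ->; rewrite mulr0.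
rewrite !big1 ?expr0n// => i _; rewrite none mulr0//.
Qed.

(** A process with n summands has n + 1 break times, hence the large inequality on [i]. *)
Definition no_break S s t := forall i, (i <= sp_size S)%N -> ~~ (s < sp_time S i < t).

Lemma sp_int_cell S (B : R -> Om -> R) s t w : mono S -> s <= t -> no_break S s t ->
  sp_int S B t w - sp_int S B s w = sp_val S t w * (B t w - B s w).
Proof.
move=> mS st nb; rewrite /sp_int /sp_val -sumrB mulr_suml; apply: eq_bigr => i _.
rewrite -mulrBr -mulrA; congr (_ * _).
apply: (min_incr_cell (B ^~ w)) => //; first exact: mS.
- exact/nb/ltnW.
- exact/nb.
Qed.

Lemma sp_quad_cell S s t w : mono S -> s <= t -> no_break S s t ->
  sp_quad S t w - sp_quad S s w = sp_val S t w ^+ 2 * (t - s).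
Proof.
move=> mS st nb; rewrite sp_val_sqr// /sp_quad -sumrB mulr_suml; apply: eq_bigr => i _.
rewrite -mulrBr -mulrA; congr (_ * _).
apply: (min_incr_cell id) => //; first exact: mS.
- exact/nb/ltnW.
- exact/nb.
Qed.

Lemma sp_quad_mono S s t w : mono S -> s <= t -> sp_quad S s w <= sp_quad S t w.
Proof.
move=> mS st; apply: ler_sum => i _; rewrite ler_wpM2l ?sqr_ge0//.
by apply: min_incr_mono => //; exact: mS.
Qed.

(* Approximating processes are bounded individually but not uniformly, and
   their L^2 distance to the limit is only controlled in probability; cutting
   the coefficients when the bracket at time T passes K restores a uniform
   bound, and changes nothing on the paths where the bracket stays below K. *)
Definition sp_trunc S (T K : R) := SimpleProcess (sp_size S) (sp_time S)
  (fun i w => sp_coef S i w * (\sum_(j < i.+1) sp_coef S j w ^+ 2 *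
    (Num.min (sp_time S j.+1) T - Num.min (sp_time S j) T) <= K)%R%:R).

(** Induction on the size: if the full sum stays below [K], cutting only lowers it; otherwise the
    last coefficient is 0. *)
Lemma sp_quad_trunc_le S (T K : R) w : mono S -> 0 <= K ->
  sp_quad (sp_trunc S T K) T w <= K.
Proof.
move=> mS K0; rewrite /sp_quad /=.
elim: (sp_size S) => [|n IH]; first by rewrite big_ord0.
have d0 i : 0 <= Num.min (sp_time S i.+1) T - Num.min (sp_time S i) T.
  by rewrite subr_ge0 le_min2// mS.
have [h|h] := leP (\sum_(j < n.+1) sp_coef S j w ^+ 2 *
    (Num.min (sp_time S j.+1) T - Num.min (sp_time S j) T)) K.
  apply: le_trans h; apply: ler_sum => i _; rewrite ler_wpM2r// exprMn.
  by rewrite ler_piMr ?sqr_ge0//; case: (_ <= K); rewrite ?expr1n ?expr0n.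
by rewrite big_ord_recr/=; move: h; rewrite ltNge => /negbTE ->; rewrite mulr0 expr0n mul0r addr0.
Qed.

Lemma sp_int_trunc S (T K : R) (B : R -> Om -> R) t w : mono S ->
  sp_quad S T w <= K -> sp_int (sp_trunc S T K) B t w = sp_int S B t w.
Proof.
move=> mS QK; apply: eq_bigr => i _ /=.
suff -> : (\sum_(j < i.+1) sp_coef S j w ^+ 2 *
    (Num.min (sp_time S j.+1) T - Num.min (sp_time S j) T) <= K) by rewrite mulr1.
apply: le_trans QK; rewrite /sp_quad.
rewrite -(big_mkord xpredT (fun j => sp_coef S j w ^+ 2 *
    (Num.min (sp_time S j.+1) T - Num.min (sp_time S j) T))).
rewrite -(big_mkord xpredT (fun j => sp_coef S j w ^+ 2 *
    (Num.min (sp_time S j.+1) T - Num.min (sp_time S j) T))).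
rewrite [leRHS](big_cat_nat _ (n := i.+1))//= lerDl; apply: sumr_ge0 => j _.
by rewrite mulr_ge0 ?sqr_ge0// subr_ge0 le_min2// mS.
Qed.

Lemma sp_quad_trunc_incr S (T K : R) s t w : mono S -> s <= t ->
  sp_quad (sp_trunc S T K) t w - sp_quad (sp_trunc S T K) s w <=
  sp_quad S t w - sp_quad S s w.
Proof.
move=> mS st; rewrite /sp_quad /= -!sumrB; apply: ler_sum => i _.
rewrite -!mulrBr ler_wpM2r//.
  by rewrite subr_ge0 min_incr_mono// mS.
rewrite exprMn ler_piMr ?sqr_ge0//; case: (_ <= K); by rewrite ?expr1n ?expr0n.
Qed.

Variables (P : probability Om R) (F : R -> set (set Om)).
Hypothesis hF : is_filtration F.
Local Notation Fm s f := (measurable_fun [set: g_sigma_algebraType (F s)] f).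

Lemma sp_time_ge0 S i : simple_adapted F S -> 0 <= sp_time S i.
Proof. by move=> [t0 mS _ _]; apply: le_trans t0 (mS _ _ _). Qed.

Lemma sp_coef_Fm S i : simple_adapted F S -> (i < sp_size S)%N ->
  bounded_Fm F (sp_time S i) (sp_coef S i).
Proof.
move=> aS ilt; split.
  apply/(measurable_wrtE hF); last exact: (sa_coef aS ilt).
  exact: sp_time_ge0.
by have [M h] := sa_bound aS; exists M => w; exact: h.
Qed.

(** A coefficient active at [t] starts before [t], hence by time [s] since no break lies in between;
    its value is then known at [s]. *)
Lemma sp_val_bounded_Fm S s t : simple_adapted F S -> 0 <= s -> no_break S s t ->
  bounded_Fm F s (sp_val S t).
Proof.
move=> aS s0 nb; apply: bounded_Fm_sum => i.
case: (ltP (sp_time S i) t) => [tit|_] /=; last first.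
  rewrite (_ : (fun w => _) = (fun=> 0)); first exact: bounded_Fm_cst.
  by apply/funext => w; rewrite mulr0.
have tis : sp_time S i <= s.
  have := nb i (ltnW (ltn_ord i)); rewrite tit andbT -leNgt//.
apply: bounded_FmM; last exact: bounded_Fm_cst.
apply: (bounded_Fm_mono hF _ tis); first exact: sp_time_ge0.
exact: sp_coef_Fm.
Qed.

Lemma sp_trunc_adapted S T K : simple_adapted F S -> simple_adapted F (sp_trunc S T K).
Proof.
move=> aS; split.
- exact: sa_time0 aS.
- exact: sa_mono aS.
- move=> i /= ilt; apply/(measurable_wrtE hF); first exact: sp_time_ge0.
  apply: measurable_funM; first exact: (sp_coef_Fm aS ilt).1.
  (* The test that cuts coefficient [i] counts the bracket up to [t_(i+1)], yet it involves only
     coefficients up to [i] and deterministic times, so it is decided at [t_i]. *)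
  pose c w := \sum_(j < i.+1) sp_coef S j w ^+ 2 *
    (Num.min (sp_time S j.+1) T - Num.min (sp_time S j) T).
  have mc : Fm (sp_time S i) c.
    apply: measurable_sum => j; apply: measurable_funM; last exact: measurable_cst.
    apply: measurable_funX.
    have ji : (j <= i)%N by rewrite -ltnS.
    apply: (Fm_mono hF (sp_time_ge0 j aS) (sa_mono aS ji)).
    by apply: (sp_coef_Fm aS (leq_ltn_trans ji ilt)).1.
  rewrite (_ : (fun w => _) = \1_(c @^-1` `]-oo, K]%classic)).
    apply: (@measurable_indic _ (g_sigma_algebraType (F (sp_time S i)))).
    by rewrite -[X in measurable X]setTI; apply: mc.
  apply/funext => w; rewrite indicE; congr (_%:R); congr nat_of_bool.
  by apply/idP/idP; rewrite inE/= in_itv/=.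
- have [M h] := sa_bound aS; exists M => i w /= ilt.
  apply: le_trans (h i w ilt); rewrite normrM ler_piMr//.
  by case: (_ <= K); rewrite ?normr1 ?normr0.
Qed.

Variables (m : nat) (W : R -> Om -> 'rV[R]_m) (S : 'I_m -> @simple_process R _ Om).
Hypotheses (hW : brownian_motion P F W) (aS : forall k, simple_adapted F (S k)).

Lemma mart_incr_simple s t : 0 <= s -> s <= t ->
  mart_incr P F s t
    (fun w => \sum_k sp_int (S k) (fun t w => W t w 0 k) t w
            - \sum_k sp_int (S k) (fun t w => W t w 0 k) s w)
    (fun w => \sum_k sp_quad (S k) t w - \sum_k sp_quad (S k) s w).
Proof.
pose M t w := \sum_k sp_int (S k) (fun t w => W t w 0 k) t w.
pose Q t w := \sum_k sp_quad (S k) t w.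
(* Induction on a list [L] containing all break times strictly between [s] and [t]: split at the
   head if it lies inside and glue with [mart_incrD]; once none is left, a single Brownian cell
   remains. *)
suff H (L : seq R) : forall s t, 0 <= s -> s <= t ->
    (forall k i, (i <= sp_size (S k))%N -> s < sp_time (S k) i < t -> sp_time (S k) i \in L) ->
    mart_incr P F s t (fun w => M t w - M s w) (fun w => Q t w - Q s w).
  move=> s0 st; apply: (H (flatten [seq [seq sp_time (S k) i | i <- iota 0 (sp_size (S k)).+1] | k <- enum 'I_m])) => //.
  move=> k i ik _; apply/flatten_mapP; exists k; first by rewrite mem_enum.
  by apply: map_f; rewrite mem_iota/= add0n ltnS.
elim: L => [|x L IH] {}s {}t s0 st hL.
  move: st; rewrite le_eqVlt => /predU1P[<-|st].
    rewrite (_ : (fun w => _) = (fun=> 0)); last by apply/funext => w; rewrite subrr.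
    rewrite (_ : (fun w => Q s w - _) = (fun=> 0)); last by apply/funext => w; rewrite subrr.
    exact: mart_incr0.
  have nb k : no_break (S k) s t by move=> i ik; apply/negP => /(hL k i ik).
  have ms k : mono (S k) by exact: sa_mono (aS k).
  have := mart_incr_cell hF hW s0 st (fun k => sp_val_bounded_Fm (aS k) s0 (nb k)).
  congr mart_incr; apply/funext => w; rewrite /M /Q -sumrB; apply: eq_bigr => k _.
    by rewrite sp_int_cell// ltW.
  by rewrite sp_quad_cell// ltW.
have [/andP[sx xt]|nx] := boolP (s < x < t); last first.
  apply: IH => // k i ik h; have := hL k i ik h; rewrite inE => /predU1P[E|//].
  by move: nx; rewrite -E h.
have x0 := le_trans s0 (ltW sx).
have H1 : mart_incr P F s x (fun w => M x w - M s w) (fun w => Q x w - Q s w).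
  apply: IH => //; first exact: ltW.
  move=> k i ik /andP[h1 h2]; have := hL k i ik; rewrite h1 (lt_trans h2 xt) => /(_ isT).
  by rewrite inE => /predU1P[E|//]; move: h2; rewrite E ltxx.
have H2 : mart_incr P F x t (fun w => M t w - M x w) (fun w => Q t w - Q x w).
  apply: IH => //; first exact: ltW.
  move=> k i ik /andP[h1 h2]; have := hL k i ik; rewrite h2 (lt_trans sx h1) => /(_ isT).
  by rewrite inE => /predU1P[E|//]; move: h1; rewrite E ltxx.
have := mart_incrD hF s0 (ltW sx) (ltW xt) H1 H2.
by congr mart_incr; apply/funext => w; rewrite addrC addrA subrK.
Qed.

End simple_process.

(** * Riemann sums of a dissipative path *)

Section riemann_sums.
Context {R : realType}.
Local Notation mu := (@lebesgue_measure R).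
Local Notation L1 D f := (mu.-integrable D (EFin \o f)).

Lemma integrable_itv_sub (T s t : R) (f : R -> R) : 0 <= s -> t <= T ->
  L1 `]0, T] f -> L1 `]s, t] f.
Proof.
move=> s0 tT; apply: integrableS => // x /=; rewrite !in_itv/= => /andP[sx xt].
by rewrite (le_lt_trans s0 sx) (le_trans xt tT).
Qed.

Lemma sum_Rintegral_itv (n : nat) (t : nat -> R) (f : R -> R) :
  {homo t : i j / (i <= j)%N >-> i <= j} -> t 0%N = 0 ->
  L1 `]0, t n] f ->
  \sum_(l < n) \int[mu]_(s in `]t l, t l.+1]) f s = \int[mu]_(s in `]0, t n]) f s.
Proof.
move=> mt t0; elim: n => [|n IH] If.
  by rewrite big_ord0 t0 set_itv_ge ?Rintegral_set0// bnd_simp ltxx.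
have tn0 : 0 <= t n by rewrite -t0 mt.
have tnS : t n <= t n.+1 by rewrite mt.
rewrite big_ord_recr/= IH; last exact: integrable_itv_sub If.
rewrite -(@Rintegral_itvB _ f (BRight 0) (BRight (t n.+1)) (t n)) ?bnd_simp//.
by rewrite addrC subrK.
Qed.

(** * The deterministic estimate along one path *)

Section dissipative_sum.
Variables (J : finType) (m n : nat) (t : nat -> R) (T lambda h eta Om K : R).
Variables (x beta : J -> R -> R) (Sig v : J -> 'I_m -> R -> R).
Variables (om : nat -> R) (rho : nat -> bool) (z al : J -> nat -> R)
  (dq : J -> 'I_m -> nat -> R).
Hypotheses (mt : {homo t : i j / (i <= j)%N >-> i <= j}) (t0 : t 0%N = 0) (tn : t n = T).
Hypotheses (lambda0 : 0 <= lambda) (h0 : 0 < h) (h1 : h <= 1) (eta0 : 0 < eta) (K0 : 0 <= K).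
Hypothesis om01 : forall l, 0 <= om l <= Om.
Hypothesis Ib : forall c, L1 `]0, T] (beta c).
Hypothesis Ix : forall c, L1 `]0, T] (fun s => x c s ^+ 2).
Hypothesis IS : forall c k, L1 `]0, T] (fun s => Sig c k s ^+ 2).
Hypothesis Iv : forall c k, L1 `]0, T] (fun s => v c k s ^+ 2).
Hypothesis IvS : forall c k, L1 `]0, T] (fun s => (v c k s - Sig c k s) ^+ 2).
Hypothesis dis : forall s, 0 < s -> s <= T ->
  2 * (\sum_c x c s * beta c s) + \sum_c \sum_k Sig c k s ^+ 2 <=
  - lambda * \sum_c x c s ^+ 2.
Hypothesis zx : forall c l s, (l < n)%N -> rho l -> t l < s -> s <= t l.+1 ->
  `|z c l - x c s| <= h ^+ 2.
Hypothesis alE : forall c l, (l < n)%N -> rho l ->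
  al c l = \int[mu]_(s in `]t l, t l.+1]) beta c s.
Hypothesis al_le : forall c l, (l < n)%N -> rho l -> `|al c l| <= h ^+ 2.
Hypothesis dq0 : forall c k l, (l < n)%N -> 0 <= dq c k l.
Hypothesis dq_le : forall c k l, (l < n)%N ->
  dq c k l <= \int[mu]_(s in `]t l, t l.+1]) v c k s ^+ 2.
Hypothesis dq_sum : forall c k, \sum_(l < n) dq c k l <= K.
Hypothesis vS : forall c k,
  \int[mu]_(s in `]0, T]) (v c k s - Sig c k s) ^+ 2 <= h ^+ 2.

Let IX := \int[mu]_(s in `]0, T]) \sum_c x c s ^+ 2.
Let IB := \int[mu]_(s in `]0, T]) \sum_c `|beta c s|.
Let IG := \int[mu]_(s in `]0, T]) \sum_c \sum_k Sig c k s ^+ 2.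

(** The summands come, in order, from replacing [z] by [x] in the squares, from pairing [z - x] with
    [beta], from replacing [v] by [Sig], and from the squared drift increments. None depends on
    [h]. *)
Definition dissipative_const : R :=
  lambda * (2 * #|J|%:R * T + IX) + 2 * IB + (2 * (#|J| * m)%:R + IG) +
  (1 + eta^-1) * IB.

(** Rate at which a cell may exceed the dissipative bound: its three lines of error concern [z]
    against [x], the pairing with [beta], and [v] against [Sig]. *)
Let err s := lambda * ((1 + h^-1) * (h ^+ 2) ^+ 2 * #|J|%:R + h * \sum_c x c s ^+ 2)
  + (2 * h ^+ 2 * (\sum_c `|beta c s|)
  + ((1 + h^-1) * (\sum_c \sum_k (v c k s - Sig c k s) ^+ 2)
  + h * \sum_c \sum_k Sig c k s ^+ 2)).

Let T0 : 0 <= T.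
Proof. by rewrite -tn -t0 mt. Qed.

Let mD s u : measurable (`]s, u] : set R). Proof. exact: measurable_itv. Qed.

Let Icst (r s u : R) : L1 `]s, u] (fun=> r).
Proof.
apply: (@measurable_bounded_integrable _ _ _ mu (fun=> r)) => //.
  by rewrite /= lebesgue_measure_itv/=; case: ifP; rewrite ?ltry.
by exists `|r|; split; [exact: num_real|move=> M rM y _ /=; exact: ltW].
Qed.

Let IX2 : L1 `]0, T] (fun s => \sum_c x c s ^+ 2).
Proof. exact: Rintegrable_sum. Qed.
Let IB1 : L1 `]0, T] (fun s => \sum_c `|beta c s|).
Proof. by apply: Rintegrable_sum => // c; exact: (integrable_norm (Ib c)). Qed.
Let IS2 : L1 `]0, T] (fun s => \sum_c \sum_k Sig c k s ^+ 2).
Proof. by apply: Rintegrable_sum => // c; exact: Rintegrable_sum. Qed.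
Let IV2 : L1 `]0, T] (fun s => \sum_c \sum_k (v c k s - Sig c k s) ^+ 2).
Proof. by apply: Rintegrable_sum => // c; exact: Rintegrable_sum. Qed.

Let Ierr1 : L1 `]0, T]
  (fun s => lambda * ((1 + h^-1) * (h ^+ 2) ^+ 2 * #|J|%:R + h * \sum_c x c s ^+ 2)).
Proof.
apply: RintegrableZ => //; apply: RintegrableD => //.
exact: RintegrableZ.
Qed.
Let Ierr2 : L1 `]0, T] (fun s => 2 * h ^+ 2 * (\sum_c `|beta c s|)).
Proof. exact: RintegrableZ. Qed.
Let Ierr3 : L1 `]0, T] (fun s => (1 + h^-1) * (\sum_c \sum_k (v c k s - Sig c k s) ^+ 2)).
Proof. exact: RintegrableZ. Qed.
Let Ierr4 : L1 `]0, T] (fun s => h * \sum_c \sum_k Sig c k s ^+ 2).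
Proof. exact: RintegrableZ. Qed.
Let Ierr : L1 `]0, T] err.
Proof.
apply: RintegrableD => //; apply: RintegrableD => //.
exact: RintegrableD.
Qed.

Let err_le : \int[mu]_(s in `]0, T]) err s <=
  h * (lambda * (2 * #|J|%:R * T + IX) + 2 * IB + (2 * (#|J| * m)%:R + IG)).
Proof.
rewrite /err RintegralD//; last by apply: RintegrableD => //; exact: RintegrableD.
rewrite RintegralD//; last exact: RintegrableD.
rewrite RintegralD// RintegralZl//; last first.
  by apply: RintegrableD => //; exact: RintegrableZ.
rewrite RintegralD//; last exact: RintegrableZ.
rewrite !RintegralZl// Rintegral_cst// -/IX -/IB -/IG.
have -> : fine (mu `]0, T]%classic) = T.
  rewrite lebesgue_measure_itv/= lte_fin; case: ltP => [_|]; first by rewrite -EFinB subr0.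
  by move=> ?; apply/le_anti/andP.
have V : \int[mu]_(s in `]0, T]) (\sum_c \sum_k (v c k s - Sig c k s) ^+ 2) <= (#|J| * m)%:R * h ^+ 2.
  rewrite Rintegral_sum//; last by move=> c; exact: Rintegrable_sum.
  under eq_bigr do rewrite Rintegral_sum//.
  rewrite (_ : (#|J| * m)%:R * h ^+ 2 = \sum_(c : J) \sum_(k < m) h ^+ 2).
    by apply: ler_sum => c _; apply: ler_sum => k _; exact: vS.
  by rewrite !sumr_const card_ord -mulrnA mulr_natl mulnC.
have IX0 : 0 <= IX by apply: Rintegral_ge0 => s _; apply: sumr_ge0 => c _; exact: sqr_ge0.
have IB0 : 0 <= IB by apply: Rintegral_ge0 => s _; apply: sumr_ge0.
have hh : h ^+ 2 <= h by rewrite expr2 ler_piMl// ltW.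
have hV : (1 + h^-1) * h ^+ 2 <= 2 * h.
  have -> : (1 + h^-1) * h ^+ 2 = h ^+ 2 + h by field; rewrite gt_eqF.
  by lra.
have hV2 : (1 + h^-1) * (h ^+ 2) ^+ 2 <= 2 * h.
  apply: le_trans hV; rewrite ler_wpM2l ?addr_ge0 ?invr_ge0 ?(ltW h0)//.
  by rewrite expr2 ler_piMr ?sqr_ge0// expr_le1// ltW.
have c1 : 0 <= 1 + h^-1 by rewrite addr_ge0 ?invr_ge0 ?(ltW h0).
have := ler_wpM2l c1 V.
have J0 : 0 <= #|J|%:R :> R by [].
have Jm0 : 0 <= (#|J| * m)%:R :> R by [].
have e1 : (1 + h^-1) * (h ^+ 2) ^+ 2 * #|J|%:R * T <= 2 * h * (#|J|%:R * T).
  by rewrite -mulrA ler_wpM2r// mulr_ge0.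
have e2 : (1 + h^-1) * ((#|J| * m)%:R * h ^+ 2) <= 2 * h * (#|J| * m)%:R.
  by rewrite mulrCA mulrC ler_wpM2r.
have e3 : h ^+ 2 * IB <= h * IB by rewrite ler_wpM2r.
have := ler_wpM2l lambda0 e1.
nra.
Qed.

(* The step h bounds every approximation error; the factor h^-1 coming from
   a^2 - b^2 <= (1 + h^-1) (a - b)^2 + h b^2 is absorbed because the errors are
   measured at scale h^2. *)
Lemma dissipative_sum_le :
  \sum_(l < n) om l.+1 * (rho l)%:R *
    (\sum_c (lambda * (t l.+1 - t l) * z c l ^+ 2 + 2 * (z c l * al c l) +
             (1 + eta^-1) * al c l ^+ 2) +
     (1 + eta) * \sum_c \sum_k dq c k l) <=
  eta * (Om * ((#|J| * m)%:R * K)) + h * (Om * dissipative_const).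
Proof.
have c1 : 0 <= 1 + h^-1 by rewrite addr_ge0 ?invr_ge0 ?(ltW h0).
have c2 : 0 <= 1 + eta^-1 by rewrite addr_ge0 ?invr_ge0 ?(ltW eta0).
have tge0 l : 0 <= t l by rewrite -t0 mt.
have tleT l : (l < n)%N -> t l.+1 <= T by move=> ln; rewrite -tn mt.
have dt l : t l <= t l.+1 by rewrite mt.
have muE l : fine (mu `]t l, t l.+1]%classic) = t l.+1 - t l.
  rewrite lebesgue_measure_itv/= lte_fin; case: ltP => // h'.
  by apply/eqP; rewrite eq_sym subr_eq0 eq_le h' dt.
have sub l f : (l < n)%N -> L1 `]0, T] f -> L1 `]t l, t l.+1] f.
  by move=> ln; apply: integrable_itv_sub => //; exact: tleT.
have sq_diff a b : a ^+ 2 - b ^+ 2 <= (1 + h^-1) * (a - b) ^+ 2 + h * b ^+ 2.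
  rewrite -subr_ge0.
  have -> : (1 + h^-1) * (a - b) ^+ 2 + h * b ^+ 2 - (a ^+ 2 - b ^+ 2) =
     h^-1 * ((a - b) - h * b) ^+ 2 by field; rewrite gt_eqF.
  by rewrite mulr_ge0 ?sqr_ge0// invr_ge0 ltW.
have err0 s : 0 <= err s.
  have hp := ltW h0.
  rewrite /err; apply: addr_ge0; last apply: addr_ge0; last apply: addr_ge0.
  - apply: mulr_ge0 => //; apply: addr_ge0; first by rewrite !mulr_ge0// exprn_ge0// exprn_ge0.
    by apply: mulr_ge0 => //; apply: sumr_ge0 => c _; exact: sqr_ge0.
  - by apply: mulr_ge0; [rewrite mulr_ge0// sqr_ge0|apply: sumr_ge0].
  - apply: mulr_ge0 => //; apply: sumr_ge0 => c _; apply: sumr_ge0 => k _.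
    exact: sqr_ge0.
  - apply: mulr_ge0 => //; apply: sumr_ge0 => c _; apply: sumr_ge0 => k _.
    exact: sqr_ge0.
have cell l : (l < n)%N -> rho l ->
  \sum_c (lambda * (t l.+1 - t l) * z c l ^+ 2 + 2 * (z c l * al c l)) +
  \sum_c \sum_k dq c k l <= \int[mu]_(s in `]t l, t l.+1]) err s.
  move=> ln rl.
  pose g s := \sum_c (lambda * z c l ^+ 2 + 2 * z c l * beta c s) +
    \sum_c \sum_k v c k s ^+ 2.
  have Iz c : L1 `]t l, t l.+1] (fun s => 2 * z c l * beta c s).
    by apply: RintegrableZ => //; exact: sub.
  have Ig1 : L1 `]t l, t l.+1] (fun s => \sum_c (lambda * z c l ^+ 2 + 2 * z c l * beta c s)).
    by apply: Rintegrable_sum => // c; exact: RintegrableD.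
  have Ivl c k : L1 `]t l, t l.+1] (fun s => v c k s ^+ 2) by exact: sub.
  have Ig2 : L1 `]t l, t l.+1] (fun s => \sum_c \sum_k v c k s ^+ 2).
    by apply: Rintegrable_sum => // c; exact: Rintegrable_sum.
  apply: (@le_trans _ _ (\int[mu]_(s in `]t l, t l.+1]) g s)).
    rewrite /g RintegralD// Rintegral_sum//; last by move=> c; exact: RintegrableD.
    rewrite Rintegral_sum//; last by move=> c; exact: Rintegrable_sum.
    apply: lerD.
      apply: ler_sum => c _; rewrite RintegralD// Rintegral_cst//.
      rewrite RintegralZl//; last exact: sub.
      rewrite -alE// (mulrA 2) lerD2r -mulrA (mulrC (t l.+1 - t l)) mulrA (ler_wpM2l (mulr_ge0 lambda0 (sqr_ge0 _)))//.
      by rewrite le_eqVlt; apply/orP; left; apply/eqP; exact/esym/muE.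
    apply: ler_sum => c _; rewrite Rintegral_sum//.
    by apply: ler_sum => k _; exact: dq_le.
  apply: le_Rintegral => //.
  - exact: RintegrableD.
  - exact: sub.
  move=> s /=; rewrite in_itv/= => /andP[ls sl].
  have s0 : 0 < s := le_lt_trans (tge0 l) ls.
  have sT : s <= T := le_trans sl (tleT _ ln).
  (* Dissipativity makes the expression in [x] and [Sig] at time [s] nonpositive; subtracting it
     leaves only the differences bounded in [E1], [E2] and [E3]. *)
  have := dis s0 sT; rewrite -subr_ge0 => D.
  rewrite /g /err -subr_ge0; apply: le_trans D _; rewrite -subr_ge0.
  have E1 : \sum_c (z c l ^+ 2 - x c s ^+ 2) <=
      (1 + h^-1) * (h ^+ 2) ^+ 2 * #|J|%:R + h * \sum_c x c s ^+ 2.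
    rewrite mulr_natr -sumr_const mulr_sumr -big_split/=.
    apply: ler_sum => c _; apply: le_trans (sq_diff _ _) _.
    rewrite lerD2r ler_wpM2l// -[leLHS]real_normK ?num_real//.
    rewrite lerXn2r ?nnegrE ?normr_ge0 ?sqr_ge0//.
    exact: zx.
  have E2 : \sum_c (2 * ((z c l - x c s) * beta c s)) <= 2 * h ^+ 2 * \sum_c `|beta c s|.
    rewrite mulr_sumr; apply: ler_sum => c _; rewrite -mulrA ler_wpM2l//.
    apply: le_trans (ler_norm _) _; rewrite normrM ler_wpM2r//.
    exact: zx.
  have E3 : \sum_c \sum_k (v c k s ^+ 2 - Sig c k s ^+ 2) <=
     (1 + h^-1) * (\sum_c \sum_k (v c k s - Sig c k s) ^+ 2) +
     h * \sum_c \sum_k Sig c k s ^+ 2.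
    rewrite !mulr_sumr -big_split/=; apply: ler_sum => c _.
    rewrite !mulr_sumr -big_split/=; apply: ler_sum => k _; exact: sq_diff.
  have := ler_wpM2l lambda0 E1; move: E2 E3.
  have -> : \sum_c (z c l ^+ 2 - x c s ^+ 2) = \sum_c z c l ^+ 2 - \sum_c x c s ^+ 2.
    by rewrite sumrB.
  have -> : \sum_c (2 * ((z c l - x c s) * beta c s)) =
     \sum_c (2 * z c l * beta c s) - 2 * \sum_c x c s * beta c s.
    by rewrite mulr_sumr -sumrB; apply: eq_bigr => c _; ring.
  have -> : \sum_c \sum_k (v c k s ^+ 2 - Sig c k s ^+ 2) =
     \sum_c \sum_k v c k s ^+ 2 - \sum_c \sum_k Sig c k s ^+ 2.
    by rewrite -sumrB; apply: eq_bigr => c _; rewrite sumrB.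
  have -> : \sum_c (lambda * z c l ^+ 2 + 2 * z c l * beta c s) =
     lambda * (\sum_c z c l ^+ 2) + \sum_c (2 * z c l * beta c s).
    by rewrite mulr_sumr -big_split.
  lra.
pose DQ l := \sum_c \sum_k dq c k l.
have DQ0 l : (l < n)%N -> 0 <= DQ l.
  by move=> ln; apply: sumr_ge0 => c _; apply: sumr_ge0 => k _; exact: dq0.
pose eI l := \int[mu]_(s in `]t l, t l.+1]) err s.
pose bI l := \int[mu]_(s in `]t l, t l.+1]) \sum_c `|beta c s|.
have eI0 l : 0 <= eI l by exact: Rintegral_ge0.
have bI0 l : 0 <= bI l by apply: Rintegral_ge0 => s _; apply: sumr_ge0.
(* One factor of each square is at most [h ^+ 2], the other at most the integral of [|beta|] over
   the cell. *)
have al2 l : (l < n)%N -> rho l -> \sum_c al c l ^+ 2 <= h ^+ 2 * bI l.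
  move=> ln rl; rewrite /bI Rintegral_sum//; last first.
    by move=> c; apply: sub => //; exact: (integrable_norm (Ib c)).
  rewrite mulr_sumr; apply: ler_sum => c _.
  rewrite -real_normK ?num_real// expr2 ler_pM//; first exact: al_le.
  by rewrite alE// le_normr_Rintegral//; exact: sub.
(* [cell] absorbs the bracket with factor 1. The surplus [eta * DQ] is kept apart: it is not small
   with [h], and its total is bounded through [dq_sum]. *)
apply: (@le_trans _ _ (\sum_(l < n) Om * (eI l + (1 + eta^-1) * h ^+ 2 * bI l + eta * DQ l))).
  apply: ler_sum => l _.
  have Y0 : 0 <= eI l + (1 + eta^-1) * h ^+ 2 * bI l + eta * DQ l.
    by rewrite !addr_ge0// !mulr_ge0 ?sqr_ge0 ?DQ0// ltW.
  have [rl|_] := boolP (rho l); last first.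
    by rewrite mulr0 mul0r mulr_ge0//; have /andP[/le_trans a /a] := om01 0.
  have /andP[wl0 wl1] := om01 l.+1.
  rewrite mulr1; apply: le_trans (ler_wpM2r Y0 wl1); rewrite ler_wpM2l//.
  rewrite big_split/= -mulr_sumr -/(DQ l).
  have := cell l (ltn_ord l) rl; have := ler_wpM2l c2 (al2 l (ltn_ord l) rl).
  rewrite -/(DQ l) -/(eI l); lra.
rewrite -mulr_sumr !big_split/= -!mulr_sumr.
rewrite /eI /bI !sum_Rintegral_itv ?tn//.
have DQs : \sum_(l < n) DQ l <= (#|J| * m)%:R * K.
  rewrite /DQ exchange_big/=.
  rewrite (_ : (#|J| * m)%:R * K = \sum_(c : J) \sum_(k < m) K).
    by apply: ler_sum => c _; rewrite exchange_big/=; apply: ler_sum => k _; exact: dq_sum.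
  by rewrite !sumr_const card_ord -mulrnA mulr_natl mulnC.
have Om0 : 0 <= Om by have /andP[/le_trans a /a] := om01 0.
rewrite (mulrCA eta) (mulrCA h) -mulrDr ler_wpM2l//.
have IB0 : 0 <= IB by apply: Rintegral_ge0 => s _; apply: sumr_ge0.
have := err_le; have := ler_wpM2l (ltW eta0) DQs.
have hh : h ^+ 2 <= h by rewrite expr2 ler_piMl// ltW.
have := ler_wpM2r IB0 (ler_wpM2l c2 hh).
rewrite /dissipative_const -/IB; lra.
Qed.

End dissipative_sum.
End riemann_sums.

(** * Uniform continuity on a segment *)

Section uniform_continuity.
Context {R : realType}.

Lemma itv_uniform_continuous (a b : R) (f : R -> R) (e : R) : 0 < e ->
  {within `[a, b], continuous f} ->
  \forall d \near (0:R)^'+, forall s s', a <= s <= b -> a <= s' <= b ->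
    `|s - s'| <= d -> `|f s - f s'| <= e.
Proof.
move=> e0 /subspace_continuousP cf.
have := @segment_compact R a b; rewrite compact_near_coveringP => /near_covering_withinP.
move=> /(_ R ((0:R)^'+) (fun d s => forall s', a <= s' <= b -> `|s - s'| <= d -> `|f s - f s'| <= e) _) H.
suff: \forall d \near (0:R)^'+, `[a, b]%classic `<=` (fun s => forall s', a <= s' <= b -> `|s - s'| <= d -> `|f s - f s'| <= e).
  apply: filterS => d h s s' hs; apply: h.
  by rewrite /= in_itv.
apply: H => x xab.
have := cf x xab => /cvgrPdist_lt/(_ (e / 2) _); rewrite divr_gt0// => /(_ isT).
rewrite near_withinE => /nbhs_ballP[del /= del0 hdel].
have d2 : 0 < del / 2 by rewrite divr_gt0.
exists (ball x (del / 2), [set d | d < del / 2]) => /=.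
  split; first exact: nbhsx_ballx.
  exact: nbhs_right_lt.
move=> [s d] /= [xs ds] sab s' s'ab ss'.
have h1 : `|f x - f s| < e / 2.
  apply: hdel => //; move: xs; rewrite /ball/= => /lt_trans; apply; lra.
have h2 : `|f x - f s'| < e / 2.
  apply: hdel; last by rewrite /= in_itv.
  move: xs; rewrite /ball/= => xs.
  by have := ler_distD s x s'; move: xs ss' ds; lra.
have := ler_distD (f x) (f s) (f s'); rewrite (distrC (f s) (f x)); move: h1 h2; lra.
Qed.

End uniform_continuity.

(** * Time integrals of simple processes *)

Section sp_val_integral.
Context {R : realType} {dO : measure_display} {Om : measurableType dO}.
Local Notation mu := (@lebesgue_measure R).
Local Notation L1 D f := (mu.-integrable D (EFin \o f)).
Implicit Types (S : @simple_process R _ Om).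

Lemma Rintegral_indic_itv (a b s t : R) : a <= b -> s <= t ->
  \int[mu]_(u in `]s, t]) (a < u <= b)%R%:R =
  (Num.min b t - Num.min a t) - (Num.min b s - Num.min a s).
Proof.
move=> ab st.
have -> : (fun u => (a < u <= b)%R%:R) = \1_(`]a, b]%classic) :> (R -> R).
  apply/funext => u; rewrite indicE; congr (_%:R); congr nat_of_bool.
  by apply/idP/idP; rewrite inE/= in_itv/=.
rewrite /Rintegral integral_indic//=.
have -> : `]a, b]%classic `&` `]s, t]%classic = `](Num.max a s), (Num.min b t)]%classic.
  apply/seteqP; split => u /=; rewrite !in_itv/= gt_max le_min.
    by move=> [/andP[-> ->] /andP[-> ->]].
  by move=> /andP[/andP[-> ->] /andP[-> ->]].
rewrite lebesgue_measure_itv/= lte_fin; case: ifPn => [h|]; last rewrite -leNgt => h.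
  rewrite -EFinB/=; move: h; rewrite !maxEle !minEle.
  by case: ifPn; case: ifPn; case: ifPn; case: ifPn; rewrite -?ltNge; lra.
rewrite /=; move: h; rewrite !maxEle !minEle.
by case: ifPn; case: ifPn; case: ifPn; case: ifPn; rewrite -?ltNge; lra.
Qed.

Lemma measurable_indic_itv (a b : R) (D : set R) :
  measurable_fun D (fun u => (a < u <= b)%R%:R : R).
Proof.
have -> : (fun u => (a < u <= b)%R%:R) = \1_(`]a, b]%classic) :> (R -> R).
  apply/funext => u; rewrite indicE; congr (_%:R); congr nat_of_bool.
  by apply/idP/idP; rewrite inE/= in_itv/=.
exact: measurable_indic.
Qed.

Lemma measurable_sp_val S w (D : set R) : measurable_fun D (sp_val S ^~ w).
Proof.
apply: measurable_sum => i; apply: measurable_funM; first exact: measurable_cst.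
exact: measurable_indic_itv.
Qed.

(** The bridge between the bracket of the martingale increments and the Riemann sums, where the
    integrand enters through its time integral. *)
Lemma sp_val_sqr_integral S s t w : {homo sp_time S : i j / (i <= j)%N >-> i <= j} ->
  s <= t ->
  L1 `]s, t] (fun u => sp_val S u w ^+ 2) /\
  \int[mu]_(u in `]s, t]) sp_val S u w ^+ 2 = sp_quad S t w - sp_quad S s w.
Proof.
move=> mS st.
have E : (fun u => sp_val S u w ^+ 2) = (fun u => \sum_(i < sp_size S)
    sp_coef S i w ^+ 2 * (sp_time S i < u <= sp_time S i.+1)%R%:R).
  by apply/funext => u; rewrite sp_val_sqr.
have I1 (i : 'I_(sp_size S)) : L1 `]s, t] (fun u => (sp_time S i < u <= sp_time S i.+1)%R%:R : R).
  apply: (@measurable_bounded_integrable _ _ _ mu) => //.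
  - by rewrite /= lebesgue_measure_itv/=; case: ifP; rewrite ?ltry.
  - exact: measurable_indic_itv.
  - exists 1; split => // M M1 u _ /=; case: (_ < _ <= _);
      by rewrite ?normr1 ?normr0 ltW// (lt_trans _ M1).
rewrite E; split; first by apply: Rintegrable_sum => // i; exact: RintegrableZ.
rewrite Rintegral_sum//; last by move=> i; exact: RintegrableZ.
rewrite /sp_quad -sumrB; apply: eq_bigr => i _.
by rewrite RintegralZl// Rintegral_indic_itv// ?mulrBr//; exact: mS.
Qed.

End sp_val_integral.

(** * Convergence in probability *)

Section convergence_in_probability.
Context {R : realType} {dO : measure_display} {Om : measurableType dO}.
Variable P : probability Om R.
Local Open Scope ereal_scope.

(** If a sum is at least [e], one of its two terms is at least [e / 2]. *)
Lemma cvg_prob0D (Y Z : nat -> Om -> \bar R) :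
  (forall n w, 0 <= Y n w) -> (forall n w, 0 <= Z n w) ->
  cvg_prob0 P Y -> cvg_prob0 P Z -> cvg_prob0 P (fun n w => Y n w + Z n w).
Proof.
move=> Y0 Z0 [mY cY] [mZ cZ]; split=> [n|e e0].
  exact: emeasurable_funD.
have e2 : (0 < e / 2)%R by rewrite divr_gt0.
have mge (V : nat -> Om -> \bar R) (c : R) n : measurable_fun setT (V n) ->
    measurable [set w | c%:E <= V n w].
  by move=> mV; rewrite -[X in measurable X]setTI; exact: emeasurable_fun_c_infty.
have := cvgeD _ (cY _ e2) (cZ _ e2); rewrite adde0 => /(_ _ isT).
apply: (@squeeze_cvge _ _ _ _ (fun=> 0)); last exact: cvg_cst.
apply: nearW => n; rewrite measure_ge0/=.
apply: (@le_trans _ _ (P ([set w | (e / 2)%:E <= Y n w] `|` [set w | (e / 2)%:E <= Z n w]))).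
  apply: le_measure; rewrite ?inE.
  - by apply: (mge (fun n w => Y n w + Z n w)); exact: emeasurable_funD.
  - by apply: measurableU; exact: mge.
  move=> w /= h; apply/orP; rewrite -[X in _ || X]negbK -[X in X || _]negbK -negb_and.
  apply/negP => /andP[]; rewrite -!ltNge => yl zl; move: h; rewrite leNgt => /negP; apply.
  by rewrite [X in X%:E](splitr e) EFinD lteD.
by apply: measureU2; exact: mge.
Qed.

Lemma cvg_prob0_cst0 : cvg_prob0 P (fun _ _ => 0).
Proof.
split=> [n|e e0]; first exact: measurable_cst.
rewrite (_ : (fun n => _) = (fun=> 0)); first exact: cvg_cst.
apply/funext => n; rewrite (_ : [set w | _] = set0) ?measure0//.
by apply/seteqP; split => // w /=; rewrite lee_fin leNgt e0.
Qed.

Lemma cvg_prob0_sum (I : Type) (r : seq I) (Z : I -> nat -> Om -> \bar R) :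
  (forall i n w, 0 <= Z i n w) -> (forall i, cvg_prob0 P (Z i)) ->
  cvg_prob0 P (fun n w => \sum_(i <- r) Z i n w).
Proof.
move=> Z0 cZ; elim: r => [|i r IH].
  under eq_fun do under eq_fun do rewrite big_nil.
  exact: cvg_prob0_cst0.
under eq_fun do under eq_fun do rewrite big_cons.
by apply: cvg_prob0D => // n w; apply: sume_ge0.
Qed.

Lemma cvg_prob0_pick (Z : nat -> Om -> \bar R) (e : R) : (0 < e)%R ->
  cvg_prob0 P Z -> exists n, P [set w | e%:E <= Z n w] <= e%:E.
Proof.
move=> e0 [_ /(_ _ e0)] /fine_cvgP[fP].
move=> /cvgrPdist_le/(_ _ e0) h.
have [n _ hn] := filterI fP h.
exists n; have [fn] := hn n (leqnn n).
rewrite /= sub0r normrN => hle; rewrite -(fineK fn) lee_fin.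
exact: le_trans (ler_norm _) hle.
Qed.


(** Borel-Cantelli: the probabilities are summable, so the upper limit of the bad events is null. *)
Lemma ae_eventually_lt (D : nat -> Om -> \bar R) :
  (forall r, measurable_fun setT (D r)) ->
  (forall r, P [set w | (2 ^- r)%:E <= D r w] <= (2 ^- r)%:E) ->
  {ae P, forall w, \forall r \near \oo, D r w < (2 ^- r)%:E}.
Proof.
move=> mD hD.
pose B r := [set w | (2 ^- r)%:E <= D r w].
have mB r : measurable (B r).
  by rewrite -[X in measurable X]setTI; exact: emeasurable_fun_c_infty.
exists (lim_sup_set B); split.
- apply: bigcapT_measurable => n; exact: bigcup_measurable.
- apply: lim_sup_set_cvg0 => //.
  apply: (@le_lt_trans _ _ (\sum_(r <oo) (2 ^- r)%:E)); first by apply: lee_nneseries => // r _; exact: hD.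
  rewrite (eq_eseriesr (g := fun r => (2 / (2 ^ r.+1)%:R)%:E)) => [|r _].
    by apply: (le_lt_trans (epsilon_trick0 xpredT _)); rewrite ?ltry.
  by rewrite natrX exprS invfM mulrA divff ?mul1r.
move=> w /= h n _; apply: contrapT => hn; apply: h.
exists n => // r /= nr; rewrite ltNge; apply/negP => hr; apply: hn.
by exists r.
Qed.

End convergence_in_probability.

(** * The discrete energy inequality *)

Section energy.
Context {R : realType} {dO : measure_display} {Om : measurableType dO}.
Variables (P : probability Om R) (F : R -> set (set Om)).
Hypothesis hF : is_filtration F.
Local Notation L1 f := (P.-integrable setT (EFin \o f)).
Local Notation Fm s f := (measurable_fun [set: g_sigma_algebraType (F s)] f).
Implicit Types (G D Q z a : Om -> R) (s t : R).

(* The cross term of [a], which is not F_s-measurable, with [D] does not vanish: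
   it is split by 2 a D <= a^2 / eta + eta D^2. *)
Lemma mart_incr_energy s t G z a D Q (eta : R) : 0 <= s -> s <= t -> 0 < eta ->
  mart_incr P F s t D Q ->
  bounded_Fm F s G -> (forall w, G w = 0 \/ G w = 1) ->
  bounded_Fm F s (fun w => G w * z w) -> bounded_Fm F t a ->
  [/\ L1 (fun w => G w * (z w + a w + D w) ^+ 2),
      L1 (fun w => G w * (z w ^+ 2 + 2 * (z w * a w) + (1 + eta^-1) * a w ^+ 2 + (1 + eta) * Q w)) &
      \int[P]_w (G w * (z w + a w + D w) ^+ 2) <=
      \int[P]_w (G w * (z w ^+ 2 + 2 * (z w * a w) + (1 + eta^-1) * a w ^+ 2 + (1 + eta) * Q w))].
Proof.
move=> s0 st eta0 mD bG G01 bGz ba.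
have t0 := le_trans s0 st.
(* As [G] is idempotent, [G z ^+ 2] is the square of [G z], which is bounded even where [z] is
   not. *)
have GG w : G w * G w = G w by case: (G01 w) => ->; rewrite ?mulr0 ?mulr1.
have G0 w : 0 <= G w by case: (G01 w) => ->.
have bGt := bounded_Fm_mono hF s0 st bG.
have bGzt := bounded_Fm_mono hF s0 st bGz.
pose p w := (G w * z w) * (G w * z w) + (2 * ((G w * z w) * a w) + (1 + eta^-1) * (G w * (a w * a w))).
have bp : bounded_Fm F t p.
  apply: bounded_FmD; first exact: bounded_FmM.
  apply: bounded_FmD; apply: bounded_FmM; try exact: bounded_Fm_cst.
    exact: bounded_FmM.
  by apply: bounded_FmM => //; exact: bounded_FmM.
have mDm := Fm_measurable hF t0 (mi_meas mD).
have ID2 := mi_L2 mD.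
have ID := integrable_sqr mDm ID2.
have IGD2 := integrable_bounded_mul hF s0 bG ID2.
have IGzD := integrable_bounded_mul hF s0 bGz ID.
have IaD : L1 (fun w => G w * a w * D w).
  by apply: (integrable_bounded_mul hF t0) => //; exact: bounded_FmM.
have Ip := integrable_bounded P hF t0 bp.
have IGQ := integrable_bounded_mul hF s0 bG (integrable_bounded P hF t0 (mi_Q mD)).
have IR : L1 (fun w => p w + (1 + eta) * (G w * Q w)).
  by apply: RintegrableD => //; exact: RintegrableZ.
have pE w : p w + (1 + eta) * (G w * Q w) =
    G w * (z w ^+ 2 + 2 * (z w * a w) + (1 + eta^-1) * a w ^+ 2 + (1 + eta) * Q w).
  have := GG w; rewrite /p; set g := G w => gg.
  rewrite (_ : g * z w * (g * z w) = (g * g) * (z w * z w)); last by ring.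
  by rewrite gg; ring.
have IL : L1 (fun w => G w * (z w + a w + D w) ^+ 2).
  apply: (eq_Rintegrable (f := fun w => (G w * z w) * (G w * z w) + (2 * ((G w * z w) * a w) + (G w * (a w * a w))) +
     (2 * (G w * z w * D w) + (2 * (G w * a w * D w) + G w * D w ^+ 2)))).
    apply: RintegrableD => //.
      apply: (integrable_bounded P hF t0).
      apply: bounded_FmD; first exact: bounded_FmM.
      apply: bounded_FmD; apply: bounded_FmM => //; try exact: bounded_Fm_cst.
        exact: bounded_FmM.
      exact: bounded_FmM.
    apply: RintegrableD => //; first exact: RintegrableZ.
    by apply: RintegrableD => //; exact: RintegrableZ.
  move=> w; have := GG w; set g := G w => gg.
  rewrite (_ : g * z w * (g * z w) = (g * g) * (z w * z w)); last by ring.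
  by rewrite gg; ring.
have IR2 : L1 (fun w => 2 * (G w * z w * D w) + (p w + (1 + eta) * (G w * D w ^+ 2))).
  apply: RintegrableD => //; first exact: RintegrableZ.
  by apply: RintegrableD => //; exact: RintegrableZ.
split => //; first exact: (eq_Rintegrable IR).
under [leRHS]eq_Rintegral do rewrite -pE.
apply: (@le_trans _ _ (\int[P]_w (2 * (G w * z w * D w) + (p w + (1 + eta) * (G w * D w ^+ 2))))).
  apply: le_Rintegral => // w _.
  have := GG w; rewrite /p; have := G0 w; set g := G w => g0 gg.
  rewrite (_ : g * z w * (g * z w) = (g * g) * (z w * z w)); last by ring.
  rewrite gg -subr_ge0.
  rewrite (_ : _ - _ = g * (eta^-1 * (a w - eta * D w) ^+ 2)).
    by rewrite mulr_ge0// mulr_ge0 ?sqr_ge0// invr_ge0 ltW.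
  by field; rewrite gt_eqF.
rewrite RintegralD//; first last.
- by apply: RintegrableD => //; exact: RintegrableZ.
- exact: RintegrableZ.
rewrite RintegralZl// (mi_mean mD bGz) mulr0 add0r.
rewrite RintegralD//; last exact: RintegrableZ.
rewrite [leRHS]RintegralD//; last exact: RintegrableZ.
rewrite lerD2l !RintegralZl// ler_wpM2l ?addr_ge0 ?(ltW eta0)//.
exact: (mi_sqr mD bG G0).
Qed.


Lemma bounded_Fm_prod s (I : Type) (r : seq I) (f : I -> Om -> R) :
  (forall i, bounded_Fm F s (f i)) -> bounded_Fm F s (fun w => \prod_(i <- r) f i w).
Proof.
move=> bf; elim: r => [|i r IH].
  under eq_fun do rewrite big_nil; exact: bounded_Fm_cst.
under eq_fun do rewrite big_cons; exact: bounded_FmM.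
Qed.

Lemma bounded_Fm_le s G (k : R) : Fm s G -> bounded_Fm F s (fun w => (G w <= k)%R%:R).
Proof.
move=> mG; rewrite (_ : (fun w => _) = \1_(G @^-1` `]-oo, k]%classic)).
  split.
    apply: (@measurable_indic _ (g_sigma_algebraType (F s))).
    by rewrite -[X in measurable X]setTI; apply: mG.
  by exists 1 => w; rewrite indicE; case: (_ \in _); rewrite ?normr1 ?normr0.
apply/funext => w; rewrite indicE; congr (_%:R); congr nat_of_bool.
by apply/idP/idP; rewrite inE/= in_itv/=.
Qed.

(** Writes a stopping rule made of finitely many conditions as a product, to which closure of
    [bounded_Fm] under products applies. *)
Lemma natr_forall (I : finType) (p : pred I) :
  ([forall i, p i])%:R = \prod_i (p i)%:R :> R.
Proof.
have -> : [forall i, p i] = \big[andb/true]_i p i.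
  by rewrite big_andE; apply: eq_forallb.
rewrite (big_morph (fun b : bool => b%:R : R) (id1 := 1) (op1 := *%R))//.
by move=> [] []; rewrite ?mulr1 ?mulr0.
Qed.

(** * The stopped scheme on a grid *)

Section scheme.
Variables (J : finType) (t : nat -> R) (lambda K kappa eta : R) (om : nat -> R).
Variables (x0 : J -> Om -> R) (A M y DQ : J -> nat -> Om -> R).
Hypotheses (mt : {homo t : i j / (i <= j)%N >-> i <= j}) (t0 : 0 <= t 0%N).
Hypotheses (eta0 : 0 < eta) (lambda0 : 0 <= lambda) (K0 : 0 <= K).
Hypothesis om_ge0 : forall l, 0 <= om l.
Hypothesis om_step : forall l, om l.+1 * (1 - lambda * (t l.+1 - t l)) <= om l.
Hypothesis mx0 : forall c, Fm (t 0%N) (x0 c).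
Hypothesis Ix0 : forall c, L1 (fun w => x0 c w ^+ 2).
Hypothesis mA : forall c l, Fm (t l) (A c l).
Hypothesis mM : forall c l, Fm (t l) (M c l).
Hypothesis my : forall c l, Fm (t l) (y c l).
Hypothesis MQ : forall c l, mart_incr P F (t l) (t l.+1)
  (fun w => M c l.+1 w - M c l w) (DQ c l).

Definition scheme_Z c l w : R := x0 c w + (A c l w - A c 0%N w) + (M c l w - M c 0%N w).

(* [rho l] is F_(t l)-measurable and nonincreasing in l: a stopping rule. *)
Definition scheme_rho l w : bool := [forall j : 'I_l.+1, [forall c,
  [&& `|scheme_Z c j w - y c j w| <= kappa, `|y c j w| <= K &
      \sum_(i < j) `|A c i.+1 w - A c i w| <= K]]].

(* A bounded version of the increment of A; they agree when [rho l.+1] holds. *)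
Definition scheme_al c l w : R :=
  (A c l.+1 w - A c l w) * (`|A c l.+1 w - A c l w| <= K)%R%:R.

(** The weights [om] stand for e^(lambda t). [om_step] turns their growth into the term in [lambda],
    so the integral of each summand bounds the gain of the weighted stopped energy over one cell. *)
Definition scheme_U n w : R := \sum_(l < n) om l.+1 * (scheme_rho l w)%:R *
  (\sum_c (lambda * (t l.+1 - t l) * scheme_Z c l w ^+ 2 +
            2 * (scheme_Z c l w * scheme_al c l w) +
            (1 + eta^-1) * scheme_al c l w ^+ 2) +
   (1 + eta) * \sum_c DQ c l w).

Local Notation Z := scheme_Z.
Local Notation rho := scheme_rho.
Local Notation al := scheme_al.
Local Notation U := scheme_U.

Let tge0 l : 0 <= t l.
Proof. by rewrite (le_trans t0)// mt. Qed.

Let lift i l (f : Om -> R) : (i <= l)%N -> Fm (t i) f -> Fm (t l) f.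
Proof. by move=> il; apply: (Fm_mono hF (tge0 i)); rewrite mt. Qed.

Let mZ c l : Fm (t l) (Z c l).
Proof.
apply: measurable_funD; first apply: measurable_funD.
- exact: (@lift 0%N).
- by apply: measurable_funB => //; exact: (@lift 0%N).
- by apply: measurable_funB => //; exact: (@lift 0%N).
Qed.

Lemma scheme_rho_bounded l : bounded_Fm F (t l) (fun w => (rho l w)%:R).
Proof.
under eq_fun do rewrite natr_forall.
apply: bounded_Fm_prod => -[j /= jl]; under eq_fun do rewrite natr_forall.
apply: bounded_Fm_prod => c.
under eq_fun do rewrite -mulnb natrM -mulnb natrM.
have jl' : (j <= l)%N by rewrite -ltnS.
apply: bounded_FmM; last apply: bounded_FmM; apply: bounded_Fm_le; apply: (lift jl').
- by apply: measurableT_comp => //; exact: measurable_funB.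
- exact: measurableT_comp.
- apply: measurable_sum => -[i /= ij]; apply: measurableT_comp => //.
  apply: measurable_funB; [exact: (lift ij (@mA c i.+1))|exact: (lift (ltnW ij) (@mA c i))].
Qed.

Lemma scheme_rhoS l w : rho l.+1 w -> rho l w.
Proof.
move=> /forallP h; apply/forallP => -[j jl].
have jl' : (j < l.+2)%N by rewrite (leq_trans jl).
exact: (h (Ordinal jl')).
Qed.

Lemma scheme_rhoP l w c : rho l w ->
  [/\ `|Z c l w - y c l w| <= kappa, `|y c l w| <= K &
      \sum_(i < l) `|A c i.+1 w - A c i w| <= K].
Proof. by move=> /forallP/(_ ord_max)/forallP/(_ c)/and3P. Qed.

Let al_bounded c l : bounded_Fm F (t l.+1) (al c l).
Proof.
have mdA : Fm (t l.+1) (fun w => A c l.+1 w - A c l w).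
  by apply: measurable_funB => //; exact: (lift (leqnSn l) (@mA c l)).
split.
  apply: measurable_funM => //; apply: (bounded_Fm_le K _).1.
  exact: measurableT_comp.
exists K => w; rewrite /al.
have [h|_] := boolP (`|A c l.+1 w - A c l w| <= K); first by rewrite mulr1.
by rewrite mulr0 normr0.
Qed.

Let al_eq c l w : rho l.+1 w -> al c l w = A c l.+1 w - A c l w.
Proof.
move=> /(@scheme_rhoP _ _ c)[_ _]; rewrite big_ord_recr/= => h.
rewrite /al (_ : (_ <= K)) ?mulr1//; apply: le_trans h; rewrite lerDr.
exact: sumr_ge0.
Qed.

Lemma scheme_Z_le c l w : rho l w -> `|Z c l w| <= K + kappa.
Proof.
move=> /(@scheme_rhoP _ _ c)[h1 h2 _].
rewrite -[Z c l w](subrK (y c l w)) (le_trans (ler_normD _ _))// addrC.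
exact: lerD.
Qed.

Let rhoZ_bounded c l : bounded_Fm F (t l) (fun w => (rho l w)%:R * Z c l w).
Proof.
split; first by apply: measurable_funM => //; exact: (scheme_rho_bounded l).1.
exists `|K + kappa| => w.
have [h|_] := boolP (rho l w); last by rewrite mul0r normr0.
by rewrite mul1r (le_trans (scheme_Z_le c h))// ler_norm.
Qed.

Let rho01 l w : (rho l w)%:R = 0 :> R \/ (rho l w)%:R = 1 :> R.
Proof. by case: (rho l w); [right|left]. Qed.

Let IV l : L1 (fun w => (rho l w)%:R * \sum_c Z c l w ^+ 2).
Proof.
apply: (eq_Rintegrable (f := fun w => \sum_c ((rho l w)%:R * Z c l w) * ((rho l w)%:R * Z c l w))).
  apply: Rintegrable_sum => // c; apply: (integrable_bounded P hF (tge0 l)).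
  exact: bounded_FmM.
move=> w; rewrite mulr_sumr; apply: eq_bigr => c _.
by case: (rho l w); rewrite ?mul1r ?mul0r.
Qed.

Let step c l := mart_incr_energy (tge0 l) (mt (leqnSn l)) eta0 (MQ c l)
  (scheme_rho_bounded l) (rho01 l) (rhoZ_bounded c l) (al_bounded c l).

Let term l w := om l.+1 * (rho l w)%:R *
  (\sum_c (lambda * (t l.+1 - t l) * Z c l w ^+ 2 +
            2 * (Z c l w * al c l w) +
            (1 + eta^-1) * al c l w ^+ 2) +
   (1 + eta) * \sum_c DQ c l w).

Let rhs c l w := (rho l w)%:R * (Z c l w ^+ 2 + 2 * (Z c l w * al c l w) +
  (1 + eta^-1) * al c l w ^+ 2 + (1 + eta) * DQ c l w).

Let Irhs c l : L1 (rhs c l). Proof. by have [] := step c l. Qed.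

(** Separates the one-step bound on the new energy from the old energy, whose coefficient [om_step]
    compares with [om l]; this is what makes the estimates telescope. *)
Let termE l w : term l w = om l.+1 * (\sum_c rhs c l w) -
  om l.+1 * (1 - lambda * (t l.+1 - t l)) * ((rho l w)%:R * \sum_c Z c l w ^+ 2).
Proof.
rewrite /term /rhs -mulr_sumr !big_split/= -!mulr_sumr; ring.
Qed.

Let Iterm l : L1 (term l).
Proof.
apply: (eq_Rintegrable (f := fun w => om l.+1 * (\sum_c rhs c l w) -
  om l.+1 * (1 - lambda * (t l.+1 - t l)) * ((rho l w)%:R * \sum_c Z c l w ^+ 2))).
  apply: RintegrableB => //; last exact: RintegrableZ.
  by apply: RintegrableZ => //; exact: Rintegrable_sum.
by move=> w; rewrite termE.
Qed.

Lemma integrable_scheme_U n : L1 (U n).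
Proof. exact: (Rintegrable_sum measurableT (index_enum _) (fun l : 'I_n => Iterm l)). Qed.

Lemma integrable_scheme_V n : L1 (fun w => (rho n w)%:R * \sum_c Z c n w ^+ 2).
Proof. exact: IV. Qed.

Lemma scheme_energy n :
  om n * \int[P]_w ((rho n w)%:R * \sum_c Z c n w ^+ 2) <=
  om 0%N * \int[P]_w (\sum_c x0 c w ^+ 2) + \int[P]_w U n w.
Proof.
elim: n => [|n IH].
  have -> : \int[P]_w U 0 w = 0.
    by under eq_Rintegral do rewrite /U big_ord0; rewrite Rintegral_cst// mul0r.
  rewrite addr0 ler_wpM2l//; apply: le_Rintegral => //.
  - exact: Rintegrable_sum.
  - move=> w _; rewrite (_ : \sum_c Z c 0 w ^+ 2 = \sum_c x0 c w ^+ 2).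
      have : 0 <= \sum_c x0 c w ^+ 2 by apply: sumr_ge0 => c _; exact: sqr_ge0.
      by case: (rho 0 w) => h; rewrite ?mul1r// mul0r.
    by apply: eq_bigr => c _; rewrite /Z !subrr !addr0.
have -> : \int[P]_w U n.+1 w = \int[P]_w U n w + \int[P]_w term n w.
  rewrite -RintegralD//; last exact: integrable_scheme_U.
  by apply: eq_Rintegral => w _; rewrite /U big_ord_recr.
rewrite addrA; apply: le_trans (lerD IH (lexx _)).
have -> : \int[P]_w term n w = om n.+1 * (\sum_c \int[P]_w rhs c n w) -
  om n.+1 * (1 - lambda * (t n.+1 - t n)) * \int[P]_w ((rho n w)%:R * \sum_c Z c n w ^+ 2).
  under eq_Rintegral do rewrite termE.
  rewrite RintegralB//; last 2 first.
  - by apply: RintegrableZ => //; exact: Rintegrable_sum.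
  - exact: RintegrableZ.
  rewrite RintegralZl//; last exact: Rintegrable_sum.
  by rewrite RintegralZl// Rintegral_sum.
have V0 : 0 <= \int[P]_w ((rho n w)%:R * \sum_c Z c n w ^+ 2).
  apply: Rintegral_ge0 => w _; apply: mulr_ge0 => //; apply: sumr_ge0 => c _.
  exact: sqr_ge0.
(* Where [rho n.+1] holds, the capped increment [al] is the true one, so [Z] advances by [al] plus
   the martingale increment. The factor is then relaxed to [rho n], which is known at the start of
   the cell. *)
have H : \int[P]_w ((rho n.+1 w)%:R * \sum_c Z c n.+1 w ^+ 2) <= \sum_c \int[P]_w rhs c n w.
  apply: (@le_trans _ _ (\sum_c \int[P]_w ((rho n w)%:R * (Z c n w + al c n w + (M c n.+1 w - M c n w)) ^+ 2))).
    rewrite -Rintegral_sum//; last by move=> c; have [] := step c n.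
    apply: le_Rintegral => //.
      by apply: Rintegrable_sum => // c; have [] := step c n.
    move=> w _; rewrite -mulr_sumr.
    have [h|_] := boolP (rho n.+1 w); last first.
      rewrite mul0r mulr_ge0//; apply: sumr_ge0 => c _; exact: sqr_ge0.
    rewrite (scheme_rhoS h) !mul1r; apply: ler_sum => c _.
    rewrite al_eq// le_eqVlt; apply/orP; left; apply/eqP; congr (_ ^+ 2).
    by rewrite /Z; ring.
  by apply: ler_sum => c _; have [] := step c n.
have := ler_wpM2l (om_ge0 n.+1) H.
have := ler_wpM2r V0 (om_step n).
lra.
Qed.

(** At the last index where [rho] holds, it bounds all earlier increments by [K] in total, and the
    cap bounds the last one by [K]. *)
Lemma scheme_al_sum_le n c w : \sum_(l < n) (rho l w)%:R * `|al c l w| <= 2 * K.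
Proof.
have alA l : `|al c l w| <= `|A c l.+1 w - A c l w|.
  rewrite /al normrM ler_piMr//; by case: (_ <= K); rewrite ?normr1 ?normr0.
have alK l : `|al c l w| <= K.
  have [_ [k hk]] := al_bounded c l; rewrite /al.
  have [h|_] := boolP (`|A c l.+1 w - A c l w| <= K); first by rewrite mulr1.
  by rewrite mulr0 normr0.
elim: n => [|n IH]; first by rewrite big_ord0 mulr_ge0.
rewrite big_ord_recr/=; have [h|_] := boolP (rho n w); last by rewrite mul0r addr0.
have [_ _ hA] := scheme_rhoP c h.
rewrite mul1r mulr_natl mulr2n lerD//; apply: le_trans hA; apply: ler_sum => l _.
by apply: le_trans (alA l); rewrite ler_piMl//; case: (rho l w).
Qed.

(** The bound sees the partition only through its total length, so it provides the dominating
    constant when the mesh tends to 0. *)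
Lemma scheme_U_le n (Om' Kq : R) w : (forall l, (l <= n)%N -> om l <= Om') -> kappa <= 1 ->
  (forall c l, 0 <= DQ c l w) -> (forall c, \sum_(l < n) DQ c l w <= Kq) ->
  U n w <= Om' * (#|J|%:R * (lambda * (t n - t 0%N) * (K + 1) ^+ 2 +
     (2 * (K + 1) + (1 + eta^-1) * K) * (2 * K) + (1 + eta) * Kq)).
Proof.
move=> omO k1 DQ0 DQK.
have c2 : 0 <= 1 + eta^-1 by rewrite addr_ge0 ?invr_ge0 ?(ltW eta0).
have Om0 : 0 <= Om' by exact: le_trans (om_ge0 0) (omO 0%N isT).
pose B l := \sum_c (lambda * (t l.+1 - t l) * (K + 1) ^+ 2 +
   (2 * (K + 1) + (1 + eta^-1) * K) * ((rho l w)%:R * `|al c l w|) + (1 + eta) * DQ c l w).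
have alK c l : `|al c l w| <= K.
  rewrite /al.
  have [h|_] := boolP (`|A c l.+1 w - A c l w| <= K); first by rewrite mulr1.
  by rewrite mulr0 normr0.
have B0 l : 0 <= B l.
  have dt : 0 <= t l.+1 - t l by rewrite subr_ge0 mt.
  have k0 : 0 <= K + 1 by rewrite addr_ge0.
  have k2 : 0 <= 2 * (K + 1) + (1 + eta^-1) * K by rewrite addr_ge0 ?mulr_ge0.
  have k3 : 0 <= 1 + eta by rewrite addr_ge0// ltW.
  apply: sumr_ge0 => c _; apply: addr_ge0; last by rewrite mulr_ge0.
  apply: addr_ge0; last by apply: mulr_ge0 => //; exact: mulr_ge0.
  by apply: mulr_ge0; [exact: mulr_ge0|exact: sqr_ge0].
have UB : U n w <= \sum_(l < n) Om' * B l.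
  apply: ler_sum => l _.
  have [h|_] := boolP (rho l w); last by rewrite mulr0 mul0r mulr_ge0.
  rewrite mulr1; apply: le_trans (ler_wpM2r (B0 l) (omO l.+1 (ltn_ord l))).
  rewrite ler_wpM2l// mulr_sumr -big_split/=; apply: ler_sum => c _.
  rewrite h mul1r lerD2r -addrA lerD//.
    rewrite ler_wpM2l ?mulr_ge0 ?subr_ge0 ?mt//.
    rewrite -real_normK ?num_real// lerXn2r ?nnegrE ?addr_ge0//.
    by rewrite (le_trans (scheme_Z_le c h))// lerD2l.
  rewrite [leRHS]mulrDl; apply: lerD.
    rewrite -mulrA ler_wpM2l//; apply: le_trans (ler_norm _) _; rewrite normrM.
    rewrite ler_wpM2r//.
    by rewrite (le_trans (scheme_Z_le c h))// lerD2l.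
  rewrite -mulrA ler_wpM2l// -real_normK ?num_real// expr2 ler_wpM2r//.
apply: (le_trans UB); rewrite -mulr_sumr ler_wpM2l// /B exchange_big/=.
rewrite (_ : forall z : R, #|J|%:R * z = \sum_(c : J) z); last first.
  by move=> z; rewrite sumr_const mulr_natl.
apply: ler_sum => c _; rewrite !big_split/= -!mulr_sumr lerD//; last first.
  by rewrite ler_wpM2l// addr_ge0// ltW.
rewrite lerD//; last first.
  rewrite ler_wpM2l ?scheme_al_sum_le// addr_ge0// mulr_ge0// addr_ge0//.
rewrite -mulr_suml -mulr_sumr.
rewrite (_ : \sum_(i < n) (t i.+1 - t i) = t n - t 0%N)//.
by rewrite -(big_mkord xpredT (fun i => t i.+1 - t i)) telescope_sumr.
Qed.

End scheme.
End energy.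

Lemma limn_einf_le_near (R : realType) (u : (\bar R)^nat) (a : R) :
  (forall e : R, 0 < e -> \forall n \near \oo, (u n <= (a + e)%:E)%E) ->
  (limn_einf u <= a%:E)%E.
Proof.
move=> h; apply/lee_addgt0Pr => e e0; rewrite limn_einf_lim -EFinD.
apply: lime_le; first exact: is_cvg_einfs.
apply: filterS (h e e0) => n; apply: le_trans.
by apply: ereal_inf_lbound; exists n => /=.
Qed.

(** * The uniform grid on [0, T] *)

Section grid.
Context {R : realType}.
Variable T : R.
Hypothesis T0 : 0 < T.

(** The minimum freezes the grid at [T] from index [r + 1] on, so that it is monotone and bounded by
    [T] over all indices. *)
Definition grid (r l : nat) : R := T * (minn l r.+1)%:R / r.+1%:R.

Lemma grid_mono r : {homo grid r : i j / (i <= j)%N >-> i <= j}.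
Proof.
move=> i j ij; rewrite /grid ler_wpM2r ?invr_ge0// ler_wpM2l ?(ltW T0)//.
by rewrite ler_nat leq_min (leq_trans (geq_minl _ _) ij) geq_minr.
Qed.

Lemma grid0 r : grid r 0 = 0.
Proof. by rewrite /grid min0n mulr0 mul0r. Qed.

Lemma gridT r : grid r r.+1 = T.
Proof. by rewrite /grid minnn mulfK// pnatr_eq0. Qed.

Lemma grid_ge0 r l : 0 <= grid r l.
Proof. by rewrite -(grid0 r) grid_mono. Qed.

Lemma grid_le r l : grid r l <= T.
Proof.
rewrite /grid ler_pdivrMr ?ltr0n// ler_wpM2l ?(ltW T0)// ler_nat geq_minr//.
Qed.

Lemma grid_step r l : grid r l.+1 - grid r l <= T / r.+1%:R.
Proof.
rewrite /grid -mulrBl -mulrBr ler_wpM2r ?invr_ge0// -[leRHS]mulr1.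
rewrite ler_wpM2l ?(ltW T0)// lerBlDr -[1]/(1%:R) -natrD ler_nat.
by rewrite add1n -minnSS leq_min geq_minl (leq_trans (geq_minr _ _)).
Qed.

Lemma near_grid_step (e : R) : 0 < e -> \forall r \near \oo, T / r.+1%:R <= e.
Proof.
move=> e0; near=> r; rewrite ler_pdivrMr ?ltr0n// mulrC -ler_pdivrMr//.
by apply: (@le_trans _ _ r%:R); [near: r; exact: nbhs_infty_ger|rewrite ler_nat].
Unshelve. all: by end_near. Qed.

Lemma near_expN2 (e : R) : 0 < e -> \forall r \near \oo, 2 ^- r <= e :> R.
Proof.
move=> e0; near=> r; rewrite -exprVn.
suff: `|(2^-1 : R) ^+ r| <= e by exact: le_trans (ler_norm _).
rewrite -normrN -[- _]sub0r; near: r.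
have := @cvg_expr R 2^-1; rewrite ger0_norm ?invr_ge0// invf_lt1 ?ltr1n// => /(_ isT).
by move=> /cvgrPdist_le/(_ _ e0).
Unshelve. all: by end_near. Qed.

End grid.

(** * Almost sure approximation by simple integrals *)

Section approximation.
Context {R : realType} {dO : measure_display} {Om : measurableType dO}.
Variables (P : probability Om R) (F : R -> set (set Om)).
Variables (J : finType) (m : nat) (T : R).
Variables (B Sig I : J -> 'I_m -> R -> Om -> R).
Hypothesis T0 : 0 < T.
Hypothesis ito : forall c k, ito_integral P F (B c k) (Sig c k) (I c k).
Local Notation mu := (@lebesgue_measure R).

(* Convergence in probability only gives this along a subsequence, by
   Borel-Cantelli; whence the summable rate 2^-r. *)
Lemma simple_approximation : exists S : nat -> J -> 'I_m -> @simple_process R _ Om,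
  (forall r c k, simple_adapted F (S r c k)) /\
  {ae P, forall w, \forall r \near \oo,
    (forall c l, (l <= r.+1)%N ->
      `|\sum_k (sp_int (S r c k) (B c k) (grid T r l) w - I c k (grid T r l) w)| <= 2 ^- r) /\
    (forall c k, (\int[mu]_(s in `[0%R, T])
       ((sp_val (S r c k) s w - Sig c k s w) ^+ 2)%:E < (2 ^- r)%:E)%E)}.
Proof.
have /choice[S0 hS0] : forall ck : J * 'I_m, exists S : nat -> @simple_process R _ Om,
   (forall n, simple_adapted F (S n)) /\
        forall t, 0 <= t ->
          cvg_prob0 P (fun n w => \int[lebesgue_measure]_(s in `[0%R, t])
            ((sp_val (S n) s w - Sig ck.1 ck.2 s w) ^+ 2)%:E)%E /\
          cvg_prob0 P (fun n w => `|sp_int (S n) (B ck.1 ck.2) t w - I ck.1 ck.2 t w|%:E).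
  by move=> [c k] /=; have [_ _ _] := ito c k.
(* One sum gathers the errors at all grid times and the L^2 errors on [[0, T]], over all components,
   so that a single index [n_ r] controls them together. *)
pose D r n w := (\sum_c \sum_k ((\sum_(l < r.+2)
   `|sp_int (S0 (c, k) n) (B c k) (grid T r l) w - I c k (grid T r l) w|%:E) +
   \int[mu]_(s in `[0%R, T]) ((sp_val (S0 (c, k) n) s w - Sig c k s w) ^+ 2)%:E))%E.
have I0 c k n w : (0 <= \int[mu]_(s in `[0%R, T]) ((sp_val (S0 (c, k) n) s w - Sig c k s w) ^+ 2)%:E)%E.
  by apply: integral_ge0 => s _; rewrite lee_fin sqr_ge0.
have N0 r c k n w : (0 <= \sum_(l < r.+2)
   `|sp_int (S0 (c, k) n) (B c k) (grid T r l) w - I c k (grid T r l) w|%:E)%E.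
  by apply: sume_ge0 => l _; rewrite lee_fin.
have cD r : cvg_prob0 P (D r).
  apply: cvg_prob0_sum => [c n w|c].
    by apply: sume_ge0 => k _; rewrite adde_ge0.
  apply: cvg_prob0_sum => [k n w|k]; first by rewrite adde_ge0.
  have [_ h] := hS0 (c, k); apply: cvg_prob0D => //; last exact: (h T (ltW T0)).1.
  apply: cvg_prob0_sum => [l n w|l]; first by rewrite lee_fin.
  exact: (h _ (grid_ge0 T0 r l)).2.
have e0 r : 0 < 2 ^- r :> R by rewrite invr_gt0 exprn_gt0.
have /choice[n_ hn] : forall r, exists n, (P [set w | (2 ^- r)%:E <= D r n w] <= (2 ^- r)%:E)%E.
  by move=> r; exact: cvg_prob0_pick (e0 r) (cD r).
exists (fun r c k => S0 (c, k) (n_ r)); split.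
  by move=> r c k; have [h _] := hS0 (c, k); exact: h.
have := @ae_eventually_lt _ _ _ P (fun r => D r (n_ r)) (fun r => (cD r).1 (n_ r)) hn.
apply: filterS => w; apply: filterS => r hD.
have Dc c : (\sum_k ((\sum_(l < r.+2)
   `|sp_int (S0 (c, k) (n_ r)) (B c k) (grid T r l) w - I c k (grid T r l) w|%:E) +
   \int[mu]_(s in `[0%R, T]) ((sp_val (S0 (c, k) (n_ r)) s w - Sig c k s w) ^+ 2)%:E) < (2 ^- r)%:E)%E.
  apply: le_lt_trans hD; rewrite /D (bigD1 c)//= leeDl// sume_ge0// => c' _.
  by apply: sume_ge0 => k _; exact: adde_ge0 (N0 _ _ _ _ _) (I0 _ _ _ _).
split=> [c l lr|c k].
  rewrite -lee_fin; apply: le_trans (ltW (Dc c)).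
  apply: (@le_trans _ _ (\sum_k `|sp_int (S0 (c, k) (n_ r)) (B c k) (grid T r l) w - I c k (grid T r l) w|%:E)%E).
    by rewrite sumEFin lee_fin ler_norm_sum.
  apply: lee_sum => k _.
  rewrite (bigD1 (Ordinal (lr : (l < r.+2)%N)))//= -addeA leeDl// adde_ge0//.
  by apply: sume_ge0 => l' _; rewrite lee_fin.
apply: le_lt_trans (Dc c); rewrite (bigD1 k)//= [X in (_ <= X + _)%E]addeC -addeA leeDl//.
apply: adde_ge0; first exact: N0.
by apply: sume_ge0 => k' _; exact: adde_ge0 (N0 _ _ _ _ _) (I0 _ _ _ _).
Qed.

End approximation.

(** * Dissipative stochastic differential equations *)

Section dissipative_sde.
Context {R : realType} {dO : measure_display} {Om : measurableType dO}.
Variables (P : probability Om R) (F : R -> set (set Om)).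
Hypothesis hF : is_filtration F.
Local Notation mu := (@lebesgue_measure R).
Local Notation L1 D f := (mu.-integrable D (EFin \o f)).
Local Notation Fm s f := (measurable_fun [set: g_sigma_algebraType (F s)] f).
Variables (J : finType) (m : nat) (T lambda : R).
Variables (W : J -> R -> Om -> 'rV[R]_m) (x beta : J -> R -> Om -> R).
Variables (x0 : J -> Om -> R) (Sig I : J -> 'I_m -> R -> Om -> R).
Hypotheses (T0 : 0 < T) (lambda0 : 0 <= lambda).
Hypothesis hW : forall c, brownian_motion P F (W c).
Hypothesis mx : forall c t, 0 <= t -> Fm t (x c t).
Hypothesis mx0 : forall c, Fm 0 (x0 c).
Hypothesis Ix0 : forall c, P.-integrable setT (EFin \o (fun w => x0 c w ^+ 2)).
Hypothesis mI : forall c k t, 0 <= t -> Fm t (I c k t).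

Let B c k t w := W c t w 0 k.

Section approximated.
Variable S : nat -> J -> 'I_m -> @simple_process R _ Om.
Hypothesis aS : forall r c k, simple_adapted F (S r c k).

Record good_path w : Prop := {
  gp_x : forall c, {within `[0, T], continuous (x c ^~ w)} ;
  gp_beta : forall c, L1 `[0, T] (beta c ^~ w) ;
  gp_Sig_meas : forall c k, measurable_fun `[0, T] (Sig c k ^~ w) ;
  gp_Sig_sqr : forall c k, (\int[mu]_(s in `[0%R, T]) (Sig c k s w ^+ 2)%:E < +oo)%E ;
  gp_eq : forall c t, 0 <= t <= T ->
    x c t w = x0 c w + \int[mu]_(s in `[0, t]) beta c s w + \sum_k I c k t w ;
  gp_dis : forall s, 0 <= s ->
    2 * (\sum_c x c s w * beta c s w) + \sum_c \sum_k Sig c k s w ^+ 2 <=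
    - lambda * \sum_c x c s w ^+ 2 ;
  gp_approx : \forall r \near \oo,
    (forall c l, (l <= r.+1)%N ->
      `|\sum_k (sp_int (S r c k) (B c k) (grid T r l) w - I c k (grid T r l) w)| <= 2 ^- r) /\
    (forall c k, (\int[mu]_(s in `[0%R, T])
       ((sp_val (S r c k) s w - Sig c k s w) ^+ 2)%:E < (2 ^- r)%:E)%E) }.

(** The shift keeps the level at least 1, so that the cap in [scheme_al] never cuts a drift
    increment below 1. *)
Let cap (K : nat) : R := K.+1%:R.
Let tr r K c k := sp_trunc (S r c k) T (cap K).
(** The drift is read off from the equation rather than defined as an integral of [beta]:
    adaptedness is then immediate, and the two agree on good paths. *)
Let A r c l w := x c (grid T r l) w - x0 c w - \sum_k I c k (grid T r l) w.
Let M r K c l w := \sum_k sp_int (tr r K c k) (B c k) (grid T r l) w.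
Let y r c l := x c (grid T r l).
Let DQ r K c l w := \sum_k sp_quad (tr r K c k) (grid T r l.+1) w -
  \sum_k sp_quad (tr r K c k) (grid T r l) w.
Let om r l := expR (lambda * grid T r l).
Let kap (r : nat) : R := 2 ^- r.
Let Z r K := scheme_Z x0 (A r) (M r K).
Let rho r K := scheme_rho (cap K) (kap r) x0 (A r) (M r K) (y r).
Let V r K w : R := (rho r K r.+1 w)%:R * \sum_c Z r K c r.+1 w ^+ 2.
Let U r K eta w := scheme_U (grid T r) lambda (cap K) (kap r) eta (om r) x0
  (A r) (M r K) (y r) (DQ r K) r.+1 w.
Let Omx : R := expR (lambda * T).
Let CK (K : nat) : R := Omx * ((#|J| * m)%:R * cap K).

Let mono r c k := sa_mono (@aS r c k).

Let cap0 K : 0 <= cap K. Proof. by []. Qed.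

Let cap1 K : 1 <= cap K. Proof. by rewrite ler1n. Qed.

Let kap1 r : kap r <= 1.
Proof. by rewrite invf_le1 ?exprn_gt0// exprn_ege1// ler1n. Qed.

Let om0 r l : 0 <= om r l. Proof. exact: expR_ge0. Qed.

Let om_le r l : om r l <= Omx.
Proof. by rewrite ler_expR ler_wpM2l// grid_le. Qed.

Let om_step r l : om r l.+1 * (1 - lambda * (grid T r l.+1 - grid T r l)) <= om r l.
Proof.
rewrite (_ : om r l = om r l.+1 * expR (- (lambda * (grid T r l.+1 - grid T r l)))).
  by rewrite ler_wpM2l// expR_ge1Dx.
by rewrite -expRD; congr expR; ring.
Qed.

Let mx0' r c : Fm (grid T r 0) (x0 c). Proof. by rewrite grid0. Qed.

Let mA r c l : Fm (grid T r l) (A r c l).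
Proof.
have t0 := grid_ge0 T0 r l.
apply: measurable_funB; first apply: measurable_funB.
- exact: mx.
- exact: (Fm_mono hF (lexx 0) t0).
- by apply: measurable_sum => k; exact: mI.
Qed.

Let sp_int0 S' (b : R -> Om -> R) w : simple_adapted F S' -> sp_int S' b 0 w = 0.
Proof.
move=> aS'; apply: big1 => i _.
by rewrite !min_r ?subrr ?mulr0// (sp_time_ge0 _ aS').
Qed.

Let sp_quad0 S' w : simple_adapted F S' -> sp_quad S' 0 w = 0.
Proof.
move=> aS'; apply: big1 => i _.
by rewrite !min_r ?subrr ?mulr0// (sp_time_ge0 _ aS').
Qed.

Let atr r K c k : simple_adapted F (tr r K c k).
Proof. exact: sp_trunc_adapted. Qed.

Let MQ' r K c s t : 0 <= s -> s <= t ->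
  mart_incr P F s t
   (fun w => \sum_k sp_int (tr r K c k) (B c k) t w - \sum_k sp_int (tr r K c k) (B c k) s w)
   (fun w => \sum_k sp_quad (tr r K c k) t w - \sum_k sp_quad (tr r K c k) s w).
Proof. by move=> s0 st; exact: (mart_incr_simple hF (hW c) (atr r K c) s0 st). Qed.

Let MQ r K c l : mart_incr P F (grid T r l) (grid T r l.+1)
  (fun w => M r K c l.+1 w - M r K c l w) (DQ r K c l).
Proof. by apply: MQ'; [exact: grid_ge0|exact: grid_mono]. Qed.

Let M0 r K c w : M r K c 0 w = 0.
Proof. by rewrite /M grid0 big1// => k _; exact: sp_int0. Qed.

Let mM r K c l : Fm (grid T r l) (M r K c l).
Proof.
have := mi_meas (MQ' r K c (lexx 0) (grid_ge0 T0 r l)).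
congr measurable_fun; apply/funext => w; rewrite [X in _ - X]big1 ?subr0// => k _.
exact: sp_int0.
Qed.

Let my r c l : Fm (grid T r l) (y r c l).
Proof. by apply: mx; exact: grid_ge0. Qed.

Let t00 r : 0 <= grid T r 0. Proof. exact: grid_ge0. Qed.

Let IV r K : P.-integrable setT (EFin \o V r K).
Proof.
exact: (integrable_scheme_V P hF _ _ (grid_mono T0 r) (t00 r) (@mx0' r) (@mA r) (@mM r K) (@my r)).
Qed.

Let IU r K eta : 0 < eta -> P.-integrable setT (EFin \o U r K eta).
Proof.
move=> eta0.
exact: (integrable_scheme_U hF _ _ _ (grid_mono T0 r) (t00 r) eta0 (cap0 K) (@mx0' r) (@mA r) (@mM r K) (@my r) (@MQ r K)).
Qed.

Let energy r K eta : 0 < eta ->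
  Omx * \int[P]_w V r K w <= \int[P]_w (\sum_c x0 c w ^+ 2) + \int[P]_w U r K eta w.
Proof.
move=> eta0.
have := scheme_energy hF (kap r) (grid_mono T0 r) (t00 r) eta0 (cap0 K) (om0 r)
  (om_step r) (@mx0' r) Ix0 (@mA r) (@mM r K) (@my r) (@MQ r K) r.+1.
by rewrite {1}/om gridT {1}/om grid0 mulr0 expR0 mul1r.
Qed.

Let DQE r K c l w : DQ r K c l w = \sum_k (sp_quad (tr r K c k) (grid T r l.+1) w -
  sp_quad (tr r K c k) (grid T r l) w).
Proof. by rewrite /DQ sumrB. Qed.

Let dq_ge0 r K c k l w : 0 <= sp_quad (tr r K c k) (grid T r l.+1) w -
  sp_quad (tr r K c k) (grid T r l) w.
Proof. by rewrite subr_ge0 sp_quad_mono ?grid_mono//; exact: sa_mono (atr r K c k). Qed.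

Let dq_sum r K c k w : \sum_(l < r.+1) (sp_quad (tr r K c k) (grid T r l.+1) w -
  sp_quad (tr r K c k) (grid T r l) w) <= cap K.
Proof.
rewrite -(big_mkord xpredT (fun l => sp_quad (tr r K c k) (grid T r l.+1) w -
  sp_quad (tr r K c k) (grid T r l) w)) telescope_sumr// gridT grid0.
by rewrite sp_quad0// subr0 sp_quad_trunc_le//; exact: mono.
Qed.

Let U_ub K eta : 0 < eta -> exists Bd, forall r w, U r K eta w <= Bd.
Proof.
move=> eta0; eexists => r w.
apply: le_trans.
  apply: (scheme_U_le hF x0 (M r K) (y r) (grid_mono T0 r) (t00 r) eta0 lambda0 (cap0 K) (om0 r) (@mA r) (Om' := Omx) (Kq := m%:R * cap K)).
  - by move=> l _; exact: om_le.
  - exact: kap1.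
  - by move=> c l; rewrite DQE; apply: sumr_ge0 => k _; exact: dq_ge0.
  - move=> c; under eq_bigr do rewrite DQE.
    rewrite exchange_big/= (_ : m%:R * cap K = \sum_(k < m) cap K).
      by apply: ler_sum => k _; exact: dq_sum.
    by rewrite sumr_const card_ord mulr_natl.
rewrite gridT grid0 subr0; exact: lexx.
Qed.

Section path.
Variable w : Om.
Hypothesis gw : good_path w.

Let sub0 : `]0, T] `<=` `[0%R, T].
Proof. by move=> s /=; rewrite !in_itv/= => /andP[/ltW -> ->]. Qed.

Let restr f : L1 `[0, T] f -> L1 `]0, T] f.
Proof. by apply: integrableS => //; exact: sub0. Qed.

Let Ib c : L1 `]0, T] (beta c ^~ w).
Proof. exact/restr/(gp_beta gw). Qed.

Let Ix c : L1 `]0, T] (fun s => x c s w ^+ 2).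
Proof.
apply: restr.
apply: continuous_compact_integrable; first exact: segment_compact.
move=> s; apply: (@continuous_comp _ _ _ _ (fun z : R => z ^+ 2)); first exact: (gp_x gw).
exact: exprn_continuous.
Qed.

Let IS c k : L1 `]0, T] (fun s => Sig c k s w ^+ 2).
Proof.
apply: restr; apply/integrableP; split.
  by apply/measurable_EFinP; apply: measurable_funX; exact: (gp_Sig_meas gw).
under eq_integral do rewrite /= ger0_norm ?sqr_ge0//.
exact: (gp_Sig_sqr gw).
Qed.

Let Iv r c k : L1 `]0, T] (fun s => sp_val (S r c k) s w ^+ 2).
Proof. by have [] := sp_val_sqr_integral w (mono r c k) (ltW T0). Qed.

Let IvS r c k : L1 `]0, T] (fun s => (sp_val (S r c k) s w - Sig c k s w) ^+ 2).
Proof.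
apply: (@le_Rintegrable _ _ _ mu _ _ _ (fun s => 2 * sp_val (S r c k) s w ^+ 2 + 2 * Sig c k s w ^+ 2)) => //.
- apply: measurable_funX; apply: measurable_funB; first exact: measurable_sp_val.
  exact: measurable_funS sub0 (gp_Sig_meas gw c k).
- move=> s _; rewrite ger0_norm ?sqr_ge0//.
  by have := sqr_ge0 (sp_val (S r c k) s w + Sig c k s w); lra.
- by apply: RintegrableD => //; exact: RintegrableZ.
Qed.

Let approx_fin r : (forall c k, (\int[mu]_(s in `[0%R, T])
       ((sp_val (S r c k) s w - Sig c k s w) ^+ 2)%:E < (2 ^- r)%:E)%E) ->
  forall c k, \int[mu]_(s in `]0, T]) (sp_val (S r c k) s w - Sig c k s w) ^+ 2 <= kap r.
Proof.
move=> h c k; rewrite -lee_fin /Rintegral fineK; last by apply: integrable_fin_num => //; exact: IvS.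
apply: le_trans (ltW (h c k)); apply: ge0_subset_integral => //.
- apply/measurable_EFinP; apply: measurable_funX; apply: measurable_funB.
    exact: measurable_sp_val.
  exact: (gp_Sig_meas gw).
- by move=> s _; rewrite lee_fin sqr_ge0.
Qed.

Let AE r c l : A r c l w = \int[mu]_(s in `[0, grid T r l]) beta c s w.
Proof.
by rewrite /A (gp_eq gw) ?grid_ge0 ?grid_le//; ring.
Qed.

Let A0 r c : A r c 0 w = 0.
Proof. by rewrite AE grid0 set_itv1 Rintegral_set1. Qed.

Let dAE r c l : A r c l.+1 w - A r c l w =
  \int[mu]_(s in `](grid T r l), (grid T r l.+1)]) beta c s w.
Proof.
rewrite !AE; apply: Rintegral_itvB.
- apply: integrableS (gp_beta gw c) => //= s /=; rewrite !in_itv/= => /andP[-> h].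
  by rewrite (le_trans h)// grid_le.
- by rewrite bnd_simp grid_ge0.
- by rewrite bnd_simp grid_mono.
Qed.

Let dA_sum r c j : \sum_(i < j) `|A r c i.+1 w - A r c i w| <=
  \int[mu]_(s in `]0, T]) `|beta c s w|.
Proof.
have If l : L1 `]0, grid T r l] (fun s => `|beta c s w|).
  by apply: integrable_itv_sub (integrable_norm (Ib c)) => //; exact: grid_le.
apply: (@le_trans _ _ (\sum_(i < j) \int[mu]_(s in `](grid T r i), (grid T r i.+1)]) `|beta c s w|)).
  apply: ler_sum => i _; rewrite dAE le_normr_Rintegral//.
  apply: integrable_itv_sub (Ib c); [exact: grid_ge0|exact: grid_le].
rewrite sum_Rintegral_itv//; last 2 first.
- exact: grid_mono.
- exact: grid0.
rewrite /Rintegral fine_le//.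
- exact: integrable_fin_num.
- by apply: integrable_fin_num => //; exact: (integrable_norm (Ib c)).
- apply: ge0_subset_integral => //.
  + by have /measurable_int := integrable_norm (Ib c).
  + by move=> s /=; rewrite !in_itv/= => /andP[-> h]; rewrite (le_trans h)// grid_le.
Qed.

Let near_osc (f : J -> R -> R) (e : R) : 0 < e ->
  (forall c, {within `[0, T], continuous (f c)}) -> \forall r \near \oo, forall c s s',
  0 <= s <= T -> 0 <= s' <= T -> `|s - s'| <= T / r.+1%:R -> `|f c s - f c s'| <= e.
Proof.
move=> e0 cf; apply: filter_forall => c.
have : \forall d \near (0:R)^'+, 0 < d /\ (forall s s', 0 <= s <= T -> 0 <= s' <= T ->
    `|s - s'| <= d -> `|f c s - f c s'| <= e).
  by near=> d; split; near: d; [exact: nbhs_right_gt|exact: itv_uniform_continuous].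
move=> /filter_ex[d [d0 hd]].
apply: filterS (near_grid_step T d0) => r hr s s' hs hs' ss'.
by apply: hd => //; exact: le_trans ss' hr.
Unshelve. all: by end_near. Qed.

Let grid_in r l : 0 <= grid T r l <= T.
Proof. by rewrite grid_ge0// grid_le. Qed.

Let grid_dist r l : `|grid T r l.+1 - grid T r l| <= T / r.+1%:R.
Proof. by rewrite ger0_norm ?grid_step// subr_ge0 grid_mono. Qed.

Let U_bound r K eta h : 0 < eta -> 0 < h -> h <= 1 ->
  (forall c s s', 0 <= s <= T -> 0 <= s' <= T -> `|s - s'| <= T / r.+1%:R ->
     `|x c s w - x c s' w| <= h ^+ 2 / 2) ->
  (forall c l, `|A r c l.+1 w - A r c l w| <= h ^+ 2) ->
  kap r <= h ^+ 2 / 2 ->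
  (forall c k, \int[mu]_(s in `]0, T]) (sp_val (S r c k) s w - Sig c k s w) ^+ 2 <= kap r) ->
  U r K eta w <= eta * CK K + h * (Omx * dissipative_const T lambda eta
     (fun c s => x c s w) (fun c s => beta c s w) (fun c k s => Sig c k s w)).
Proof.
move=> eta0 h0 h1 hx hA hk hS.
have h2 : h ^+ 2 <= 1 by rewrite expr_le1// ltW.
have alE c l : scheme_al (cap K) (A r) c l w = A r c l.+1 w - A r c l w.
  by rewrite /scheme_al (le_trans (hA c l)) ?mulr1// (le_trans h2).
have UE : U r K eta w = \sum_(l < r.+1) om r l.+1 * (rho r K l w)%:R *
    (\sum_c (lambda * (grid T r l.+1 - grid T r l) * Z r K c l w ^+ 2 +
      2 * (Z r K c l w * scheme_al (cap K) (A r) c l w) +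
      (1 + eta^-1) * scheme_al (cap K) (A r) c l w ^+ 2) +
     (1 + eta) * \sum_c \sum_k (sp_quad (tr r K c k) (grid T r l.+1) w -
       sp_quad (tr r K c k) (grid T r l) w)).
  apply: eq_bigr => l _; congr (_ * (_ + _ * _)); apply: eq_bigr => c _.
  exact: DQE.
rewrite UE /CK.
apply: (dissipative_sum_le (J := J) (m := m) (n := r.+1) (t := grid T r) (T := T)
  (lambda := lambda) (h := h) (eta := eta) (Om := Omx) (K := cap K)
  (x := fun c s => x c s w) (beta := fun c s => beta c s w)
  (Sig := fun c k s => Sig c k s w) (v := fun c k s => sp_val (S r c k) s w)
  (om := om r) (rho := rho r K ^~ w) (z := fun c l => Z r K c l w)
  (al := fun c l => scheme_al (cap K) (A r) c l w)
  (dq := fun c k l => sp_quad (tr r K c k) (grid T r l.+1) w -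
       sp_quad (tr r K c k) (grid T r l) w)) => //.
- exact: grid_mono.
- exact: grid0.
- exact: gridT.
- by move=> l; rewrite om0 om_le.
- by move=> s s0 _; apply: (gp_dis gw); exact: ltW.
- move=> c l s _ rl ls sl.
  (* At most [h ^+ 2 / 2] comes from the distance of [Z] to [x] at the grid point, and as much from
     the oscillation of [x] within the cell. *)
  have [hZ _ _] := scheme_rhoP c rl.
  have sT : 0 <= s <= T.
    by rewrite (le_trans (grid_ge0 T0 r l) (ltW ls)) (le_trans sl (grid_le T0 r _)).
  have := hx c (grid T r l) s (grid_in r l) sT.
  have -> : `|grid T r l - s| <= T / r.+1%:R.
    rewrite distrC ger0_norm ?subr_ge0 ?(ltW ls)//; apply: le_trans (grid_step T0 r l).
    by rewrite lerD2r.
  move=> /(_ isT) hxs.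
  have := ler_distD (y r c l w) (Z r K c l w) (x c s w).
  move: hZ hxs hk; rewrite -/(Z r K c l w) /y; lra.
- by move=> c l _ _; rewrite alE dAE.
- by move=> c l _ _; rewrite alE.
- move=> c k l _.
  have [_ ->] := sp_val_sqr_integral w (mono r c k) (grid_mono T0 r (leqnSn l)).
  by apply: sp_quad_trunc_incr; [exact: mono|exact: grid_mono].
- by move=> c k; apply: le_trans (hS c k) _; move: hk; have := sqr_ge0 h; lra.
Qed.

Let A_cont c : {within `[0, T], continuous (fun s => \int[mu]_(u in `[0, s]) beta c u w)}.
Proof. exact: (parameterized_integral_continuous (ltW T0) (gp_beta gw c)). Qed.

Lemma U_limit K eta e : 0 < eta -> 0 < e -> \forall r \near \oo, U r K eta w <= eta * CK K + e.
Proof.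
move=> eta0 e0.
set D := dissipative_const T lambda eta
     (fun c s => x c s w) (fun c s => beta c s w) (fun c k s => Sig c k s w).
have Om0 : 0 < Omx by exact: expR_gt0.
have D1 : 0 < Omx * (`|D| + 1) by rewrite mulr_gt0// ltr_wpDl.
(* [D] depends on the path but not on [r], so [h] is fixed before [r] grows; [|D| + 1] is positive
   whatever [D] is. *)
pose h := Num.min 1 (e / (Omx * (`|D| + 1))).
have h0 : 0 < h by rewrite lt_min ltr01 divr_gt0.
have h1 : h <= 1 by rewrite ge_min lexx.
have he : h * (Omx * D) <= e.
  apply: (@le_trans _ _ (h * (Omx * (`|D| + 1)))).
    by rewrite ler_pM2l// ler_pM2l// (le_trans (ler_norm _))// lerDl.
  by rewrite -ler_pdivlMr// ge_min lexx orbT.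
have h22 : 0 < h ^+ 2 / 2 by rewrite divr_gt0// exprn_gt0.
have oscA : \forall r \near \oo, forall c l, `|A r c l.+1 w - A r c l w| <= h ^+ 2.
  apply: filterS (near_osc (exprn_gt0 2 h0) A_cont) => r hr c l; rewrite !AE.
  exact: (hr c _ _ (grid_in r l.+1) (grid_in r l) (grid_dist r l)).
near=> r.
apply: (@le_trans _ _ (eta * CK K + h * (Omx * D))); last by rewrite lerD2l.
apply: U_bound => //.
- near: r; exact: (near_osc h22 (gp_x gw)).
- by near: r.
- near: r; exact: near_expN2.
- near: r; apply: filterS (gp_approx gw) => r [_ hr]; exact: approx_fin.
Unshelve. all: by end_near. Qed.

Let x_bounded : exists C, forall c s, 0 <= s <= T -> `|x c s w| <= C.
Proof.
have /choice[C hC] : forall c, exists C, forall s, 0 <= s <= T -> `|x c s w| <= C.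
  move=> c; have cn : {within `[0, T], continuous (fun s => `|x c s w|)}.
    by move=> s; apply: continuous_comp; [exact: (gp_x gw)|exact: norm_continuous].
  have [s0 _ h] := EVT_max (ltW T0) cn.
  by exists `|x c s0 w| => s hs; apply: h; rewrite in_itv.
exists (\sum_c `|C c|) => c s hs; apply: le_trans (hC c s hs) _.
by rewrite (bigD1 c)//= (le_trans (ler_norm _))// lerDl sumr_ge0.
Qed.

(** For a given path, neither truncation nor stopping acts once [K] is large. The threshold [K0] is
    independent of [r], and the range of [r] of [K], so both can tend to infinity together. *)
Lemma V_limit : exists K0 : nat, \forall r \near \oo, forall K, (K0 <= K)%N ->
  V r K w = \sum_c Z r K c r.+1 w ^+ 2 /\
  (forall c, `|Z r K c r.+1 w - x c T w| <= kap r).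
Proof.
have [C hC] := x_bounded.
pose b := \sum_c \int[mu]_(s in `]0, T]) `|beta c s w|.
(* A bound on the brackets, from v^2 <= 2 (v - Sig)^2 + 2 Sig^2, where the integral of (v - Sig)^2
   is at most [kap r <= 1]. *)
pose g := \sum_c \sum_k (2 + 2 * \int[mu]_(s in `]0, T]) Sig c k s w ^+ 2).
have [K0 hK0] : exists K0 : nat, `|C| + b + g <= K0%:R.
  exists (Num.Def.truncn (`|C| + b + g)).+1; apply: ltW; exact: truncnS_gt.
have b0 : 0 <= b by apply: sumr_ge0 => c _; exact: Rintegral_ge0.
have i0 c k : 0 <= \int[mu]_(s in `]0, T]) Sig c k s w ^+ 2.
  by apply: Rintegral_ge0 => s _; exact: sqr_ge0.
have g0 : 0 <= g.
  apply: sumr_ge0 => c _; apply: sumr_ge0 => k _.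
  by rewrite addr_ge0// mulr_ge0.
exists K0; apply: filterS (gp_approx gw) => r [h1 /approx_fin h2] K K0K.
have capK : K0%:R <= cap K by rewrite ler_nat (leq_trans K0K).
have QK c k : sp_quad (S r c k) T w <= cap K.
  have [_ E] := sp_val_sqr_integral w (mono r c k) (ltW T0).
  have -> : sp_quad (S r c k) T w = \int[mu]_(u in `]0, T]) sp_val (S r c k) u w ^+ 2.
    by rewrite E (sp_quad0 _ (aS r c k)) subr0.
  apply: (@le_trans _ _ (2 + 2 * \int[mu]_(s in `]0, T]) Sig c k s w ^+ 2)); last first.
    apply: le_trans capK; apply: le_trans hK0.
    apply: (@le_trans _ _ g); last by rewrite lerDr addr_ge0.
    rewrite /g (bigD1 c)//= (bigD1 k)//=  -[leRHS]addrA lerDl addr_ge0//.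
      by apply: sumr_ge0 => k' _; rewrite addr_ge0// mulr_ge0.
    apply: sumr_ge0 => c' _; apply: sumr_ge0 => k' _.
    by rewrite addr_ge0// mulr_ge0.
  apply: (@le_trans _ _ (\int[mu]_(s in `]0, T]) (2 * (sp_val (S r c k) s w - Sig c k s w) ^+ 2 + 2 * Sig c k s w ^+ 2))).
    apply: le_Rintegral => //.
      by apply: RintegrableD => //; exact: RintegrableZ.
    move=> s _; have := sqr_ge0 (sp_val (S r c k) s w - 2 * Sig c k s w); lra.
  rewrite RintegralD//; [|exact: RintegrableZ|exact: RintegrableZ].
  rewrite !RintegralZl// lerD2r.
  by have := h2 c k; have := kap1 r; lra.
(* Since [A] is built from [x] and the limit integrals, [Z - y] is exactly the error of the simple
   integrals; by [QK] truncation leaves these unchanged. *)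
have MI c l : (l <= r.+1)%N -> `|Z r K c l w - y r c l w| <= kap r.
  move=> lr; apply: le_trans (h1 c l lr).
  rewrite /Z /scheme_Z A0 M0 !subr0.
  rewrite (_ : _ - _ = \sum_k (sp_int (S r c k) (B c k) (grid T r l) w - I c k (grid T r l) w))//.
  rewrite sumrB (_ : M r K c l w = \sum_k sp_int (S r c k) (B c k) (grid T r l) w).
    by rewrite /A /y; ring.
  by apply: eq_bigr => k _; apply: sp_int_trunc; [exact: mono|exact: QK].
have rT : rho r K r.+1 w.
  apply/forallP => -[j /= jr]; apply/forallP => c; apply/and3P; split.
  - by apply: MI; rewrite -ltnS.
  - apply: le_trans (hC c _ (grid_in r j)) _; apply: le_trans capK; apply: le_trans hK0.
    rewrite -addrA (le_trans (ler_norm _))// lerDl addr_ge0//.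
  - apply: le_trans (dA_sum r c j) _; apply: le_trans capK; apply: le_trans hK0.
    apply: (@le_trans _ _ b); last first.
      by rewrite (addrC `|C|) -addrA lerDl addr_ge0.
    by rewrite /b (bigD1 c)//= lerDl; apply: sumr_ge0 => c' _; exact: Rintegral_ge0.
split; first by rewrite /V rT mul1r.
by move=> c; have := MI c r.+1 (leqnn _); rewrite /y gridT.
Qed.

End path.
Hypothesis good_ae : {ae P, forall w, good_path w}.

Let E0 := \int[P]_w (\sum_c x0 c w ^+ 2).

Let EU_limit K eta e : 0 < eta -> 0 < e ->
  \forall r \near \oo, \int[P]_w U r K eta w <= eta * CK K + e.
Proof.
move=> eta0 e0; have [Bd hBd] := U_ub K eta0.
(* [U] is controlled from above only, so dominated convergence is applied to the positive part of
   its excess, which tends to 0. *)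
pose f r w := Num.max (U r K eta w - eta * CK K) 0.
have mU r := Rintegrable_meas (IU r K eta0).
have mf r : measurable_fun setT (f r).
  by apply: measurable_maxr => //; apply: measurable_funB.
have f0 r w : 0 <= f r w by rewrite le_max lexx orbT.
have fB r w : `|f r w| <= `|Bd| + `|eta * CK K|.
  rewrite ger0_norm// ge_max addr_ge0// andbT lerD//.
    exact: le_trans (hBd r w) (ler_norm _).
  by rewrite -normrN ler_norm.
have Icst c : P.-integrable setT (EFin \o (fun=> c : R)).
  exact: finite_measure_integrable_cst.
have If r : P.-integrable setT (EFin \o f r).
  by apply: (le_Rintegrable measurableT (mf r) _ (Icst (`|Bd| + `|eta * CK K|))) => w _.
have cf : \int[P]_w f r w @[r --> \oo] --> \int[P]_w (fun=> 0 : R) w.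
  apply: (Rintegral_dominated measurableT mf _ _ (Icst (`|Bd| + `|eta * CK K|))).
  - exact: measurable_cst.
  - apply: filterS good_ae => w gw _; apply/cvgrPdist_le => e' e'0.
    apply: filterS (U_limit gw K eta0 e'0) => r hr.
    by rewrite sub0r normrN ger0_norm// ge_max (ltW e'0) andbT lerBlDl.
  - by apply: aeW => w r _; exact: fB.
rewrite Rintegral_cst// mul0r in cf.
move/cvgrPdist_le : cf => /(_ _ e0); apply: filterS => r.
rewrite sub0r normrN => /(le_trans (ler_norm _)) h.
apply: (@le_trans _ _ (\int[P]_w (eta * CK K + f r w))).
  apply: le_Rintegral => //.
  - exact: IU.
  - exact: RintegrableD.
  - by move=> w _; rewrite -lerBlDl /f le_max lexx.
rewrite RintegralD// Rintegral_cst// lerD//.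
have PT : fine (P setT) = 1 :> R by rewrite probability_setT.
rewrite le_eqVlt; apply/orP; left; apply/eqP; rewrite -[RHS]mulr1.
by congr (_ * _); exact: PT.
Qed.

(* For each K, eta is chosen so that the error eta * CK K is below 1/K. *)
Let pick_r K : exists r, (K <= r)%N /\ Omx * \int[P]_w V r K w <= E0 + K.+1%:R^-1.
Proof.
have CK0 : 0 <= CK K by rewrite mulr_ge0 ?expR_ge0// mulr_ge0.
have k0 : 0 < (K.+1%:R^-1 / 2 : R) by rewrite divr_gt0// invr_gt0 ltr0n.
have eta0 : 0 < K.+1%:R^-1 / 2 / (CK K + 1) by rewrite divr_gt0// ltr_wpDl.
have [r [Kr hr]] := filter_ex (filterI (nbhs_infty_ge K) (EU_limit K eta0 k0)).
exists r; split => //; apply: le_trans (energy r K eta0) _.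
rewrite lerD2l; apply: le_trans hr _.
rewrite -[leRHS](addrNK (K.+1%:R^-1 / 2)) lerD2r.
rewrite [X in _ <= X](_ : _ = K.+1%:R^-1 / 2); last by rewrite [X in X - _]splitr addrK.
by rewrite mulrAC ler_pdivrMr ?ltr_wpDl// ler_wpM2l ?lerDl// ltW.
Qed.

(** The second moment of [x] at [T] could a priori be infinite; Fatou's lemma bounds it, finiteness
    included, through the integrable variables [V]. *)
Lemma dissipative_sde_approx :
  (\int[P]_w (\sum_c x c T w ^+ 2)%:E <= (expR (- (lambda * T)) * E0)%:E)%E.
Proof.
have /choice[r_ hr] := pick_r.
pose g K w := V (r_ K) K w.
have mg K : measurable_fun setT (EFin \o g K).
  by apply/measurable_EFinP; exact: Rintegrable_meas (IV (r_ K) K).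
have g0 K w : (0 <= (g K w)%:E)%E.
  by rewrite lee_fin mulr_ge0//; apply: sumr_ge0 => c _; exact: sqr_ge0.
(* Division by [Omx] then does not enlarge the error [1 / (K + 1)] of [pick_r]. *)
have Om1 : 1 <= Omx by rewrite -expR0 ler_expR mulr_ge0// ltW.
have Om0 : 0 < Omx by exact: lt_le_trans ltr01 Om1.
have near_kap (e : R) : 0 < e -> \forall K \near \oo, kap (r_ K) <= e.
  move=> e0; have [N _ hN] := near_expN2 e0.
  exists N => // K /= NK; apply: hN => /=; exact: leq_trans NK (hr K).1.
have fat := fatou P measurableT mg (fun n x _ => g0 n x).
apply: (@le_trans _ _ (\int[P]_w limn_einf (fun K => (g K w)%:E)))%E.
  apply: ae_ge0_le_integral => //.
  - by move=> w _; rewrite lee_fin; apply: sumr_ge0 => c _; exact: sqr_ge0.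
  - apply/measurable_EFinP; apply: measurable_sum => c; apply: measurable_funX.
    exact: (Fm_measurable hF (ltW T0) (mx c (ltW T0))).
  - move=> w _; rewrite limn_einf_lim; apply: lime_ge; first exact: is_cvg_einfs.
    apply: nearW => n; apply: le_ereal_inf_tmp => _ [k /= _ <-]; exact: g0.
  - rewrite /limn_einf; apply: measurableT_comp => //.
    apply: measurable_fun_limn_esup => n; apply: measurableT_comp => //; exact: mg.
  apply: filterS good_ae => w gw _.
  have [K0 [N _ hN]] := V_limit gw.
  have cg : (g K w)%:E @[K --> \oo] --> (\sum_c x c T w ^+ 2)%:E.
    apply/cvg_EFin; first exact: nearW.
    have cZ c : Z (r_ K) K c (r_ K).+1 w @[K --> \oo] --> x c T w.
      apply/cvgrPdist_le => e e0; near=> K.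
      have K0K : (K0 <= K)%N by near: K; exact: nbhs_infty_ge.
      have NK : (N <= K)%N by near: K; exact: nbhs_infty_ge.
      have [_ h] := hN (r_ K) (leq_trans NK (hr K).1) K K0K.
      by rewrite distrC (le_trans (h c))//; near: K; exact: near_kap.
    apply: (@cvg_trans _ ((\sum_c Z (r_ K) K c (r_ K).+1 w ^+ 2) @[K --> \oo])).
      apply: near_eq_cvg; near=> K.
      have K0K : (K0 <= K)%N by near: K; exact: nbhs_infty_ge.
      have NK : (N <= K)%N by near: K; exact: nbhs_infty_ge.
      by have [<- _] := hN (r_ K) (leq_trans NK (hr K).1) K K0K.
    apply: cvg_big => [|c _]; first exact: add_continuous.
    exact: (@cvg_comp _ _ _ _ (fun z : R => z ^+ 2) _ _ _ (cZ c) (@exprn_continuous R 2 _)).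
  by have [-> _] := cvg_limn_einf_sup cg.
apply: (le_trans fat); apply: limn_einf_le_near => e e0.
have [N _ hN] := near_infty_natSinv_lt (PosNum e0).
exists N => // K /= NK.
have -> : (\int[P]_w (EFin \o g K) w)%E = (\int[P]_w V (r_ K) K w)%:E.
  by rewrite /Rintegral fineK//; apply: integrable_fin_num => //; exact: IV.
have [_ h] := hr K.
rewrite lee_fin expRN mulrC -/Omx -(ler_pM2l Om0) mulrDr mulrCA divff ?gt_eqF// mulr1.
apply: (le_trans h); rewrite lerD2l; apply: le_trans (ltW (hN K NK)) _ => /=.
by rewrite ler_peMl// ltW.
Unshelve. all: by end_near. Qed.

End approximated.
End dissipative_sde.

(** With [C + 1] for [C], the logarithm [L] of the constant is nonnegative even if [C = 0], and
    [L / t] is below [e] as soon as [t > L / e]. *)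
Lemma limsup_log_le (R : realType) (u : R -> \bar R) (lambda C : R) : 0 <= C ->
  (forall t, 0 < t -> (0 <= u t <= (expR (- (lambda * t)) * C)%:E)%E) ->
  (limf_esup (fun t : R => (t^-1)%:E * lne (u t)) (pinfty_nbhs R) <= (- lambda)%:E)%E.
Proof.
move=> C0 hu; apply/lee_addgt0Pr => e e0; rewrite limf_esupE.
pose L := ln (C + 1).
have C1 : 0 < C + 1 by rewrite ltr_wpDl.
have L0 : 0 <= L by rewrite ln_ge0// lerDr.
apply: (@le_trans _ _ (ereal_sup [set ((t^-1)%:E * lne (u t))%E | t in [set t | L / e < t]])).
  apply: ereal_inf_lbound; exists [set t | L / e < t] => //.
  by exists (L / e); split; first exact: num_real.
apply: ge_ereal_sup => _ /= [t Lt <-].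
have t0 : 0 < t by apply: le_lt_trans Lt; rewrite divr_ge0// ltW.
have /andP[u0 uC] := hu t t0.
have v0 : 0 < expR (- (lambda * t)) * (C + 1) by rewrite mulr_gt0 ?expR_gt0.
have uC' : (u t <= (expR (- (lambda * t)) * (C + 1))%:E)%E.
  apply: (le_trans uC); rewrite lee_fin ler_wpM2l ?expR_ge0// lerDl//.
apply: (@le_trans _ _ ((t^-1)%:E * lne (expR (- (lambda * t)) * (C + 1))%:E)%E).
  rewrite lee_pmul2l ?lte_fin ?invr_gt0// lee_lne// in_itv/= ?u0 ?leey//.
  by rewrite lee_fin (ltW v0).
rewrite lne_EFin// lnM ?posrE ?expR_gt0// expRK -EFinM -EFinD lee_fin -/L.
rewrite mulrDr mulrN mulrCA mulVf ?gt_eqF// mulr1 lerD2l mulrC.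
by rewrite ler_pdivrMr// mulrC -ler_pdivrMr// ltW.
Qed.

(** * Empirical measures *)

Section empirical_wasserstein.
Context {R : realType} {d N : nat}.
Variable hN : (0 < N)%N.
Local Notation Rd := (borel_rV R d).

Lemma nth_enum_ord_map (f : 'I_N -> 'rV[R]_d) (i : 'I_N) :
  nth 0 [seq f i | i <- enum 'I_N] i = f i.
Proof. by rewrite (nth_map i) ?size_enum_ord// nth_ord_enum. Qed.

Lemma dotpp_ge0 n (z : 'rV[R]_n) : 0 <= dotp z z.
Proof. by apply: sumr_ge0 => i _; rewrite -expr2 sqr_ge0. Qed.

Lemma enorm_sqr n (z : 'rV[R]_n) : enorm z ^+ 2 = \sum_i z 0 i ^+ 2.
Proof. by rewrite sqr_sqrtr ?dotpp_ge0//; apply: eq_bigr => i _; rewrite expr2. Qed.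

Lemma calW2_empirical (x : 'I_N -> 'rV[R]_d) :
  calW2 (empirical hN x) ^+ 2 = N%:R^-1 * \sum_i enorm (x i) ^+ 2.
Proof.
have mf : measurable_fun [set: Rd]
    (EFin \o (fun y : Rd => enorm (y : 'rV[R]_d) ^+ 2)).
  by apply/measurable_EFinP; apply: measurable_funX; exact: measurable_enorm.
have f0 (y : Rd) : setT y -> (0 <= (enorm (y : 'rV[R]_d) ^+ 2)%:E)%E.
  by rewrite lee_fin sqr_ge0.
rewrite sqr_sqrtr; last by rewrite fine_ge0// integral_ge0.
rewrite /moment2 /= /emp ge0_integral_mscale//= ge0_integral_measure_sum//.
rewrite (eq_bigr (fun i : 'I_N => (enorm (x i) ^+ 2)%:E)) => [|i _].
  by rewrite sumEFin -EFinM.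
apply: etrans (integral_dirac _ measurableT mf) _.
by rewrite diracT mul1e nth_enum_ord_map.
Qed.

Lemma measurable_coord (i : 'I_d) : measurable_fun [set: Rd] (fun z : Rd => (z : 'rV[R]_d) 0 i).
Proof.
apply: (measurability _ (RGenOpens.measurableE R)).
move=> _ [_ [r [s ->] <-]]; rewrite setTI; apply: sub_sigma_algebra.
have /continuousP : continuous (fun z : 'rV[R]_d => z 0 i) by exact: coord_continuous.
by apply; exact: interval_open.
Qed.

Lemma measurable_enorm_sub :
  measurable_fun [set: (Rd * Rd)%type]
    (fun z => enorm ((z.1 : 'rV[R]_d) - z.2) ^+ 2).
Proof.
rewrite (_ : (fun z => _) = (fun z : (Rd * Rd)%type =>
    \sum_i ((z.1 : 'rV[R]_d) 0 i - (z.2 : 'rV[R]_d) 0 i) ^+ 2)).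
  apply: measurable_sum => i; apply: measurable_funX; apply: measurable_funB.
    exact: (measurableT_comp (measurable_coord i) measurable_fst).
  exact: (measurableT_comp (measurable_coord i) measurable_snd).
by apply/funext => z; rewrite enorm_sqr; apply: eq_bigr => i _; rewrite !mxE.
Qed.

Section pair_empirical.
Variables x y : 'I_N -> 'rV[R]_d.

Let diracs (k : nat) : {measure set (Rd * Rd) -> \bar R} :=
  dirac ((nth 0 [seq x i | i <- enum 'I_N] k : Rd),
         (nth 0 [seq y i | i <- enum 'I_N] k : Rd)).

(** The coupling that matches particles of equal index. It need not be optimal, but it bounds [W2]
    by the root mean square displacement. *)
Definition pair_emp : set (Rd * Rd) -> \bar R :=
  mscale (N%:R^-1)%:nng (msum diracs N).

HB.instance Definition _ := Measure.on pair_emp.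

Lemma pair_empE (A : set (Rd * Rd)) :
  pair_emp A = (N%:R^-1 * \sum_(i < N) \1_A (x i : Rd, y i : Rd))%:E.
Proof.
rewrite /pair_emp /mscale /= /msum EFinM; congr (_ * _)%E.
rewrite -sumEFin; apply: eq_bigr => i _.
by rewrite /diracs !nth_enum_ord_map.
Qed.

Let pair_emp_setT : pair_emp setT = 1%E.
Proof.
rewrite pair_empE (eq_bigr (fun=> 1)) => [|i _]; last by rewrite indicT.
by rewrite sumr_const card_ord mulVf// pnatr_eq0 -lt0n.
Qed.

HB.instance Definition _ := Measure_isProbability.Build _ _ _ pair_emp pair_emp_setT.

Lemma W2_empirical_le :
  W2 (empirical hN x) (empirical hN y) ^+ 2 <= N%:R^-1 * \sum_i enorm (x i - y i) ^+ 2.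
Proof.
pose C := [set (\int[pi]_z (enorm ((z.1 : 'rV[R]_d) - z.2) ^+ 2)%:E)%E
       | pi in coupling (empirical hN x) (empirical hN y)].
have C0 : (0 <= ereal_inf C)%E.
  apply: le_ereal_inf_tmp => _ [pi _ <-]; apply: integral_ge0 => z _.
  by rewrite lee_fin sqr_ge0.
have mf : measurable_fun [set: (Rd * Rd)%type]
    (fun z => (enorm ((z.1 : 'rV[R]_d) - z.2) ^+ 2)%:E).
  by apply/measurable_EFinP; exact: measurable_enorm_sub.
have f0 (z : (Rd * Rd)%type) : setT z -> (0 <= (enorm ((z.1 : 'rV[R]_d) - z.2) ^+ 2)%:E)%E.
  by rewrite lee_fin sqr_ge0.
have CE : C (N%:R^-1 * \sum_i enorm (x i - y i) ^+ 2)%:E.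
  exists pair_emp; last first.
    rewrite /pair_emp ge0_integral_mscale//= ge0_integral_measure_sum//.
    rewrite (eq_bigr (fun i : 'I_N => (enorm (x i - y i) ^+ 2)%:E)) => [|i _].
      by rewrite sumEFin -EFinM.
    apply: etrans (integral_dirac _ measurableT mf) _.
    by rewrite diracT mul1e !nth_enum_ord_map.
  move=> A mA; split.
  - rewrite [LHS]pair_empE [RHS]empE; congr ((_ * _)%:E); apply: eq_bigr => i _.
    by rewrite !indicE; congr (nat_of_bool _)%:R; apply/idP/idP; rewrite !inE/=; tauto.
  - rewrite [LHS]pair_empE [RHS]empE; congr ((_ * _)%:E); apply: eq_bigr => i _.
    by rewrite !indicE; congr (nat_of_bool _)%:R; apply/idP/idP; rewrite !inE/=; tauto.
rewrite /W2 -/C sqr_sqrtr ?fine_ge0//.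
have := ereal_inf_lbound CE; move: C0.
by case: (ereal_inf C) => [r| |] //=; rewrite ?lee_fin.
Qed.

End pair_empirical.

Lemma W2_empirical_lt (x y : 'I_N -> 'rV[R]_d) (e : R) : 0 < e ->
  (forall i, enorm (x i - y i) < e) -> W2 (empirical hN x) (empirical hN y) < e.
Proof.
move=> e0 h; rewrite -(@ltr_pXn2r _ 2)// ?nnegrE ?sqrtr_ge0// ?(ltW e0)//.
apply: le_lt_trans (W2_empirical_le x y) _.
rewrite mulrC ltr_pdivrMr ?ltr0n//.
rewrite (_ : e ^+ 2 * N%:R = \sum_(i < N) e ^+ 2).
  apply: ltr_sum => [|i _]; first by apply/hasP; exists (Ordinal hN); rewrite ?mem_index_enum.
  by rewrite ltr_pXn2r ?nnegrE ?sqrtr_ge0 ?h// ltW.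
by rewrite sumr_const card_ord mulr_natr.
Qed.

(** [ito_integral] makes the time integral of the squared integrand finite but says nothing of
    measurability in time. That follows here from continuity of the particles, hence of their
    empirical measure for [W2]. *)
Lemma measurable_coef_path (n p : nat) (f : 'rV[R]_d -> P2 R d -> 'M[R]_(n, p))
    (T : R) (xi : 'I_N -> R -> 'rV[R]_d) (j : 'I_N) (a : 'I_n) (k : 'I_p) :
  borel_coef f -> (forall i, {within `[0, T], continuous (xi i)}) ->
  measurable_fun `[0, T] (fun s => f (xi j s) (empirical hN (fun i => xi i s)) a k).
Proof.
move=> bf cxi mD B mB.
pose phi s := (xi j s, empirical hN (fun i => xi i s)).
(* The sets of times with measurable trace on [[0, T]] form a sigma-algebra, so it remains to treat
   preimages under [phi] of the generators [openP2]. *)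
pose S := [set A : set R | measurable (`[0, T] `&` A)].
have sS : sigma_algebra setT S.
  split.
  - by rewrite /S /= setI0.
  - move=> A SA; rewrite /S /= setTD.
    rewrite (_ : `[0, T] `&` ~` A = `[0, T] `\` (`[0, T] `&` A)); first exact: measurableD.
    by apply/seteqP; split => s /=; tauto.
  - move=> A SA; rewrite /S /= setI_bigcupr; exact: bigcupT_measurable.
have hB : <<s @open 'M[R]_(n, p) >> [set A : 'M[R]_(n, p) | B (A a k)].
  have : <<s @open R >> B by rewrite -borel_realE.
  move: B {mB}; apply: preimage_sigma; first exact: smallest_sigma_algebra.
  move=> V oV; apply: sub_sigma_algebra.
  have /continuousP : continuous (fun A : 'M[R]_(n, p) => A a k) by exact: coord_continuous.
  exact.
have /(preimage_sigma (f := phi) sS) := bf _ hB; apply => V oV.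
rewrite /S /=.
have loc s : (`[0, T] `&` phi @^-1` V) s -> exists2 e : R, 0 < e &
    forall s', s' \in `[0, T] -> `|s - s'| < e -> V (phi s').
  move=> [sT Vs]; have [e e0 he] := oV _ Vs.
  have : \forall s' \near within `[0, T] (nbhs s), forall i, enorm (xi i s - xi i s') < e.
    apply: filter_forall => i.
    have /subspace_continuousP/(_ s sT) cs := cxi i.
    have : enorm (xi i s - xi i s') @[s' --> within `[0, T] (nbhs s)] --> enorm (xi i s - xi i s).
      apply: (@cvg_comp _ _ _ (fun s' => xi i s - xi i s') (@enorm R d)); last exact: enorm_continuous.
      by apply: cvgB => //; exact: cvg_cst.
    rewrite subrr => /cvgr_lt; apply; rewrite (_ : enorm 0 = 0)//.
    by apply/eqP; rewrite sqrtr_eq0 le_eqVlt /dotp big1 ?eqxx// => k' _; rewrite mxE mul0r.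
  rewrite near_withinE => /nbhs_ballP[r /= r0 hr]; exists r => // s' s'T ss'.
  apply: he => /=; first exact: (hr s' ss' s'T j).
  by apply: W2_empirical_lt => // i; exact: (hr s' ss' s'T i).
(* A union of balls, hence open, whose trace on [[0, T]] is the relatively open preimage. *)
pose O := \bigcup_(z in [set z : R * R | 0 < z.2 /\ forall s', s' \in `[0, T] -> `|z.1 - s'| < z.2 -> V (phi s')]) ball z.1 z.2.
have -> : `[0, T] `&` phi @^-1` V = `[0, T] `&` O.
  apply/seteqP; split => s /=.
    move=> [sT Vs]; split => //; have [e e0 he] := loc s (conj sT Vs).
    by exists (s, e) => //=; exact: ballxx.
  move=> [sT [[u e] /= [e0 he] us]]; split => //; exact: he.
apply: measurableI => //; apply: open_measurable; apply: bigcup_open => z _.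
exact: ball_open.
Qed.

End empirical_wasserstein.

(** * Initial data and their laws *)

Section random_vectors.
Context {R : realType} {dO : measure_display} {Om : measurableType dO}.
Variables (P : probability Om R) (F : R -> set (set Om)).
Hypothesis hF : is_filtration F.
Variables (m d N : nat).

Lemma measurable_wrt_coord t (Y : Om -> 'rV[R]_d) (i : 'I_d) : 0 <= t ->
  measurable_wrt (F 0) Y ->
  measurable_fun [set: g_sigma_algebraType (F t)] (fun w => Y w 0 i).
Proof.
move=> t0 mY; apply: (@adapted_coord _ _ _ _ hF d (fun=> Y) t i t0) => s s0 B mB.
by apply: (filt_mono hF (lexx 0) s0); exact: mY.
Qed.

Lemma measurable_wrt_enorm (Y : Om -> 'rV[R]_d) : measurable_wrt (F 0) Y ->
  measurable_fun [set: Om] (fun w => enorm (Y w)).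
Proof.
move=> mY _ B mB; rewrite setTI; apply: (filt_sub hF (lexx 0)).
apply: (mY ((@enorm R d) @^-1` B)).
by rewrite -[X in <<s _ >> X]setTI; exact: (@measurable_enorm R d measurableT B mB).
Qed.

(** A condition on the norm of the initial value constrains only the second component of [start], so
    equality of laws on [path_sigma] fixes the law of that norm. *)
Lemma integral_enorm_copy (W : R -> Om -> 'rV[R]_m) (X0 : Om -> 'rV[R]_d)
    (Wj : 'I_N -> R -> Om -> 'rV[R]_m) (X0j : 'I_N -> Om -> 'rV[R]_d) j :
  independent_copies P W X0 Wj X0j ->
  measurable_wrt (F 0) X0 -> measurable_wrt (F 0) (X0j j) ->
  (\int[P]_w (enorm (X0j j w) ^+ 2)%:E = \int[P]_w (enorm (X0 w) ^+ 2)%:E)%E.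
Proof.
move=> copies m0 mj.
have m0' := measurable_wrt_enorm m0; have mj' := measurable_wrt_enorm mj.
have msq : measurable_fun [set: measurableTypeR R] (fun r : measurableTypeR R => (r ^+ 2)%:E).
  by apply/measurable_EFinP; exact: measurable_funX.
have sq0 (r : measurableTypeR R) : r \in [set: measurableTypeR R] -> (0 <= (r ^+ 2)%:E)%E.
  by move=> _; rewrite lee_fin sqr_ge0.
transitivity (\int[pushforward P (fun w => enorm (X0j j w) : measurableTypeR R)]_r (r ^+ 2)%:E)%E.
  by rewrite ge0_integral_pushforward.
transitivity (\int[pushforward P (fun w => enorm (X0 w) : measurableTypeR R)]_r (r ^+ 2)%:E)%E; last first.
  by rewrite ge0_integral_pushforward.
apply: eq_measure_integral => B mB _.
apply: (ic_law copies j (A := [set p | B (enorm p.2)])).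
apply: sub_sigma_algebra; right; exists ((@enorm R d) @^-1` B) => //.
by rewrite -[X in <<s _ >> X]setTI; exact: (@measurable_enorm R d measurableT B mB).
Qed.

End random_vectors.

(** * Application to the particle system *)

Theorem theorem2p1 (R : realType) (dO : measure_display)
    (Om : measurableType dO) (P : probability Om R) (F : R -> set (set Om))
    (hF : is_filtration F) (hU : usual_conditions P F)
    (d m N : nat) (hN : (0 < N)%N)
    (b : 'rV[R]_d -> P2 R d -> 'rV[R]_d)
    (sigma : 'rV[R]_d -> P2 R d -> 'M[R]_(d, m))
    (b_borel : borel_coef b) (sigma_borel : borel_coef sigma)
    (b_lip : locally_lipschitz b) (sigma_lip : locally_lipschitz sigma)
    (W : R -> Om -> 'rV[R]_m) (X0 : Om -> 'rV[R]_d)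
    (hW : brownian_motion P F W)
    (X0_F0 : measurable_wrt (F 0) X0)
    (X0_neq0 : ~ {ae P, forall w, X0 w = 0})
    (X0_moments : forall p : R, 2 <= p ->
       ('E_P[fun w => powR (enorm (X0 w)) p] < +oo)%E)
    (Wj : 'I_N -> R -> Om -> 'rV[R]_m) (X0j : 'I_N -> Om -> 'rV[R]_d)
    (hWj : forall j, brownian_motion P F (Wj j))
    (X0j_F0 : forall j, measurable_wrt (F 0) (X0j j))
    (copies : independent_copies P W X0 Wj X0j)
    (X : 'I_N -> R -> Om -> 'rV[R]_d)
    (hX : particle_system P F hN b sigma Wj X0j X)
    (K1 K2 : R) (hK1 : 0 < K1) (hK2 : 0 < K2)
    (cond_i : forall (x y : 'rV[R]_d) (mu nu : P2 R d),
       2 * dotp (x - y) (b x mu - b y nu)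
         + frob (sigma x mu - sigma y nu) ^+ 2
       <= - K1 * enorm (x - y) ^+ 2 + K2 * W2 mu nu ^+ 2)
    (a1 a2 q : R) (ha1 : 0 < a1) (ha2 : 0 < a2) (hq : 2 <= q)
    (cond_ii : forall (x : 'rV[R]_d) (mu : P2 R d),
       2 * dotp x (b x mu) + (q - 1) * frob (sigma x mu) ^+ 2
       <= - a1 * enorm x ^+ 2 + a2 * calW2 mu ^+ 2)
    (ha : a2 < a1) :
  forall j : 'I_N, exists a : R,
    0 < a <= a1 - a2 /\
    (limf_esup (fun t : R =>
         (t^-1)%:E * lne 'E_P[fun w => (enorm (X j t w) ^+ 2)%R])
       (pinfty_nbhs R) <= (- a)%:E)%E.
Proof.
move=> j; exists (a1 - a2); split; first by rewrite subr_gt0 ha lexx.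
pose mu s w := empirical hN (fun i => X i s w).
(* The particles are flattened into one system of [N * d] scalar equations; the coordinates of a
   particle share its Brownian motion [Wj c.1]. *)
pose J : finType := ('I_N * 'I_d)%type.
have /choice[I hI] : forall j : 'I_N, exists I : 'I_d -> 'I_m -> R -> Om -> R,
    (forall i k, ito_integral P F (fun t w => Wj j t w 0 k)
       (fun s w => sigma (X j s w) (mu s w) i k) (I i k)) /\
    {ae P, forall w t i, 0 <= t ->
       X j t w 0 i = X0j j w 0 i
         + \int[lebesgue_measure]_(s in `[0%R, t]) b (X j s w) (mu s w) 0 i
         + \sum_(k < m) I i k t w}.
  by move=> j'; have [_ _ _] := hX j'.
pose x (c : J) t w := X c.1 t w 0 c.2.
pose x0 (c : J) w := X0j c.1 w 0 c.2.
pose beta (c : J) s w := b (X c.1 s w) (mu s w) 0 c.2.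
pose Sig (c : J) (k : 'I_m) s w := sigma (X c.1 s w) (mu s w) c.2 k.
pose II (c : J) (k : 'I_m) := I c.1 c.2 k.
have ito (c : J) k : ito_integral P F (fun t w => Wj c.1 t w 0 k) (Sig c k) (II c k).
  exact: (hI c.1).1.
have sumJ (f : 'I_N -> 'I_d -> R) : \sum_(c : J) f c.1 c.2 = \sum_j \sum_i f j i.
  by rewrite pair_bigA.
have enormE (Y : 'I_N -> 'rV[R]_d) : \sum_(c : J) Y c.1 0 c.2 ^+ 2 = \sum_j enorm (Y j) ^+ 2.
  by rewrite (sumJ (fun j i => Y j 0 i ^+ 2)); apply: eq_bigr => i _; rewrite enorm_sqr.
(* Summing [cond_ii] over the particles, the [N] copies of the averaged second moment add up to the
   total one, whence [a1 - a2]; and [q - 1 >= 1] dominates the factor 1 of the bracket. *)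
have dis s w : 2 * (\sum_c x c s w * beta c s w) + \sum_c \sum_k Sig c k s w ^+ 2 <=
    - (a1 - a2) * \sum_c x c s w ^+ 2.
  rewrite (enormE (fun j => X j s w)).
  rewrite (sumJ (fun j i => X j s w 0 i * b (X j s w) (mu s w) 0 i)).
  rewrite (sumJ (fun j i => \sum_k sigma (X j s w) (mu s w) i k ^+ 2)).
  have frobE (A : 'M[R]_(d, m)) : \sum_i \sum_k A i k ^+ 2 = frob A ^+ 2.
    rewrite sqr_sqrtr//; apply: sumr_ge0 => i _; apply: sumr_ge0 => k _; exact: sqr_ge0.
  under [X in _ + X <= _]eq_bigr do rewrite frobE.
  have cE : calW2 (mu s w) ^+ 2 = N%:R^-1 * \sum_j enorm (X j s w) ^+ 2.
    exact: calW2_empirical.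
  have : \sum_j (2 * dotp (X j s w) (b (X j s w) (mu s w)) + (q - 1) * frob (sigma (X j s w) (mu s w)) ^+ 2) <=
      \sum_j (- a1 * enorm (X j s w) ^+ 2 + a2 * calW2 (mu s w) ^+ 2).
    by apply: ler_sum => j' _; exact: cond_ii.
  rewrite cE; set c0 := a2 * _.
  rewrite !big_split/= -!mulr_sumr sumr_const card_ord {}/c0.
  have NE (V : R) : N%:R^-1 * (V *+ N) = V.
    by rewrite -[V *+ N]mulr_natl mulKf// pnatr_eq0 -lt0n.
  rewrite NE.
  have : 0 <= \sum_j frob (sigma (X j s w) (mu s w)) ^+ 2.
    by apply: sumr_ge0 => j' _; exact: sqr_ge0.
  move: hq; rewrite /dotp; nra.
have mom j' : (\int[P]_w (enorm (X0j j' w) ^+ 2)%:E < +oo)%E.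
  rewrite (integral_enorm_copy hF copies X0_F0 (X0j_F0 j')).
  have := X0_moments 2 (lexx 2); rewrite unlock.
  by under eq_integral do rewrite powR_mulrn ?enorm_ge0//.
have mX c t : 0 <= t -> measurable_fun [set: g_sigma_algebraType (F t)] (x c t).
  by move=> t0; apply: (adapted_coord hF c.2 t0); have [] := hX c.1.
have Ix0 c : P.-integrable setT (EFin \o (fun w => x0 c w ^+ 2)).
  apply: (@le_Rintegrable _ _ _ P setT measurableT _ (fun w => enorm (X0j c.1 w) ^+ 2)).
  - apply: measurable_funX; apply: (Fm_measurable hF (lexx 0)).
    exact: measurable_wrt_coord.
  - move=> w _; rewrite ger0_norm ?sqr_ge0// enorm_sqr (bigD1 c.2)//= lerDl.
    by apply: sumr_ge0 => i _; exact: sqr_ge0.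
  - apply/integrableP; split.
      apply/measurable_EFinP; apply: measurable_funX.
      exact: (measurable_wrt_enorm hF (X0j_F0 c.1)).
    by under eq_integral do rewrite /= ger0_norm ?sqr_ge0//; exact: mom.
pose E0 := \int[P]_w (\sum_c x0 c w ^+ 2).
have main T : 0 < T ->
    (\int[P]_w (\sum_c x c T w ^+ 2)%:E <= (expR (- ((a1 - a2) * T)) * E0)%:E)%E.
  move=> T0; have [S [aS hS]] := simple_approximation T0 ito.
  apply: (dissipative_sde_approx hF (lambda := a1 - a2) (beta := beta) (Sig := Sig)
    (I := II) (x0 := x0) (W := fun c => Wj c.1) T0 _ _ _ _ Ix0 _ aS) => //.
  - by rewrite subr_ge0 ltW.
  - by move=> c; exact: measurable_wrt_coord.
  - move=> c k t t0; have [aI _ _ _] := ito c k.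
    exact: ((measurable_wrtE hF _ t0).1 (aI t t0)).
  have sub0 : `[0, T]%classic `<=` [set t : R | 0 <= t].
    by move=> t /=; rewrite in_itv/= => /andP[].
  have cX : {ae P, forall w, forall j, {within `[0, T], continuous (X j ^~ w)}}.
    apply: filter_forall => j'; have [_ cXj _ _] := hX j'.
    by apply: filterS cXj => w; exact: continuous_subspaceW.
  have bX : {ae P, forall w, forall j i, lebesgue_measure.-integrable `[0, T]
      (fun s => (b (X j s w) (mu s w) 0 i)%:E)}.
    apply: filter_forall => j'; have [_ _ bXj _] := hX j'.
    by apply: filterS bXj => w h i; apply: h; exact: ltW.
  have sX : {ae P, forall w, forall c k,
      (\int[lebesgue_measure]_(s in `[0%R, T]) (Sig c k s w ^+ 2)%:E < +oo)%E}.
    apply: filter_forall => c; apply: filter_forall => k.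
    have [_ _ h _] := ito c k.
    by apply: filterS h => w; apply; exact: ltW.
  have eX : {ae P, forall w, forall j t i, 0 <= t ->
       X j t w 0 i = X0j j w 0 i
         + \int[lebesgue_measure]_(s in `[0%R, t]) b (X j s w) (mu s w) 0 i
         + \sum_(k < m) I j i k t w}.
    by apply: filter_forall => j'; exact: (hI j').2.
  apply: filterS3 (filterI hS cX) (filterI bX sX) eX.
  move=> w [Sw cw] [bw sw] ew; split => //.
  - move=> c s; apply: (@continuous_comp _ _ _ _ (fun z : 'rV[R]_d => z 0 c.2)).
      exact: cw.
    exact: coord_continuous.
  - by move=> c; exact: bw.
  - by move=> c k; exact: measurable_coef_path.
  - by move=> c t /andP[t0' _]; exact: ew.
(* One particle is bounded by the energy of the whole system, at the cost of the constant [E0],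
   which does not affect the exponential rate. *)
apply: (@limsup_log_le _ _ (a1 - a2) E0).
  by apply: Rintegral_ge0 => w _; apply: sumr_ge0 => c _; exact: sqr_ge0.
move=> t t0; rewrite unlock; apply/andP; split.
  by apply: integral_ge0 => w _; rewrite lee_fin sqr_ge0.
apply: le_trans (main t t0); apply: ge0_le_integral => //.
- by move=> w _; rewrite lee_fin sqr_ge0.
- apply/measurable_EFinP; rewrite (_ : (fun w => _) = (fun w => \sum_i x (j, i) t w ^+ 2)).
    apply: measurable_sum => i; apply: measurable_funX.
    exact: (Fm_measurable hF (ltW t0) (mX (j, i) t (ltW t0))).
  by apply/funext => w; rewrite enorm_sqr.
- apply/measurable_EFinP; apply: measurable_sum => c; apply: measurable_funX.
  exact: (Fm_measurable hF (ltW t0) (mX c t (ltW t0))).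
move=> w _; rewrite lee_fin (enormE (fun j => X j t w)) (bigD1 j)//= lerDl.
by apply: sumr_ge0 => i _; exact: sqr_ge0.
Qed.
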